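(* Let $G$ be a locally compact Hausdorff groupoid with Haar system $\alpha$ and let $L$ be a Fell line bundle over $G$ with associated circle extension $\Sigma$. There is a bijection between measurable representations of $L$ and $\mathbb T$-equivariant measurable representations of $\Sigma$.
   Context: Notation. $G$ has unit space $G^0$ (units identified with identity arrows), source and range maps $s,r$; $G^2$ is the space of composable pairs; $\mathbb T=\{z\in\mathbb C:|z|=1\}$. A Fell line bundle $L=(L_g)_{g\in G}$ over $G$ is a continuous, locally trivial field of one-dimensional Banach spaces over $G$ with continuous bilinear maps $L_g\times L_h\to L_{gh}$ for $(g,h)\in G^2$ and continuous conjugate-linear maps $L_g\to L_{g^{-1}}$, $a\mapsto a^*$, such that multiplication is associative, $(ab)^*=b^*a^*$, $a^{**}=a$, $\|ab\|\le\|a\|\|b\|$, $\|a^*a\|=\|a\|^2$, and $a^*a\ge0$ in the $C^*$-algebra $L_{s(g)}\cong\mathbb C$ for $a\in L_g$. The restriction of $L$ to $G^0$ is canonically $G^0\times\mathbb C$. $\Sigma=\{y\in\bigsqcup_{g}L_g:\ y^*y=1\in L_{s(g)}\cong\mathbb C\text{ for }y\in L_g\}$ (equivalently $yy^*=1$) is a topological groupoid with the multiplication and topology of $L$, unit space $G^0$ and $s(y)=s(g)$, $r(y)=r(g)$ for $y\in L_g$. $\mathbb T$ acts freely on $\Sigma$ by scalar multiplication with $\Sigma/\mathbb T\cong G$. $\Sigma$ carries the Haar system $f\mapsto\int_{G^x}\int_{\mathbb T}f(z\cdot y_g)\,dz\,d\alpha^x(g)$, where $y_g\in L_g\cap\Sigma$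 is arbitrary and $dz$ is normalised Haar measure. Measurable representation of $L$: a triple $(\nu,\mathcal H,S)$ of a measure $\nu$ on $G^0$ (only its class matters), a $\nu$-measurable field $\mathcal H=(\mathcal H_x)_{x\in G^0}$ of separable Hilbert spaces with $\mathcal H_x\ne0$ for $\nu$-almost all $x$, and linear maps $S_g\colon L_g\to\mathbb B(\mathcal H_{s(g)},\mathcal H_{r(g)})$ for all $g\in G$, such that $S_g(a_1)S_h(a_2)=S_{gh}(a_1a_2)$ for $(g,h)\in G^2$, $a_1\in L_g$, $a_2\in L_h$; $S_g(a)^*=S_{g^{-1}}(a^* )$; for each $x\in G^0$ the representation $S_x$ of $L_x\cong\mathbb C$ on $\mathcal H_x$ is nondegenerate; $g\mapsto S_g(f(g))\xi(g)$ is measurable for each compactly supported continuous section $f$ of $L$ and measurable section $\xi$ of $s^*\mathcal H$; and $\nu$ is quasi-invariant relative to $S$, meaning that the restriction of $\nu\circ\alpha=\int\alpha^x\,d\nu(x)$ to $\{g\in G:\mathcal H_{r(g)}\ne0\}$ is equivalent to its image under $g\mapsto g^{-1}$. Measurable representation of the groupoid $\Sigma$: a triple $(\nu,\mathcal H,(U_y)_{y\in\Sigma})$ of a measure $\nu$ on $G^0$ (only its class matters), a $\nu$-measurable field $\mathcal H=(\mathcal H_x)_{x\in G^0}$ of separable Hilbert spaces with $\mathcal H_x\ne0$ for $\nu$-almost all $x$, where $\nu$ is quasi-invariant for $\Sigma$ (the analogous condition with $\Sigma$ and its Haar system), and unitaries $U_y\colon\mathcal H_{s(y)}\to\mathcal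 H_{r(y)}$ with $U_{y_1}U_{y_2}=U_{y_1y_2}$ for composable $y_1,y_2$, depending measurably on $y$. It is $\mathbb T$-equivariant if $U_{z\cdot y}=z\cdot U_y$ for all $z\in\mathbb T$, $y\in\Sigma$. *)

(* Defs.v *)
From HB Require Import structures.
From mathcomp Require Import all_boot all_order all_algebra.
From mathcomp Require Import complex.
From mathcomp Require Import all_classical all_reals all_analysis.
Set Implicit Arguments.
Unset Strict Implicit.
Unset Printing Implicit Defensive.
Import Order.TTheory GRing.Theory Num.Theory.
Import numFieldNormedType.Exports.
Local Open Scope classical_set_scope.
Local Open Scope ring_scope.
Local Open Scope complex_scope.

(* The topology of the complex numbers lives on the alias [R[i]^o]. *)

(** * Radon measures *)

Definition borel (X : ptopologicalType) := g_sigma_algebraType (@open X).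

Section Radon.
Variable R : realType.

Definition radon (X : ptopologicalType)
    (m : {measure set (borel X) -> \bar R}) : Prop :=
  [/\ forall K : set X, compact K -> (m K < +oo)%E,
      forall A : set (borel X), measurable A ->
        m A = ereal_inf [set m U | U in [set U : set X | open U /\ A `<=` U]]
    & forall U : set X, open U ->
        m U = ereal_sup [set m K | K in [set K : set X | compact K /\ K `<=` U]]].

Definition measure_support (X : ptopologicalType)
    (m : {measure set (borel X) -> \bar R}) : set X :=
  [set x | forall U : set X, open U -> U x -> (0 < m U)%E].

Section Functionals.
Variable X : topologicalType.

Definition Cc (f : X -> R) : Prop :=
  continuous f /\ compact (closure [set x | f x != 0]).

(* A Radon measure that is only given by its integral [I] on C_c(X), such as
   an iterated integral, is handled through the outer measure that [I]
   induces as in the Riesz representation theorem.  Negligible means locally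
   negligible, and measurable means Caratheodory measurable, so that the
   space need not be sigma-compact and only the class of the measure matters. *)
Definition outer_measure_of (I : (X -> R) -> R) (A : set X) : \bar R :=
  ereal_inf
    [set ereal_sup [set (I f)%:E | f in
        [set f | [/\ Cc f, forall x, 0 <= f x <= 1
                   & closure [set x | f x != 0] `<=` U]]]
    | U in [set U : set X | open U /\ A `<=` U]].

Definition negligible_for (I : (X -> R) -> R) (A : set X) : Prop :=
  forall K : set X, compact K -> outer_measure_of I (A `&` K) = 0%E.

Definition equivalent (I J : (X -> R) -> R) : Prop :=
  forall A : set X, negligible_for I A <-> negligible_for J A.

Definition measurable_for (I : (X -> R) -> R) (f : X -> R[i]) : Prop :=
  forall V : set R[i]^o, open V -> (outer_measure_of I).-caratheodory (f @^-1` V).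

End Functionals.

Definition integral_of (X : ptopologicalType)
    (m : {measure set (borel X) -> \bar R}) : (X -> R) -> R :=
  fun f => \int[m]_(x in setT) f x.

End Radon.

(** * Topological groupoids *)

Record groupoid_data := GroupoidData {
  obj : ptopologicalType;
  arr :> ptopologicalType;
  src : arr -> obj;
  rng : arr -> obj;
  gunit : obj -> arr;
  ginv : arr -> arr;
  gmul : arr -> arr -> arr  (* only meaningful on composable pairs *)
}.
Arguments src {g}.
Arguments rng {g}.
Arguments gunit {g}.
Arguments ginv {g}.
Arguments gmul {g}.

Definition composable (G : groupoid_data) (g h : G) : Prop := src g = rng h.

Definition is_groupoid (G : groupoid_data) : Prop :=
  [/\ [/\ forall x : obj G, src (gunit x : G) = x,
          forall x : obj G, rng (gunit x : G) = x,
          forall g h : G, composable g h -> src (gmul g h) = src h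
        & forall g h : G, composable g h -> rng (gmul g h) = rng g],
      [/\ forall g h k : G, composable g h -> composable h k ->
            gmul (gmul g h) k = gmul g (gmul h k),
          forall g : G, gmul (gunit (rng g)) g = g
        & forall g : G, gmul g (gunit (src g)) = g]
    & [/\ forall g : G, src (ginv g) = rng g,
          forall g : G, rng (ginv g) = src g,
          forall g : G, gmul (ginv g) g = gunit (src g)
        & forall g : G, gmul g (ginv g) = gunit (rng g)]].

Definition is_topological (G : groupoid_data) : Prop :=
  [/\ continuous (@src G), continuous (@rng G), continuous (@gunit G),
      continuous (@ginv G)
    & {within [set p : G * G | composable p.1 p.2],
        continuous (fun p : G * G => gmul p.1 p.2)}].

Record topGroupoid := TopGroupoid {
  groupoid_of :> groupoid_data;
  groupoidP : is_groupoid groupoid_of;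
  topologicalP : is_topological groupoid_of
}.

Section HaarSystem.
Variables (R : realType) (G : groupoid_data).

Definition haar_system
    (alpha : obj G -> {measure set (borel G) -> \bar R}) : Prop :=
  [/\ forall x, radon (alpha x),
      forall x, measure_support (alpha x) = rng @^-1` [set x],
      forall f : G -> R, Cc f ->
        continuous (fun x : obj G => integral_of (alpha x) f : R)
    & forall (f : G -> R) (g : G), Cc f ->
        \int[alpha (src g)]_(h in rng @^-1` [set src g]) f (gmul g h) =
        \int[alpha (rng g)]_(h in rng @^-1` [set rng g]) f h].

Definition haar_integral (alpha : obj G -> {measure set (borel G) -> \bar R}) :
    obj G -> (G -> R) -> R :=
  fun x f => \int[alpha x]_(g in rng @^-1` [set x]) f g.

(* The integral of the measure nu o alpha on the arrow space. *)
Definition induced (nu : {measure set (borel (obj G)) -> \bar R})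
    (haar : obj G -> (G -> R) -> R) : (G -> R) -> R :=
  fun f => \int[nu]_(x in setT) haar x f.

End HaarSystem.

(** * Fields of Hilbert spaces *)

Section Hilbert.
Variable R : realType.

Record hilbert := Hilbert {
  hilbert_sort :> completeNormedModType R[i];
  dot : hilbert_sort -> hilbert_sort -> R[i];
  dot_linear : forall (a : R[i]) (u v w : hilbert_sort),
    dot (a *: u + v) w = a * dot u w + dot v w;
  dot_conj : forall u v : hilbert_sort, dot v u = Num.conj (dot u v);
  dot_norm : forall u : hilbert_sort, dot u u = `|u| ^+ 2
}.

Definition separable_hilbert (H : hilbert) : Prop :=
  exists2 D : set H, countable D & dense D.

Definition lspan (V : lmodType R[i]) (A : set V) : set V :=
  [set v | exists n (c : 'I_n -> R[i]) (w : 'I_n -> V),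
    (forall i, A (w i)) /\ v = \sum_(i < n) c i *: w i].

Definition bounded_operator (H K : hilbert) (T : H -> K) : Prop :=
  linear T /\ continuous T.

Definition unitary_operator (H K : hilbert) (T : H -> K) : Prop :=
  [/\ linear T, forall u v, dot (T u) (T v) = dot u v
    & forall w, exists u, T u = w].

Record hilbert_field (X : Type) := HilbertField {
  hfield :> X -> hilbert;
  hsections : set (forall x, hfield x)
}.
Arguments hsections {X}.

Definition hcast (X : Type) (H : hilbert_field X) (x y : X) (e : x = y) :
    H x -> H y :=
  fun v => ecast z (H z) e v.

(* Measurable fields in the sense of Dixmier; [hsections] is the space of
   measurable sections. *)
Definition measurable_field (X : topologicalType) (I : (X -> R) -> R)
    (H : hilbert_field X) : Prop :=
  [/\ forall x, separable_hilbert (H x),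
      hsections H (fun x => 0) /\
      (forall (a : R[i]) (u v : forall x, H x), hsections H u ->
        hsections H v -> hsections H (fun x => a *: u x + v x)),
      forall u, hsections H u -> measurable_for I (fun x => `|u x|),
      forall v : (forall x, H x),
        (forall u, hsections H u -> measurable_for I (fun x => dot (v x) (u x))) ->
        hsections H v
    & exists2 e : nat -> forall x, H x, (forall n, hsections H (e n))
        & forall x, dense (lspan (range (fun n => e n x)))].

(* Measurable sections of the pullback of [H] along [p : Y -> X]. *)
Definition measurable_section (X Y : topologicalType) (I : (Y -> R) -> R)
    (p : Y -> X) (H : hilbert_field X) (v : forall y, H (p y)) : Prop :=
  forall u, hsections H u -> measurable_for I (fun y => dot (v y) (u (p y))).

Definition nonzero_at (X : Type) (H : hilbert_field X) : set X :=
  [set x | exists v : H x, v != 0].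

(* [m] stands for the measure nu o alpha; both sides of the equivalence speak
   of its restriction to the arrows at which the field is nonzero, the right
   one after transport along the inversion. *)
Definition quasi_invariant (G : groupoid_data) (m : (G -> R) -> R)
    (H : hilbert_field (obj G)) : Prop :=
  let E := [set g : G | nonzero_at H (rng g)] in
  forall A : set G,
    negligible_for m (A `&` E) <-> negligible_for m (ginv @^-1` A `&` E).

End Hilbert.

Arguments hsections {R X}.
Arguments measurable_section {R X Y}.

(** * Measurable representations of groupoids *)

Section GroupoidRepresentations.
Variables (R : realType) (G : groupoid_data) (haar : obj G -> (G -> R) -> R).

Implicit Types (nu : {measure set (borel (obj G)) -> \bar R})
  (H : hilbert_field R (obj G)).

(* In conditions relating vectors in fibres of [H] at objects that are only
   propositionally equal, the proofs of these equalities are quantified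
   universally; for composable arrows they always exist and are unique. *)
Definition is_groupoid_rep nu H (U : forall y : G, H (src y) -> H (rng y)) :=
  [/\ radon nu /\ measurable_field (integral_of nu) H,
      negligible_for (integral_of nu) (~` nonzero_at H),
      quasi_invariant (induced nu haar) H,
      (forall y, unitary_operator (U y)) /\
      (forall (y1 y2 : G) (e : src y1 = rng y2)
          (es : src (gmul y1 y2) = src y2) (er : rng (gmul y1 y2) = rng y1)
          (xi : H (src y2)),
        U (gmul y1 y2) (hcast (esym es) xi) =
        hcast (esym er) (U y1 (hcast (esym e) (U y2 xi))))
    & forall xi : (forall y : G, H (src y)),
        measurable_section (induced nu haar) src H xi ->
        measurable_section (induced nu haar) rng H (fun y => U y (xi y))].

Record groupoid_rep := GroupoidRep {
  gr_measure : {measure set (borel (obj G)) -> \bar R};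
  gr_field : hilbert_field R (obj G);
  gr_op : forall y : G, gr_field (src y) -> gr_field (rng y);
  gr_axioms : is_groupoid_rep gr_measure gr_op
}.

(* Only the class of the measure matters. *)
Inductive groupoid_rep_equiv : groupoid_rep -> groupoid_rep -> Prop :=
  GroupoidRepEquiv nu nu' H (U : forall y : G, H (src y) -> H (rng y))
      (hU : is_groupoid_rep nu U) (hU' : is_groupoid_rep nu' U) :
    equivalent (integral_of nu) (integral_of nu') ->
    groupoid_rep_equiv (GroupoidRep hU) (GroupoidRep hU').

End GroupoidRepresentations.

Arguments gr_op {R G haar}.

(** * Fell line bundles *)

(* A field of normed spaces with a topology on its total space. *)
Record bundle_data (R : realType) (X : topologicalType) := BundleData {
  fiber :> X -> normedModType R[i];
  bundle_open : set_system {x : X & fiber x};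
  bundle_openT : bundle_open setT;
  bundle_openI : setI_closed bundle_open;
  bundle_open_bigU : forall (I : Type) (f : I -> set {x : X & fiber x}),
    (forall i, bundle_open (f i)) -> bundle_open (\bigcup_i f i)
}.

(* An alias, because the library puts the disjoint union topology on
   sigma-types. *)
Definition total_space (R : realType) (X : topologicalType) (L : bundle_data R X) :
  Type := {x : X & L x}.

Section Total.
Variables (R : realType) (X : topologicalType) (L : bundle_data R X).

HB.instance Definition _ := Choice.copy (total_space L) {x : X & L x}.
HB.instance Definition _ := isOpenTopological.Build (total_space L)
  (@bundle_openT R X L) (@bundle_openI R X L) (@bundle_open_bigU R X L).

Definition tot (x : X) (a : L x) : total_space L := existT _ x a.
Definition bproj (t : total_space L) : X := projT1 t.
Definition bvect (t : total_space L) : L (bproj t) := projT2 t.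

(* Near each point there are a section [sigma] of norm one and coordinates [c]
   with respect to it; in particular the fibres are one-dimensional, hence
   Banach spaces, and the norm is continuous on the total space. *)
Definition locally_trivial_line_bundle : Prop :=
  continuous bproj /\
  forall x0 : X, exists (U : set X) (sigma : forall x, L x)
      (c : total_space L -> R[i]^o),
    [/\ open U /\ U x0,
        forall x, U x -> `|sigma x| = 1,
        forall x (a : L x), U x -> a = c (tot a) *: sigma x,
        {within [set q : X * R[i]^o | U q.1],
          continuous (fun q : X * R[i]^o =>
            tot ((q.2 : R[i]) *: sigma q.1) : total_space L)}
      & {within [set t : total_space L | U (bproj t)], continuous c}].

Definition Cc_section (f : forall x, L x) : Prop :=
  continuous (fun x => tot (f x) : total_space L) /\
  compact (closure [set x | f x != 0]).

End Total.

Record fell_line_bundle (R : realType) (G : topGroupoid) := FellLineBundle {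
  fell_bundle :> bundle_data R G;
  (* only meaningful on composable pairs *)
  fmul : forall g h : G, fell_bundle g -> fell_bundle h -> fell_bundle (gmul g h);
  fstar : forall g : G, fell_bundle g -> fell_bundle (ginv g);
  (* the identity of the C*-algebra at a unit; it exists and is unique, and it
     provides the identification of that algebra with the complex numbers *)
  fone : forall x : obj G, fell_bundle (gunit x);

  fell_trivial : locally_trivial_line_bundle fell_bundle;
  fmul_linearl : forall (g h : G) (c : R[i]) (a a' : fell_bundle g)
    (b : fell_bundle h), composable g h ->
    fmul (c *: a + a') b = c *: fmul a b + fmul a' b;
  fmul_linearr : forall (g h : G) (c : R[i]) (a : fell_bundle g)
    (b b' : fell_bundle h), composable g h ->
    fmul a (c *: b + b') = c *: fmul a b + fmul a b';
  fmul_continuous :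
    {within [set p : total_space fell_bundle * total_space fell_bundle |
               composable (bproj p.1) (bproj p.2)],
      continuous (fun p : total_space fell_bundle * total_space fell_bundle =>
        tot (fmul (bvect p.1) (bvect p.2)) : total_space fell_bundle)};
  fstar_linear : forall (g : G) (c : R[i]) (a a' : fell_bundle g),
    fstar (c *: a + a') = Num.conj c *: fstar a + fstar a';
  fstar_continuous :
    continuous (fun t : total_space fell_bundle =>
      tot (fstar (bvect t)) : total_space fell_bundle);
  fmulA : forall (g h k : G) (a : fell_bundle g) (b : fell_bundle h)
    (c : fell_bundle k), composable g h -> composable h k ->
    tot (fmul (fmul a b) c) = tot (fmul a (fmul b c));
  fstarM : forall (g h : G) (a : fell_bundle g) (b : fell_bundle h),
    composable g h -> tot (fstar (fmul a b)) = tot (fmul (fstar b) (fstar a));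
  fstarK : forall (g : G) (a : fell_bundle g), tot (fstar (fstar a)) = tot a;
  fmul_norm : forall (g h : G) (a : fell_bundle g) (b : fell_bundle h),
    composable g h -> `|fmul a b| <= `|a| * `|b|;
  fstar_norm : forall (g : G) (a : fell_bundle g),
    `|fmul (fstar a) a| = `|a| ^+ 2;
  fone_l : forall (x : obj G) (a : fell_bundle (gunit x)),
    tot (fmul (fone x) a) = tot a;
  fone_r : forall (x : obj G) (a : fell_bundle (gunit x)),
    tot (fmul a (fone x)) = tot a;
  fstar_ge0 : forall (g : G) (a : fell_bundle g),
    exists2 c : R[i], 0 <= c &
      tot (fmul (fstar a) a) = tot (c *: fone (src g))
}.

(** * The circle extension *)

Section CircleExtension.
Variables (R : realType) (G : topGroupoid) (L : fell_line_bundle R G).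

Definition circle_set : set (total_space L) :=
  [set t | tot (fmul (fstar (bvect t)) (bvect t)) =
           tot (fone L (src (bproj t))) :> total_space L].

Definition circle := set_type circle_set.

Lemma inv_unit (x : obj G) : ginv (gunit x) = gunit x :> G.
Proof.
have [[su ru _ _] [_ _ mulu] [si _ invg _]] := groupoidP G.
rewrite -[LHS]mulu si ru; have := invg (gunit x); rewrite su.
exact.
Qed.

Lemma fone_circle (x : obj G) : tot (fone L x) \in circle_set.
Proof.
have [[su ru _ _] [_ _ _] [_ _ _ _]] := groupoidP G.
have cast (y : G) (e : y = gunit x) (a : L y) :
    exists a' : L (gunit x), tot a = tot a'.
  by move: a; rewrite e => a; exists a.
have mulE (g g' h : G) (a : L g) (a' : L g') (b : L h) :
    tot a = tot a' :> total_space L -> tot (fmul a b) = tot (fmul a' b) :> total_space L.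
  move=> e; pose F (t : total_space L) : total_space L := tot (fmul (bvect t) b).
  exact: (congr1 F e).
have mulEr (g h h' : G) (a : L g) (b : L h) (b' : L h') :
    tot b = tot b' :> total_space L -> tot (fmul a b) = tot (fmul a b') :> total_space L.
  move=> e; pose F (t : total_space L) : total_space L := tot (fmul a (bvect t)).
  exact: (congr1 F e).
pose st (t : total_space L) : total_space L := tot (fstar (bvect t)).
have [a Ea] := cast _ (inv_unit x) (fstar (fone L x)).
have E : tot (fmul (fstar (fone L x)) (fone L x)) =
    tot (fstar (fone L x)) :> total_space L.
  by rewrite (mulE _ _ _ _ _ _ Ea) fone_r Ea.
have cu : composable (ginv (gunit x) : G) (gunit x).
  by rewrite /composable inv_unit su ru.
have selfadj : tot (fstar (fone L x)) = tot (fone L x) :> total_space L.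
  have := congr1 st E; rewrite /st /= (fstarM _ _ cu) /bvect/=.
  by rewrite (mulEr _ _ _ _ _ _ (fstarK (fone L x))) E fstarK.
rewrite inE /circle_set /= /bvect /bproj /= su.
by rewrite E selfadj.
Qed.

Definition circle_unit (x : obj G) : circle :=
  exist (fun t => t \in circle_set) (tot (fone L x)) (fone_circle x).

HB.instance Definition _ := Topological.on circle.
HB.instance Definition _ := isPointed.Build circle (circle_unit point).

Definition cproj (y : circle) : G := bproj (val y).
Definition cvect (y : circle) : L (cproj y) := bvect (val y).

(* [circle_set] is closed under the operations below (for the product on
   composable pairs, for scaling by z with |z| = 1), so the default values of [insubd] are irrelevant. *)
Definition circle_mul (y1 y2 : circle) : circle :=
  insubd y1 (tot (fmul (cvect y1) (cvect y2))).
Definition circle_inv (y : circle) : circle :=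
  insubd y (tot (fstar (cvect y))).
Definition circle_scale (z : R[i]) (y : circle) : circle :=
  insubd y (tot (z *: cvect y)).

Definition circle_extension : groupoid_data :=
  @GroupoidData (obj G) circle (fun y => src (cproj y))
    (fun y => rng (cproj y)) circle_unit circle_inv circle_mul.

Definition expi (t : R) : R[i] := cos t +i* sin t.

(* The integral over the circle of [f (z . y)] for any [y] above [g]. *)
Definition circle_average (f : circle -> R) (g : G) : R :=
  xget 0 [set v | exists2 y : circle, cproj y = g &
    v = (2 * pi)^-1 *
        \int[@lebesgue_measure R]_(t in `[0, 2 * pi]) f (circle_scale (expi t) y)].

Definition circle_haar (alpha : obj G -> {measure set (borel G) -> \bar R}) :
    obj circle_extension -> (circle_extension -> R) -> R :=
  fun x f => haar_integral alpha x (circle_average f).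

End CircleExtension.

(** * Representations of Fell line bundles *)

Section FellRepresentations.
Variables (R : realType) (G : topGroupoid) (L : fell_line_bundle R G).
Variable alpha : obj G -> {measure set (borel G) -> \bar R}.

Implicit Types (nu : {measure set (borel (obj G)) -> \bar R})
  (H : hilbert_field R (obj G)).

Definition is_fell_rep nu H
    (S : forall g : G, L g -> H (src g) -> H (rng g)) : Prop :=
  let m := induced nu (haar_integral alpha) in
  [/\ [/\ radon nu, measurable_field (integral_of nu) H
        & negligible_for (integral_of nu) (~` nonzero_at H)],
      (forall g (a : L g), bounded_operator (S g a)) /\
      (forall g (c : R[i]) (a b : L g) (xi : H (src g)),
        S g (c *: a + b) xi = c *: S g a xi + S g b xi),
      [/\ forall (g h : G) (a : L g) (b : L h) (e : src g = rng h)
              (es : src (gmul g h) = src h) (er : rng (gmul g h) = rng g)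
              (xi : H (src h)),
            S (gmul g h) (fmul a b) (hcast (esym es) xi) =
            hcast (esym er) (S g a (hcast (esym e) (S h b xi))),
          forall (g : G) (a : L g) (es : src (ginv g) = rng g)
              (er : rng (ginv g) = src g) (xi : H (src g)) (eta : H (rng g)),
            dot (S g a xi) eta =
            dot xi (hcast er (S (ginv g) (fstar a) (hcast (esym es) eta)))
        & forall x : obj G, dense (lspan [set w : H (rng (gunit x : G)) |
            exists (a : L (gunit x)) (xi : H (src (gunit x : G))),
              w = S (gunit x) a xi])],
      forall (f : forall g, L g) (xi : forall g : G, H (src g)),
        Cc_section f -> measurable_section m src H xi ->
        measurable_section m rng H (fun g => S g (f g) (xi g))
    & quasi_invariant m H].

Record fell_rep := FellRep {
  fr_measure : {measure set (borel (obj G)) -> \bar R};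
  fr_field : hilbert_field R (obj G);
  fr_op : forall g : G, L g -> fr_field (src g) -> fr_field (rng g);
  fr_axioms : is_fell_rep fr_measure fr_op
}.

Inductive fell_rep_equiv : fell_rep -> fell_rep -> Prop :=
  FellRepEquiv nu nu' H (S : forall g : G, L g -> H (src g) -> H (rng g))
      (hS : is_fell_rep nu S) (hS' : is_fell_rep nu' S) :
    equivalent (integral_of nu) (integral_of nu') ->
    fell_rep_equiv (FellRep hS) (FellRep hS').

Definition circle_rep := groupoid_rep (circle_haar (L := L) alpha).

Definition equivariant (rho : circle_rep) : Prop :=
  forall (z : R[i]) (y : circle_extension L), `|z| = 1 ->
  forall (es : src (circle_scale z y : circle_extension L) = src y)
    (er : rng (circle_scale z y : circle_extension L) = rng y)
    (xi : gr_field rho (src y)),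
    gr_op rho (circle_scale z y) (hcast (esym es) xi) =
    hcast (esym er) (z *: gr_op rho y xi).

Definition equivariant_rep := {rho : circle_rep | equivariant rho}.

Definition equivariant_rep_equiv (rho rho' : equivariant_rep) : Prop :=
  groupoid_rep_equiv (sval rho) (sval rho').

Inductive restricts_to : fell_rep -> circle_rep -> Prop :=
  RestrictsTo nu H (S : forall g : G, L g -> H (src g) -> H (rng g))
      (U : forall y : circle_extension L, H (src y) -> H (rng y))
      (hS : is_fell_rep nu S)
      (hU : is_groupoid_rep (circle_haar (L := L) alpha) nu U) :
    (forall (y : circle_extension L) (xi : H (src y)),
      U y xi = S (cproj y) (cvect y) xi) ->
    restricts_to (FellRep hS) (GroupoidRep hU).

End FellRepresentations.

(** * Equivalence classes *)

(* Predicates are used instead of [set T] for universe reasons. *)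
Definition eqv_classes (T : Type) (E : T -> T -> Prop) : Type :=
  {C : T -> Prop | exists x, C = E x}.

Definition eqv_class (T : Type) (E : T -> T -> Prop) (x : T) : eqv_classes E :=
  exist _ (E x) (ex_intro _ x erefl).

(* Main.v *)
Require Import Defs.
From HB Require Import structures.
From mathcomp Require Import all_boot all_order all_algebra.
From mathcomp Require Import complex.
From mathcomp Require Import all_classical all_reals all_analysis.
From mathcomp Require Import lra ring measurable_realfun.
Set Implicit Arguments.
Unset Strict Implicit.
Unset Printing Implicit Defensive.
Import Order.TTheory GRing.Theory Num.Theory.
Import numFieldNormedType.Exports.
Local Open Scope classical_set_scope.
Local Open Scope ring_scope.

(** A representation [S] of the bundle yields unitary operators at the unit
    vectors of the bundle, that is, at the points of the circle extension.
    Conversely, every element of a fibre is a multiple [z *: y] of a unit vector,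
    and for an equivariant representation [U] the operator [z *: U y] does not
    depend on this decomposition ([ext_opE]). The two constructions are inverse to
    each other ([restrict_repK], [extend_repK]) and keep the field and the measure,
    so they induce mutually inverse maps between the classes. The algebraic axioms
    correspond: the identity of a fibre over a unit acts as the identity because
    the representation is nondegenerate ([tot_op_one]), hence unit vectors act by
    unitaries. What takes work is that quasi-invariance and measurability, which
    refer to measures on two different spaces, correspond as well.

    Both measures are functionals on compactly supported continuous functions: the
    one on arrows integrates over the fibres of the range map and then over the
    unit space; the one on the circle extension first averages over circles. They
    induce outer measures for which open sets are measurable
    ([content_sigma_subadditive], [caratheodory_open]), and measurability is a
    local property ([caratheodory_local]). If null sets pull back to null sets
    along a continuous map, so do measurable sets ([cara_preimage]); this holds
    for maps along whose fibres one integrates ([fibre_null]), that is, for the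
    range map and for the projection of the circle extension. A set of arrows and
    its preimage in the circle extension have the same outer measure
    ([content_saturated]), so that nullity and measurability of the former can be
    read off from the latter.

    Quasi-invariance says that inversion preserves null sets. It descends by
    testing preimages of sets of arrows. It lifts because inversion is isometric on
    circles; in place of Fubini's theorem, [circle_inv_null] separates the circles
    on which a neighbourhood of a null set is large, which lie over a small set of
    arrows ([content_thick]), from those on which it is small ([content_thin]).

    Measurability of [y |-> U y (xi y)] is tested against measurable sections. Moving
    [U y] to the other side of the inner product turns the matrix coefficient into
    the inner product of two measurable sections, which is measurable by
    polarization ([measurable_section_dot]); the second section is measurable
    because locally [U y] is a continuous multiple of [S] at a section of compact
    support ([local_unit_section]). In the other direction, the matrix coefficients
    of [S] pull back to continuous multiples of those of [U]
    ([ext_op_measurable]). *)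

(** * Compactness and cut-off functions *)

(** If [K] did not have the property, the sets whose complement in [K] has it
    would form a filter; it would cluster at a point of [K], where the local
    hypothesis contradicts it. All finite covering arguments below go through
    this principle, which avoids explicit finite subcovers. *)
Lemma compact_induction (X : topologicalType) (K : set X) (P : set X -> Prop) :
  compact K -> P set0 -> (forall A B, A `<=` B -> P B -> P A) ->
  (forall A B, P A -> P B -> P (A `|` B)) ->
  (forall x, K x -> exists2 U, nbhs x U & P U) -> P K.
Proof.
move=> cK P0 Psub PU Ploc; apply: contrapT => nPK.
pose F : set_system X := [set A | P (K `\` A)].
have FF : ProperFilter F.
  split; first by rewrite /F /= setD0.
  split; first by rewrite /F /= setDT.
    move=> A B FA FB; rewrite /F /= setDIr; exact: PU.
  move=> A B AB; apply: Psub; exact: setDS.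
have FK : F K by rewrite /F /= setDv.
have [x [Kx clx]] := cK F FF FK.
have [U nU pU] := Ploc x Kx.
have FU : F (~` U) by rewrite /F /= setDE setCK; apply: Psub pU => y [].
by have [y []] := clx _ _ FU nU.
Qed.

Section CompactSupport.
Variables (R : realType) (X : topologicalType).
Implicit Types (f g : X -> R).

Definition supp f : set X := closure [set x | f x != 0].

Lemma supp_out f x : ~ supp f x -> f x = 0.
Proof. by move=> h; apply/eqP; apply/negP => /negP fx; apply: h; apply: subset_closure. Qed.

Lemma supp_sub f (C : set X) : closed C -> (forall x, f x != 0 -> C x) -> supp f `<=` C.
Proof. by move=> cC fC; rewrite (closure_id C).1//; exact: closureS. Qed.

Lemma Cc_supp f (C : set X) : continuous f -> compact C -> closed C ->
  (forall x, f x != 0 -> C x) -> Cc f.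
Proof.
move=> cf kC cC fC; split=> //.
by apply: (subclosed_compact _ kC); [exact: closed_closure | exact: supp_sub].
Qed.

Lemma Cc_cst0 : Cc (fun _ : X => 0 : R).
Proof.
apply: (@Cc_supp _ set0) => //;
  [exact: cst_continuous | exact: compact0 | exact: closed0 |].
by move=> x; rewrite eqxx.
Qed.

Lemma Cc_comb f g (h : X -> R) : Cc f -> Cc g -> continuous h ->
  (forall x, f x = 0 -> g x = 0 -> h x = 0) -> Cc h.
Proof.
move=> [cf kf] [cg kg] ch hz; apply: (@Cc_supp _ (supp f `|` supp g)) => //.
- exact: compactU.
- by apply: closedU; exact: closed_closure.
- move=> x; apply: contraNP => /not_orP[/supp_out f0 /supp_out g0].
  by rewrite hz.
Qed.

Lemma continuous_lin (a : R) f g : continuous f -> continuous g ->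
  continuous (fun x => a * f x + g x).
Proof.
move=> cf cg x; apply: cvgD; last exact: cg.
by apply: cvgM; [exact: cvg_cst | exact: cf].
Qed.

Lemma continuous_mul f g : continuous f -> continuous g ->
  continuous (fun x => f x * g x).
Proof. by move=> cf cg x; apply: cvgM; [exact: cf | exact: cg]. Qed.

Lemma continuous_1B f : continuous f -> continuous (fun x => 1 - f x).
Proof. by move=> cf x; apply: cvgB; [exact: cvg_cst | exact: cf]. Qed.

Lemma Cc_lin (a : R) f g : Cc f -> Cc g -> Cc (fun x => a * f x + g x).
Proof.
move=> cf cg; apply: (Cc_comb cf cg); first exact: continuous_lin cf.1 cg.1.
by move=> x -> ->; rewrite mulr0 addr0.
Qed.

Lemma Cc_mul f g : Cc f -> continuous g -> Cc (fun x => f x * g x).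
Proof.
move=> cf cg; apply: (Cc_comb cf cf); first exact: continuous_mul cf.1 cg.
by move=> x -> _; rewrite mul0r.
Qed.

Lemma Cc_max f g : Cc f -> Cc g -> Cc (fun x => Num.max (f x) (g x)).
Proof.
move=> cf cg; apply: (Cc_comb cf cg); last by move=> x -> ->; rewrite maxxx.
by move=> x; apply: continuous_max; [exact: cf.1 | exact: cg.1].
Qed.

Lemma continuous_open (Y : topologicalType) (f : X -> Y) (U : set Y) :
  continuous f -> open U -> open (f @^-1` U).
Proof. by move=> /continuousP; exact. Qed.

Lemma continuous_closed (Y : topologicalType) (f : X -> Y) (A : set Y) :
  continuous f -> closed A -> closed (f @^-1` A).
Proof.
by move=> cf cA; rewrite -openC preimage_setC; apply: continuous_open => //;
  exact: closed_openC.
Qed.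

Lemma closed_equalizer (Y : topologicalType) (f g : X -> Y) : hausdorff_space Y ->
  continuous f -> continuous g -> closed [set x | f x = g x].
Proof.
move=> hY cf cg x clx; apply: hY => A B nA nB.
have nAB : nbhs x (f @^-1` A `&` g @^-1` B) by apply: filterI; [exact: cf | exact: cg].
have [z [/= fg [Az Bz]]] := clx _ nAB.
by exists (f z); split => //; rewrite fg.
Qed.

End CompactSupport.

Section Urysohn.
Variables (R : realType) (X : topologicalType).
Hypotheses (lcX : locally_compact [set: X]) (hX : hausdorff_space X).

(** A compact neighbourhood is regular, because it is Hausdorff. *)
Lemma lc_open_nbhs (x : X) (U : set X) : open U -> U x ->
  exists W, [/\ open W, W x, compact (closure W) & closure W `<=` U].
Proof.
move=> oU Ux; case: (@lcX x) => // D; rewrite withinET => nD [kD cD].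
have [V nV clV] : filter_from (nbhs x) closure (U `&` D).
  apply: (compact_regular hX kD nD); apply: filterI => //.
  exact: open_nbhs_nbhs.
exists V°; split.
- exact: open_interior.
- exact: nV.
- apply: (subclosed_compact _ kD); first exact: closed_closure.
  by move=> y /(closureS (@interior_subset _ V))/clV[].
- by move=> y /(closureS (@interior_subset _ V))/clV[].
Qed.

(** Complete regularity gives the function near each point; the maximum of two
    such functions serves the union of two sets, so compactness concludes. *)
Lemma urysohn_Cc (K U : set X) : compact K -> open U -> K `<=` U ->
  exists (f : X -> R),
    [/\ Cc f, forall x, 0 <= f x <= 1, supp f `<=` U &
        exists2 W : set X, open W & K `<=` W /\ forall x, W x -> f x = 1].
Proof.
move=> kK oU KU.
apply: (@compact_induction X K (fun A => exists f : X -> R,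
    [/\ Cc f, forall x, 0 <= f x <= 1, supp f `<=` U &
        exists2 W : set X, open W & A `<=` W /\ forall x, W x -> f x = 1])) => //.
- exists (fun=> 0); split; [exact: Cc_cst0 | by move=> x; rewrite lexx ler01 | |].
    by apply: (subset_trans _ (@sub0set _ _)); apply: supp_sub;
     [exact: closed0 | move=> x; rewrite eqxx].
  by exists set0; [exact: open0 | split].
- move=> A B AB [f [cf f01 fU [W oW [BW fW]]]]; exists f; split => //.
  by exists W => //; split => //; exact: subset_trans BW.
- move=> A B [f [cf f01 fU [V oV [AV fV]]]] [g [cg g01 gU [W oW [BW gW]]]].
  exists (fun x => Num.max (f x) (g x)); split.
  + exact: Cc_max.
  + by move=> x; rewrite le_max ge_max; have /andP[-> ->] := f01 x; case/andP: (g01 x).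
  + apply: (@subset_trans _ (supp f `|` supp g)); last by move=> x [/fU|/gU].
    apply: supp_sub; first by apply: closedU; exact: closed_closure.
    move=> x; apply: contraNP => /not_orP[/supp_out -> /supp_out ->].
    by rewrite maxxx.
  + exists (V `|` W); first exact: openU.
    split; first exact: setUSS.
    move=> x [/fV|/gW] e; apply/eqP; rewrite eq_le le_max ge_max e lexx.
      by rewrite /= andbT; case/andP: (g01 x).
    by rewrite orbT !andbT; case/andP: (f01 x).
- move=> x /KU Ux.
  have [W [oW Wx kW WU]] := lc_open_nbhs oU Ux.
  have : uniform_separator [set x] (~` W).
    apply: (@locally_compact_completely_regular X R lcX hX); first exact: open_closedC.
    by apply.
  move/(@uniform_separatorP _ R) => [f [cf f01 fx fW]].
  (* [f] is only known to vanish at [x] itself; rescaling makes the cut-off equal to 1 where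
     [f < 1/2], which is a neighbourhood of [x]. *)
  pose g y := Num.max 0 (Num.min 1 (2 - 2 * f y)) : R.
  have cg : continuous g.
    move=> y; apply: (@continuous_max _ _ (fun=> 0) (fun y =>
      Num.min 1 (2 - 2 * f y))); first exact: cvg_cst.
    apply: (@continuous_min _ _ (fun=> 1) (fun y => (2 - 2 * f y))); first exact: cvg_cst.
    by apply: cvgB; [exact: cvg_cst|apply: cvgM; [exact: cvg_cst|exact: cf]].
  have gW y : g y != 0 -> W y.
    apply: contraNP => nWy; have -> : g y = Num.max 0 (Num.min 1 (2 - 2 * f y)) by [].
    rewrite (fW (f y)); last by exists y.
    by rewrite mulr1 subrr min_r ?ler01// maxxx.
  have sgU : supp g `<=` U.
    apply: subset_trans WU; apply: supp_sub; first exact: closed_closure.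
    by move=> y /gW; exact: subset_closure.
  have open_f : open (f @^-1` [set t | t < 1/2]).
    by apply: continuous_open => //; exact: open_lt.
  exists (f @^-1` [set t | t < 1/2]).
    apply: open_nbhs_nbhs; split => //=.
    by rewrite (fx (f x)); [rewrite divr_gt0 | exists x].
  exists g; split => //.
  + apply: (@Cc_supp _ _ _ (closure W)) => //; first exact: closed_closure.
    by move=> y /gW; exact: subset_closure.
  + by move=> y; rewrite /g le_max lexx ge_max ler01 ge_min lexx.
  + exists (f @^-1` [set t | t < 1/2]) => //; split => // y /= fy.
    rewrite /g min_l; first by rewrite max_r ?ler01.
    lra.
Qed.

End Urysohn.

(** * The outer measure of a positive functional *)

Lemma closed_setD (X : topologicalType) (A U : set X) :
  closed A -> open U -> closed (A `\` U).
Proof. by move=> cA oU; rewrite setDE; apply: closedI => //; exact: open_closedC. Qed.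

Lemma open_setD (X : topologicalType) (U A : set X) : open U -> closed A -> open (U `\` A).
Proof. by move=> oU cA; rewrite setDE; apply: openI => //; exact: closed_openC. Qed.

Lemma open_bigsetU (X : topologicalType) (U : nat -> set X) n :
  (forall i, open (U i)) -> open (\big[setU/set0]_(i < n) U i).
Proof. by move=> oU; elim/big_ind: _ => //; [exact: open0 | exact: openU]. Qed.

(** A Radon measure in the guise of its integral on C_c(X). *)
Definition positive_functional (R : realType) (X : topologicalType)
    (I : (X -> R) -> R) : Prop :=
  (forall (a : R) f g, Cc f -> Cc g -> I (fun x => a * f x + g x) = a * I f + I g) /\
  (forall f, Cc f -> (forall x, 0 <= f x) -> 0 <= I f).

(** The functions over which [outer_measure_of] takes the supremum. *)
Definition subordinate (R : realType) (X : topologicalType) (f : X -> R) (U : set X) :=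
  [/\ Cc f, forall x, 0 <= f x <= 1 & supp f `<=` U].

Section Content.
Variables (R : realType) (X : topologicalType).
Hypotheses (lcX : locally_compact [set: X]) (hX : hausdorff_space X).
Variable I : (X -> R) -> R.
Hypothesis PI : positive_functional I.
Implicit Types (f g : X -> R) (U V W : set X).

Local Notation mu := (outer_measure_of I).
Local Notation inner U := (ereal_sup [set (I f)%:E | f in
        [set f | [/\ Cc f, forall x, 0 <= f x <= 1
                   & closure [set x | f x != 0] `<=` U]]]).

Lemma functional0 : I (fun=> 0) = 0.
Proof.
have := PI.1 (-1) _ _ (Cc_cst0 R X) (Cc_cst0 R X).
have -> : (fun x : X => -1 * 0 + 0) = (fun=> 0 : R) by apply/funext => x;
  rewrite mulr0 addr0.
by move=> h; rewrite {1}h mulN1r addNr.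
Qed.

Lemma functionalZ (a : R) f : Cc f -> I (fun x => a * f x) = a * I f.
Proof.
move=> cf; rewrite -[RHS]addr0 -functional0 -PI.1//; last exact: Cc_cst0.
by congr I; apply/funext => x; rewrite addr0.
Qed.

Lemma functionalD f g : Cc f -> Cc g -> I (fun x => f x + g x) = I f + I g.
Proof.
by move=> cf cg; rewrite -[I f]mul1r -PI.1//; congr I; apply/funext => x; rewrite mul1r.
Qed.

Lemma CcD f g : Cc f -> Cc g -> Cc (fun x => f x + g x).
Proof.
by move=> cf cg; have := Cc_lin 1 cf cg; congr Cc; apply/funext => x; rewrite mul1r.
Qed.

Lemma functional_le f g : Cc f -> Cc g -> (forall x, f x <= g x) -> I f <= I g.
Proof.
move=> cf cg fg; have := PI.2 _ (Cc_lin (-1) cf cg).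
rewrite PI.1// mulN1r addrC subr_ge0; apply.
by move=> x; rewrite mulN1r addrC subr_ge0.
Qed.

Lemma subordinate0 U : subordinate (fun=> 0 : R) U.
Proof.
split; [exact: Cc_cst0 | by move=> x; rewrite lexx ler01 |].
apply: (subset_trans _ (@sub0set _ _)); apply: supp_sub;
  [exact: closed0 | by move=> x; rewrite eqxx].
Qed.

Lemma subordinateS f U V : U `<=` V -> subordinate f U -> subordinate f V.
Proof. by move=> UV [cf f01 fU]; split => //; exact: subset_trans UV. Qed.

Lemma inner_ge0 U : (0 <= inner U)%E.
Proof.
apply: ereal_sup_ubound; exists (fun=> 0); first exact: subordinate0.
by rewrite functional0.
Qed.

Lemma innerS U V : U `<=` V -> (inner U <= inner V)%E.
Proof.
by move=> UV; apply: ereal_sup_le => _ [f fU <-]; exists f => //; apply: subordinateS fU.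
Qed.

Lemma content_openE U : open U -> mu U = inner U.
Proof.
move=> oU; apply/eqP; rewrite eq_le; apply/andP; split.
  by apply: ereal_inf_lbound; exists U => //; split.
by apply: le_ereal_inf_tmp => _ [V [oV UV] <-]; exact: innerS.
Qed.

Lemma content_ge f U : open U -> subordinate f U -> ((I f)%:E <= mu U)%E.
Proof. by move=> oU fU; rewrite content_openE//; apply: ereal_sup_ubound; exists f. Qed.

Lemma content_le U (c : \bar R) : open U ->
  (forall f, subordinate f U -> ((I f)%:E <= c)%E) -> (mu U <= c)%E.
Proof.
by move=> oU h; rewrite content_openE//; apply: ge_ereal_sup => _ [f fU <-]; exact: h.
Qed.

Lemma content_approx U (c : \bar R) : open U -> (c < mu U)%E ->
  exists2 f, subordinate f U & (c < (I f)%:E)%E.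
Proof. by move=> oU; rewrite content_openE// => /ereal_sup_gt[_ [f fU <-]]; exists f. Qed.

Lemma contentS A B : A `<=` B -> (mu A <= mu B)%E.
Proof.
move=> AB; apply: le_ereal_inf_tmp => _ [U [oU BU] <-].
by apply: ereal_inf_lbound; exists U => //; split => //; exact: subset_trans BU.
Qed.

Lemma content_ge0 A : (0 <= mu A)%E.
Proof. by apply: le_ereal_inf_tmp => _ [U _ <-]; exact: inner_ge0. Qed.

Lemma content0 : mu set0 = 0%E.
Proof.
apply/eqP; rewrite eq_le content_ge0 andbT; apply: content_le; first exact: open0.
move=> f [cf _ f0]; rewrite (_ : f = fun=> 0) ?functional0//.
by apply/funext => x; apply: supp_out => /f0.
Qed.

Lemma outer_regular A (c : \bar R) : (mu A < c)%E ->
  exists U, [/\ open U, A `<=` U & (mu U < c)%E].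
Proof.
move=> /ereal_inf_lt[_ [U [oU AU] <-] Uc]; exists U; split => //.
by rewrite content_openE.
Qed.

(** A cut-off that is 1 near the part of the support outside [V] splits [f]. *)
Lemma subordinate_split f U V : open U -> open V -> subordinate f (U `|` V) ->
  exists g h, [/\ subordinate g U, subordinate h V & f = (fun x => g x + h x)].
Proof.
move=> oU oV [cf f01 fUV].
have kK : compact (supp f `\` V).
  apply: (subclosed_compact _ cf.2); last by move=> x [].
  by apply: closed_setD => //; exact: closed_closure.
have KU : supp f `\` V `<=` U by move=> x [/fUV[]].
have [k [ck k01 kU [W oW [KW kW]]]] := urysohn_Cc R lcX hX kK oU KU.
have k01' x := andP (k01 x); have f01' x := andP (f01 x).
exists (fun x => f x * k x), (fun x => f x * (1 - k x)).
have ck1 : continuous (fun x => 1 - k x) := continuous_1B ck.1.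
split.
- split.
  + by apply: Cc_mul => //; exact: ck.1.
  + move=> x; have [a0 a1] := k01' x; have [b0 b1] := f01' x.
    by rewrite mulr_ge0//= mulr_ile1.
  + apply: subset_trans kU; apply: supp_sub; first exact: closed_closure.
    by move=> x; rewrite mulf_eq0 => /norP[_ kx]; exact: subset_closure.
- split.
  + exact: Cc_mul.
  + move=> x; have [a0 a1] := k01' x; have [b0 b1] := f01' x.
    by rewrite mulr_ge0 ?subr_ge0//= mulr_ile1 ?subr_ge0// gerBl.
  + apply: (@subset_trans _ (supp f `\` W)).
      apply: supp_sub; first by apply: closed_setD => //; exact: closed_closure.
      move=> x; rewrite mulf_eq0 => /norP[fx kx]; split; first exact: subset_closure.
      by move=> /kW kx1; move: kx; rewrite kx1 subrr eqxx.
    move=> x [sx Wx]; apply: contrapT => Vx; apply: Wx; exact: KW.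
- by apply/funext => x; rewrite -mulrDr addrC subrK mulr1.
Qed.

Lemma contentU_open U V : open U -> open V -> (mu (U `|` V) <= mu U + mu V)%E.
Proof.
move=> oU oV; apply: content_le; first exact: openU.
move=> f /(subordinate_split oU oV)[g [h [gU hV ->]]].
rewrite functionalD//; [|by case: gU|by case: hV].
by rewrite EFinD; apply: leeD; exact: content_ge.
Qed.

Lemma content_bigsetU_open (U : nat -> set X) n : (forall i, open (U i)) ->
  (mu (\big[setU/set0]_(i < n) U i) <= \sum_(i < n) mu (U i))%E.
Proof.
move=> oU; elim: n => [|n ih]; first by rewrite !big_ord0 content0.
rewrite !big_ord_recr /=; apply: le_trans (leeD ih (lexx _)).
by apply: contentU_open => //; apply: open_bigsetU => i; exact: oU.
Qed.

(** The support of a function subordinate to the union is compact, so finitely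
    many of the sets already contain it. *)
Lemma content_bigcup_open (U : nat -> set X) : (forall i, open (U i)) ->
  (mu (\bigcup_i U i) <= \sum_(i <oo) mu (U i))%E.
Proof.
move=> oU; apply: content_le; first by apply: bigcup_open.
move=> f [cf f01 fU].
have [n fn] : exists n, supp f `<=` \big[setU/set0]_(i < n) U i.
  apply: (@compact_induction X (supp f)
    (fun A => exists n, A `<=` \big[setU/set0]_(i < n) U i) cf.2).
  - by exists 0%N.
  - by move=> A B AB [n Bn]; exists n; exact: subset_trans Bn.
  - move=> A B [n An] [m Bm]; exists (maxn n m) => x [/An|/Bm];
      apply: subset_bigsetU; [exact: leq_maxl | exact: leq_maxr].
  - move=> x /fU[i _ Ux]; exists (U i); first exact: open_nbhs_nbhs.
    by exists i.+1; rewrite big_ord_recr; right.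
apply: (@le_trans _ _ (mu (\big[setU/set0]_(i < n) U i))).
  apply: content_ge; first by apply: open_bigsetU => i; exact: oU.
  by split.
apply: (le_trans (content_bigsetU_open n oU)).
rewrite -(big_mkord xpredT (fun i => mu (U i))).
by apply: nneseries_lim_ge => *; exact: content_ge0.
Qed.

Lemma content_sigma_subadditive : sigma_subadditive mu.
Proof.
move=> A; apply/lee_addgt0Pr => e e0.
have [foo|] := pselect (\sum_(i <oo) mu (A i) = +oo)%E; first by rewrite foo leey.
move=> nfoo; have fin i : (mu (A i) < +oo)%E.
  rewrite ltey; apply/eqP => Ai; apply: nfoo; apply/eqP; rewrite -leye_eq -Ai.
  apply: le_trans (nneseries_lim_ge i.+1 _); last by move=> *; exact: content_ge0.
  rewrite big_mkord big_ord_recr /=; apply: leeDr.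
  by apply: sume_ge0 => *; exact: content_ge0.
have ei i : 0 < e / (2 ^ i.+1)%:R by rewrite divr_gt0// ltr0n expn_gt0.
have h i : exists U, [/\ open U, A i `<=` U & (mu U < mu (A i) + (e / (2 ^ i.+1)%:R)%:E)%E].
  apply: outer_regular; rewrite lteDl ?lte_fin// ge0_fin_numE//; exact: content_ge0.
have [U hU] := choice h.
apply: (@le_trans _ _ (mu (\bigcup_i U i))).
  by apply: contentS; apply: subset_bigcup => i _; have [_ ] := hU i.
apply: (le_trans (content_bigcup_open _)); first by move=> i; have [] := hU i.
apply: le_trans (epsilon_trick _ _ (ltW e0)); last by move=> i; exact: content_ge0.
apply: lee_nneseries; first by move=> *; exact: content_ge0.
by move=> i _; have [_ _ /ltW] := hU i.
Qed.

Definition radon_outer : {outer_measure set X -> \bar R} :=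
  HB.pack mu (isOuterMeasure.Build R X mu content0 content_ge0 contentS
    content_sigma_subadditive).

Lemma contentU A B : (mu (A `|` B) <= mu A + mu B)%E.
Proof. exact: (outer_measureU2 radon_outer). Qed.

(** Functions with disjoint supports inside [V] add up to a function that is
    again subordinate to [V]. *)
Lemma content_remainder f V : open V -> subordinate f V ->
  ((I f)%:E + mu (V `\` supp f) <= mu V)%E.
Proof.
move=> oV [cf f01 fV].
have oW : open (V `\` supp f) by apply: open_setD => //; exact: closed_closure.
rewrite -leeBrDl//; apply: content_le => // g [cg g01 gV].
rewrite leeBrDl// -EFinD -functionalD//.
apply: content_ge => //; split; first exact: CcD.
- move=> x; have [sx|/supp_out ->] := pselect (supp f x); last by rewrite add0r.
  by rewrite (@supp_out _ _ g) ?addr0//; move=> /gV[].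
- apply: (@subset_trans _ (supp f `|` supp g)); last by move=> x [/fV|/gV[]].
  apply: supp_sub; first by apply: closedU; exact: closed_closure.
  move=> y; apply: contraNP => /not_orP[/supp_out -> /supp_out ->].
  by rewrite addr0.
Qed.

(** Outer regularity: the infimum that defines the outer measure of an arbitrary
    test set runs over open sets. *)
Lemma caratheodory_of_open A :
  (forall V, open V -> (mu V < +oo)%E -> (mu (V `&` A) + mu (V `\` A) <= mu V)%E) ->
  mu.-caratheodory A.
Proof.
move=> h; apply: (@le_caratheodory_measurable _ _ radon_outer) => Y /=.
apply: le_ereal_inf_tmp => _ [V [oV YV] <-]; rewrite -content_openE//.
apply: (@le_trans _ _ (mu (V `&` A) + mu (V `\` A))%E).
  by apply: leeD; apply: contentS; [exact: setSI | exact: setSI].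
have [/h|] := boolP (mu V < +oo)%E; first exact.
by rewrite -leNgt leye_eq => /eqP ->; rewrite leey.
Qed.

Lemma caratheodory_open U : open U -> mu.-caratheodory U.
Proof.
move=> oU; apply: caratheodory_of_open => V oV Vfin.
have fin : mu (V `\` U) \is a fin_num.
  rewrite ge0_fin_numE ?content_ge0//; apply: le_lt_trans Vfin; apply: contentS.
  exact: subDsetl.
rewrite -leeBrDr//; apply: content_le; first exact: openI.
move=> f fVU; rewrite leeBrDr//.
apply: le_trans (content_remainder oV (subordinateS _ fVU)); last exact: subIsetl.
by rewrite leeD2l//; apply: contentS; apply: setDS => x; case: fVU => _ _ /[apply] -[].
Qed.

Lemma caratheodory0 N : mu N = 0%E -> mu.-caratheodory N.
Proof.
move=> N0; apply: (@le_caratheodory_measurable _ _ radon_outer) => Y /=.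
rewrite (_ : mu (Y `&` N) = 0%E) ?add0e; first by apply: contentS; exact: subIsetl.
by apply/eqP; rewrite eq_le content_ge0 andbT -N0; apply: contentS; exact: subIsetr.
Qed.

(** A cut-off that is 1 near [K] dominates every function subordinate to the set
    where it is 1. *)
Lemma content_compact K : compact K -> (mu K < +oo)%E.
Proof.
move=> kK; have [f [cf f01 _ [W oW [KW fW]]]] :=
  urysohn_Cc R lcX hX kK openT (@subsetT _ K).
apply: (@le_lt_trans _ _ (I f)%:E); last exact: ltry.
apply: (le_trans (contentS KW)); apply: content_le => // g [cg g01 gW].
rewrite lee_fin; apply: functional_le => // x.
have [/gW/fW ->|/supp_out ->] := pselect (supp g x); first by case/andP: (g01 x).
by case/andP: (f01 x).
Qed.

(** Up to small measure, an open set of finite measure is the support of a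
    function subordinate to it, and finitely many of the given neighbourhoods
    cover this compact support. *)
Lemma caratheodory_local A :
  (forall x, exists W, [/\ open W, W x & mu.-caratheodory (A `&` W)]) ->
  mu.-caratheodory A.
Proof.
move=> h; apply: caratheodory_of_open => V oV Vfin; apply/lee_addgt0Pr => e e0.
have Vnum : mu V \is a fin_num by rewrite ge0_fin_numE// content_ge0.
have [f fV fe] : exists2 f, subordinate f V & (mu V - e%:E < (I f)%:E)%E.
  apply: content_approx => //; rewrite lteBlDr//; by rewrite lteDl.
have [W [oW fW mW]] : exists W, [/\ open W, supp f `<=` W & mu.-caratheodory (A `&` W)].
  have [cf _ _] := fV.
  apply: (@compact_induction X (supp f)
    (fun B => exists W, [/\ open W, B `<=` W & mu.-caratheodory (A `&` W)]) cf.2).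
  - exists set0; split => //; first exact: open0.
    by rewrite setI0; apply: caratheodory_open; exact: open0.
  - by move=> B C BC [W [oW CW mW]]; exists W; split => //; exact: subset_trans CW.
  - move=> B C [W [oW BW mW]] [W' [oW' CW' mW']]; exists (W `|` W'); split.
    + exact: openU.
    + exact: setUSS.
    + by rewrite setIUr; exact: (@caratheodory_measurable_setU _ _ radon_outer).
  - by move=> x _; have [W [oW Wx mW]] := h x; exists W; [by apply: open_nbhs_nbhs;
      split|by exists W; split].
have small : (mu (V `\` supp f) <= e%:E)%E.
  have := content_remainder oV fV; rewrite -leeBrDl//.
  by move=> /le_trans; apply; rewrite leeBlDr// addeC -leeBlDr//; exact: ltW.
rewrite [leRHS](_ : _ = (mu (V `&` (A `&` W)) + mu (V `&` ~` (A `&` W)) + e%:E)%E);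
  last by rewrite -mW.
apply: (@le_trans _ _ (mu (V `&` (A `&` W)) + e%:E + mu (V `&` ~` (A `&` W)))%E);
  last by rewrite addeAC.
apply: leeD; last by apply: contentS; apply: setIS; apply: subsetC; exact: subIsetl.
apply: le_trans (leeD (lexx _) small); apply: le_trans (contentU _ _).
apply: contentS => x [Vx Ax]; have [/fW Wx|] := pselect (supp f x); first by left.
by right.
Qed.

End Content.

(** * Measurable complex functions *)

Local Open Scope complex_scope.

Lemma within_continuous_open (X Y : topologicalType) (W : set X) (f : X -> Y)
    (V : set Y) :
  open W -> {within W, continuous f} -> open V -> open (W `&` f @^-1` V).
Proof.
move=> oW /continuousP cf oV; have /open_subspaceP [B oB EB] := cf V oV.
by rewrite setIC -EB; exact: openI.
Qed.

Section ComplexBase.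
Variable R : realType.

Lemma normC_real (t : R) : `|t%:C| = `|t|%:C.
Proof. by rewrite normc_def /= expr0n /= addr0 sqrtr_sqr. Qed.

Lemma normC_i : `|0 +i* 1 : R[i]| = 1.
Proof. by rewrite normc_def /= expr0n add0r expr1n sqrtr1. Qed.

Lemma complex_ball (z : R[i]^o) (U : set R[i]^o) : nbhs z U ->
  exists2 r : R, 0 < r & forall w : R[i], `|z - w| < r%:C -> U w.
Proof.
move/nbhs_ballP => [e /= e0 eU].
have [er ei] : e = (complex.Re e)%:C /\ 0 < complex.Re e.
  by case: e e0 {eU} => a b; rewrite ltcE /= => /andP[/eqP -> ->].
by exists (complex.Re e) => // w; rewrite -er => zw; apply: eU.
Qed.

(** A countable base of the complex plane: with it, a continuous function of two
    measurable functions is measurable. *)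
Definition rat_ball (q : rat * rat * rat) : set R[i]^o :=
  [set w : R[i] | `|(ratr q.1.1 : R) +i* (ratr q.1.2 : R) - w| < (ratr q.2 : R)%:C].

Lemma rat_ball_open q : open (rat_ball q).
Proof.
have -> : rat_ball q = ball (((ratr q.1.1 : R) +i* (ratr q.1.2 : R)) :
  R[i]^o) ((ratr q.2 : R)%:C).
  by [].
exact: ball_open.
Qed.

Lemma rat_ball_base (z : R[i]^o) (U : set R[i]^o) : nbhs z U ->
  exists q, rat_ball q z /\ rat_ball q `<=` U.
Proof.
move=> /complex_ball[r r0 rU].
have [q /andP[q0 qr]] : exists q : rat, 0 < (ratr q : R) < r / 2.
  by have [q] := @rat_in_itvoo R 0 (r/2) (divr_gt0 r0 (ltr0n _ 2)); exists q.
have hq t : exists a : rat, `|ratr a - t| < (ratr q : R) / 2.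
  have [a] : exists a, ratr a \in `]t - ratr q / 2, t + ratr q / 2[.
    by apply: rat_in_itvoo; lra.
  by rewrite in_itv/= => at_; exists a; rewrite ltr_distlC; lra.
have [a ha] := hq (complex.Re z); have [b hb] := hq (complex.Im z).
exists (a, b, q).
have zab : `|((ratr a : R) +i* (ratr b : R)) - z| < (ratr q : R)%:C.
  have -> : ((ratr a : R) +i* (ratr b : R)) - z =
      (ratr a - complex.Re z)%:C + (0 +i* 1) * (ratr b - complex.Im z)%:C.
    by case: (z) => c d; simpc.
  apply: le_lt_trans (ler_normD _ _) _.
  rewrite normrM normC_i mul1r !normC_real -rmorphD ltcR; lra.
split => // w /= hw; apply: rU.
have -> : z - w = (z - ((ratr a : R) +i* (ratr b : R))) +
    (((ratr a : R) +i* (ratr b : R)) - w) by rewrite addrA subrK.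
apply: le_lt_trans (ler_normD _ _) _.
have -> : r%:C = (r/2)%:C + (r/2)%:C by rewrite -rmorphD -splitr.
apply: ltrD.
  by rewrite distrC; apply: lt_trans zab _; rewrite ltcR.
by apply: lt_trans hw _; rewrite ltcR.
Qed.

End ComplexBase.

Section Measurable.
Variables (R : realType) (X : topologicalType).
Hypotheses (lcX : locally_compact [set: X]) (hX : hausdorff_space X).
Variable I : (X -> R) -> R.
Hypothesis PI : positive_functional I.

Local Notation mu := (outer_measure_of I).
Local Notation M := (mu.-caratheodory).
Local Notation om := (radon_outer lcX hX PI).

Lemma caraC A : M A -> M (~` A).
Proof. exact: (@caratheodory_measurable_setC _ _ om). Qed.

Lemma caraI A B : M A -> M B -> M (A `&` B).
Proof. exact: (@caratheodory_measurable_setI _ _ om). Qed.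

Lemma caraD A B : M A -> M B -> M (A `\` B).
Proof. exact: (@caratheodory_measurable_setD _ _ om). Qed.

Lemma cara_bigcup (A : nat -> set X) : (forall n, M (A n)) -> M (\bigcup_n A n).
Proof. exact: (@caratheodory_measurable_bigcup _ _ om). Qed.

Lemma cara_bigcap (A : nat -> set X) : (forall n, M (A n)) -> M (\bigcap_n A n).
Proof.
by move=> mA; rewrite -(setCK (\bigcap_n _)) setC_bigcap; apply: caraC;
  apply: cara_bigcup => n; exact: caraC.
Qed.

Lemma cara_open U : open U -> M U.
Proof. exact: (caratheodory_open lcX hX PI). Qed.

Lemma cara_closed A : closed A -> M A.
Proof. by move=> cA; rewrite -(setCK A); apply: caraC; apply: cara_open;
  exact: closed_openC. Qed.

Lemma cara_countable (T : countType) (A : T -> set X) (P : T -> Prop) :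
  (forall t, P t -> M (A t)) -> M [set x | exists2 t, P t & A t x].
Proof.
move=> mA; pose B n : set X := [set x | exists t, [/\ unpickle n = Some t, P t & A t x]].
have -> : [set x | exists2 t, P t & A t x] = \bigcup_n B n.
  apply/seteqP; split => [x [t Pt Atx]|x [n _ [t [_ Pt Atx]]]]; last by exists t.
  by exists (pickle t) => //; exists t; rewrite pickleK.
apply: cara_bigcup => n; case E : (unpickle n : option T) => [t|]; last first.
  rewrite (_ : B n = set0); first by apply: cara_open; exact: open0.
  by apply/seteqP; split => // x [t []]; rewrite E.
have [Pt|nPt] := pselect (P t); last first.
  rewrite (_ : B n = set0); first by apply: cara_open; exact: open0.
  by apply/seteqP; split => // x [u []]; rewrite E => -[<-].
rewrite (_ : B n = A t); first exact: mA.
by apply/seteqP; split => [x [u []]|x Ax]; [rewrite E => -[<-] | exists t].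
Qed.

(** Measurability on a part of the space, for functions that are only controlled
    locally, such as coordinates in a chart. *)
Definition measurable_on (W : set X) (f : X -> R[i]) :=
  forall V : set R[i]^o, open V -> M (W `&` f @^-1` V).

Lemma measurable_onT f : measurable_on setT f <-> measurable_for I f.
Proof. by split => h V /h; rewrite setTI. Qed.

Lemma measurable_onS W W' f : M W -> W `<=` W' -> measurable_on W' f -> measurable_on W f.
Proof.
move=> mW WW' h V /h mV; rewrite (_ : _ `&` _ = W `&` (W' `&` f @^-1` V));
  first exact: caraI.
by apply/seteqP; split => x; [move=> [Wx fx]; split => //; split => //;
  exact: WW' | move=> [? []]].
Qed.

Lemma measurable_for_on W f : M W -> measurable_for I f -> measurable_on W f.
Proof. by move=> mW /measurable_onT; exact: measurable_onS. Qed.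

Lemma measurable_on_ext W f g : (forall x, W x -> f x = g x) ->
  measurable_on W f -> measurable_on W g.
Proof.
move=> fg h V /h; rewrite (_ : W `&` f @^-1` V = W `&` g @^-1` V)//.
by apply/seteqP; split => x [Wx] /=; rewrite fg.
Qed.

Lemma measurable_for_local f :
  (forall x, exists W, [/\ open W, W x & measurable_on W f]) -> measurable_for I f.
Proof.
move=> h V oV; apply: (caratheodory_local lcX hX PI) => x.
have [W [oW Wx mW]] := h x; exists W; split => //.
by rewrite setIC; exact: mW.
Qed.

Lemma measurable_on_continuous W (f : X -> R[i]^o) : open W ->
  {within W, continuous f} -> measurable_on W f.
Proof. by move=> oW cf V oV; apply: cara_open; exact: within_continuous_open. Qed.

(** The preimage of an open set is a countable union of sets on which both
    functions range in rational balls. *)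
Lemma measurable_on_comp2 W (f g : X -> R[i]) (phi : R[i]^o * R[i]^o -> R[i]^o) :
  continuous phi -> M W -> measurable_on W f -> measurable_on W g ->
  measurable_on W (fun x => phi (f x, g x)).
Proof.
move=> cphi mW mf mg V oV.
rewrite (_ : _ `&` _ = [set x | exists2 q : (rat * rat * rat) * (rat * rat * rat),
    rat_ball q.1 `*` rat_ball q.2 `<=` phi @^-1` V &
    ((W `&` f @^-1` rat_ball q.1) `&` (W `&` g @^-1` rat_ball q.2)) x]).
  apply: cara_countable => q _; apply: caraI; [apply: mf|apply: mg]; exact: rat_ball_open.
apply/seteqP; split => [x [Wx /= Vx]|x [q qV [[Wx fx] [_ gx]]]]; last first.
  by split => //; apply: qV.
have : nbhs (f x : R[i]^o, g x : R[i]^o) (phi @^-1` V).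
  by apply: cphi; apply: open_nbhs_nbhs.
move=> [[A B] [/= nA nB] AB].
have [p [pf pA]] := rat_ball_base nA; have [q [qg qB]] := rat_ball_base nB.
exists (p, q) => //= -[a b] [/= /pA Aa /qB Bb]; exact: AB.
Qed.

Lemma measurable_for_comp2 (f g : X -> R[i]) (phi : R[i]^o * R[i]^o -> R[i]^o) :
  continuous phi -> measurable_for I f -> measurable_for I g ->
  measurable_for I (fun x => phi (f x, g x)).
Proof.
move=> cphi /measurable_onT mf /measurable_onT mg; apply/measurable_onT.
by apply: measurable_on_comp2 => //; apply: cara_open; exact: openT.
Qed.

Lemma measurable_for_comp (f : X -> R[i]) (phi : R[i]^o -> R[i]^o) :
  continuous phi -> measurable_for I f -> measurable_for I (fun x => phi (f x)).
Proof.
by move=> cphi mf V oV; apply: (mf (phi @^-1` V)); exact: continuous_open.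
Qed.

Lemma measurable_onM W f g : M W -> measurable_on W f -> measurable_on W g ->
  measurable_on W (fun x => f x * g x).
Proof.
move=> mW mf mg; apply: (@measurable_on_comp2 W f g (fun p => p.1 * p.2)) => //.
by move=> p; apply: cvgM; [exact: cvg_fst | exact: cvg_snd].
Qed.

Lemma measurable_forM f g : measurable_for I f -> measurable_for I g ->
  measurable_for I (fun x => f x * g x).
Proof.
move=> mf mg; apply: (@measurable_for_comp2 f g (fun p => p.1 * p.2)) => //.
by move=> p; apply: cvgM; [exact: cvg_fst | exact: cvg_snd].
Qed.

Lemma measurable_forD f g : measurable_for I f -> measurable_for I g ->
  measurable_for I (fun x => f x + g x).
Proof.
move=> mf mg; apply: (@measurable_for_comp2 f g (fun p => p.1 + p.2)) => //.
by move=> p; apply: cvgD; [exact: cvg_fst | exact: cvg_snd].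
Qed.

Lemma measurable_for_cst (c : R[i]) : measurable_for I (fun=> c).
Proof.
move=> V oV; rewrite preimage_cst; case: ifP => _; apply: cara_open;
  [exact: openT|exact: open0].
Qed.

Lemma measurable_forZ c f : measurable_for I f -> measurable_for I (fun x => c * f x).
Proof. by move=> mf; apply: measurable_forM => //; exact: measurable_for_cst. Qed.

(** Preimages of open sets are countable unions of preimages of half-open
    intervals with rational ends. *)
Lemma measurable_for_real (f : X -> R[i]) : (forall x, 0 <= f x) ->
  (forall t : R, 0 <= t -> M [set x | t%:C < f x]) -> measurable_for I f.
Proof.
move=> f0 mf V oV.
have mf' t : M [set x | t%:C < f x].
  have [/mf //|t0] := leP 0 t.
  rewrite (_ : [set x | _] = setT); first by apply: cara_open; exact: openT.
  by apply/seteqP; split => // x _ /=; apply: lt_le_trans (f0 x); rewrite (ltcR t 0).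
rewrite (_ : f @^-1` V = [set x | exists2 q : rat * rat,
    (forall r : R, ratr q.1 < r -> r <= ratr q.2 -> V r%:C) &
    ([set x | (ratr q.1)%:C < f x] `\` [set x | (ratr q.2)%:C < f x]) x]).
  by apply: cara_countable => q _; exact: caraD.
have fr x : f x = (complex.Re (f x))%:C.
  by have := f0 x; case: (f x) => a b; rewrite lecE /= => /andP[/eqP ->].
apply/seteqP; split => x /=.
  move=> Vx; have : nbhs (f x : R[i]^o) V by apply: open_nbhs_nbhs.
  move=> /complex_ball[r r0 rV].
  have [a] : exists a, ratr a \in `]complex.Re (f x) - r, complex.Re (f x)[.
    by apply: rat_in_itvoo; rewrite gtrBl.
  rewrite in_itv/= => /andP[ra ar].
  have [b] : exists b, ratr b \in `]complex.Re (f x), complex.Re (f x) + r[.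
    by apply: rat_in_itvoo; rewrite ltrDl.
  rewrite in_itv/= => /andP[rb br].
  exists (a, b); last by rewrite /= fr !ltcR ar; split => //; apply/negP;
    rewrite -leNgt ltW.
  move=> t /= at_ tb; apply: rV; rewrite fr -rmorphB normC_real ltcR ltr_distlC.
  by rewrite (lt_trans ra at_) (le_lt_trans tb br).
move=> [[a b] /= ab [ax /negP bx]]; rewrite fr; apply: ab; move: ax bx; rewrite fr !ltcR //.
by rewrite -leNgt.
Qed.

End Measurable.

(** * Null sets and pull-backs *)

Section Negligible.
Variables (R : realType) (X : topologicalType).
Hypotheses (lcX : locally_compact [set: X]) (hX : hausdorff_space X).
Variable I : (X -> R) -> R.
Hypothesis PI : positive_functional I.
Local Notation mu := (outer_measure_of I).

Lemma content_eq0 A B : A `<=` B -> mu B = 0%E -> mu A = 0%E.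
Proof.
move=> AB B0; apply/eqP; rewrite eq_le (content_ge0 PI) andbT -B0.
exact: contentS.
Qed.

Lemma content_null A : (forall e : R, 0 < e -> (mu A <= e%:E)%E) -> mu A = 0%E.
Proof.
move=> h; apply/eqP; rewrite eq_le (content_ge0 PI) andbT.
by apply/lee_addgt0Pr => e /h; rewrite add0e.
Qed.

Lemma negligible_forS A B : A `<=` B -> negligible_for I B -> negligible_for I A.
Proof. by move=> AB nB K /nB; apply: content_eq0; exact: setSI. Qed.

Lemma negligible_for0 A : mu A = 0%E -> negligible_for I A.
Proof. by move=> A0 K _; apply: content_eq0 A0; exact: subIsetl. Qed.

Lemma negligible_forU A B : negligible_for I A -> negligible_for I B ->
  negligible_for I (A `|` B).
Proof.
move=> nA nB K kK; apply/eqP; rewrite eq_le (content_ge0 PI) andbT setIUl.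
by apply: (le_trans (contentU lcX hX PI _ _)); rewrite nA// nB// adde0.
Qed.

Lemma negligible_for_local A :
  (forall x : X, exists2 U : set X, nbhs x U & mu (A `&` U) = 0%E) -> negligible_for I A.
Proof.
move=> h K kK; apply: (@compact_induction X K (fun B => mu (A `&` B) = 0%E) kK).
- by rewrite setI0; exact: content0.
- by move=> B C BC; apply: content_eq0; exact: setIS.
- move=> B C B0 C0; apply/eqP; rewrite eq_le (content_ge0 PI) andbT setIUr.
  by apply: (le_trans (contentU lcX hX PI _ _)); rewrite B0 C0 adde0.
- by move=> x _; exact: h.
Qed.

End Negligible.

Section Pullback.
Variables (R : realType) (X Y : topologicalType).
Hypotheses (lcX : locally_compact [set: X]) (hX : hausdorff_space X).
Hypotheses (lcY : locally_compact [set: Y]) (hY : hausdorff_space Y).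
Variables (I : (X -> R) -> R) (J : (Y -> R) -> R).
Hypotheses (PI : positive_functional I) (PJ : positive_functional J).
Variable p : Y -> X.
Hypothesis cp : continuous p.
Hypothesis np : forall N, negligible_for I N -> negligible_for J (p @^-1` N).

(** A measurable set meets a compact set in a countable intersection of open
    sets up to a null set, and both kinds of set pull back well. *)
Lemma cara_preimage A : (outer_measure_of I).-caratheodory A ->
  (outer_measure_of J).-caratheodory (p @^-1` A).
Proof.
move=> mA; apply: (caratheodory_local lcY hY PJ) => y.
have [W [oW Wy kW _]] := lc_open_nbhs lcY hY (@openT Y) (Logic.I : [set: Y] y).
exists W; split => //.
pose C := p @` closure W.
have kC : compact C by apply: continuous_compact => //; exact: continuous_subspaceT.
have cC : closed C by exact: compact_closed.
pose D := A `&` C.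
have mD : (outer_measure_of I).-caratheodory D.
  by apply: caraI => //; exact: (cara_closed lcX hX PI).
have Dfin : outer_measure_of I D \is a fin_num.
  rewrite ge0_fin_numE ?(content_ge0 PI)//.
  by apply: le_lt_trans (content_compact lcX hX PI kC); apply: contentS; exact: subIsetr.
have h n : exists U, [/\ open U, D `<=` U &
    (outer_measure_of I U < outer_measure_of I D + (n.+1%:R^-1)%:E)%E].
  by apply: outer_regular; rewrite lteDl// lte_fin.
have [U hU] := choice h.
have N0 : outer_measure_of I ((\bigcap_n U n) `\` D) = 0%E.
  apply: content_null => // e e0.
  have [n ne] := ltr_add_invr e0; rewrite add0r in ne.
  apply: (@le_trans _ _ (outer_measure_of I (U n `\` D))).
    by apply: contentS; apply: setSD; exact: bigcap_inf.
  have [_ DU] := hU n; rewrite (mD (U n)) setIC setIidl// lteD2lE//.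
  by move=> /ltW /le_trans; apply; rewrite lee_fin; exact: ltW.
have nN := np (negligible_for0 PI N0).
(* On [W] the preimage of [A] is a G-delta set minus the preimage of the null
   set by which [D] differs from the intersection of the [U n]. *)
have -> : p @^-1` A `&` W = ((\bigcap_n (p @^-1` U n)) `\`
    (p @^-1` ((\bigcap_n U n) `\` D) `&` closure W)) `&` W.
  apply/seteqP; split => x [].
  - move=> Ax Wx; split => //; have Dx : D (p x).
      by split => //; exists x => //; exact: subset_closure.
    split; first by move=> n _; have [_ + _] := hU n; apply.
    by move=> [[_ /(_ Dx)]].
  - move=> [Ux nx] Wx; split => //.
    apply: contrapT => nA; apply: nx; split; last exact: subset_closure.
    by split=> [n _|[]//]; exact: Ux.
have mO V : open V -> (outer_measure_of J).-caratheodory V.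
  exact: (cara_open lcY hY PJ).
apply: (caraI lcY hY PJ); last exact: mO.
apply: (caraD lcY hY PJ).
  apply: (cara_bigcap lcY hY PJ) => n; apply: mO; apply: continuous_open => //.
  by have [] := hU n.
by apply: (caratheodory0 lcY hY PJ); exact: nN.
Qed.

Lemma measurable_for_preimage f : measurable_for I f ->
  measurable_for J (fun y => f (p y)).
Proof. by move=> mf V /mf; exact: cara_preimage. Qed.

End Pullback.

(** * Measurable sections of a field of Hilbert spaces *)

Section HilbertAlgebra.
Variables (R : realType) (H : hilbert R).
Implicit Types (u v w : H) (a : R[i]).

Lemma dotDl u v w : dot (u + v) w = dot u w + dot v w.
Proof. by rewrite -[u]scale1r dot_linear mul1r scale1r. Qed.

Lemma dot0l w : dot (0 : H) w = 0.
Proof. by apply: (addrI (dot 0 w)); rewrite -dotDl !addr0. Qed.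

Lemma dotZl a u w : dot (a *: u) w = a * dot u w.
Proof. by rewrite -[a *: u]addr0 dot_linear dot0l addr0. Qed.

Lemma dotDr u v w : dot w (u + v) = dot w u + dot w v.
Proof. by rewrite dot_conj dotDl rmorphD /= -!dot_conj. Qed.

Lemma dotZr a u w : dot w (a *: u) = Num.conj a * dot w u.
Proof. by rewrite dot_conj dotZl rmorphM /= -dot_conj. Qed.

Lemma dotBl u v w : dot (u - v) w = dot u w - dot v w.
Proof. by rewrite dotDl -scaleN1r dotZl mulN1r. Qed.

Lemma dotBr u v w : dot w (u - v) = dot w u - dot w v.
Proof. by rewrite dotDr -scaleN1r dotZr rmorphN1 mulN1r. Qed.

Lemma dot_inj u v : (forall w, dot u w = dot v w) -> u = v.
Proof.
move=> h; apply/eqP; rewrite -subr_eq0 -normr_eq0 -sqrf_eq0 -dot_norm.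
by rewrite dotBl h subrr.
Qed.

Lemma cauchy_schwarz u v : `|dot u v| <= `|u| * `|v|.
Proof.
have [->|v0] := eqVneq v 0.
  by rewrite dot_conj dot0l rmorph0 !normr0 mulr0.
have nv : 0 < `|v| by rewrite normr_gt0.
pose t := dot u v / `|v| ^+ 2.
have : 0 <= dot (u - t *: v) (u - t *: v) by rewrite dot_norm exprn_ge0.
rewrite dotBl !dotBr !dotZl !dotZr !dot_norm (dot_conj u v).
have cn : Num.conj (`|v| ^+ 2) = `|v| ^+ 2 :> R[i].
  by apply: CrealP; rewrite realX ?normr_real.
have tc : Num.conj t = Num.conj (dot u v) / `|v| ^+ 2 
  by rewrite /t [LHS]rmorphM; congr (_ * _); rewrite [LHS]fmorphV; congr (_^-1); exact: cn.
have -> : t * (Num.conj t * `|v| ^+ 2) = t * Num.conj (dot u v).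
  by rewrite tc divfK // expf_neq0 // gt_eqF.
rewrite subrr subr0 tc mulrAC -[Num.conj _ * _]mulrC -normCK.
rewrite subr_ge0 ler_pdivrMr ?exprn_gt0// -exprMn.
by rewrite ler_pXn2r ?nnegrE ?mulr_ge0.
Qed.

(** The imaginary unit as an explicit pair, so that products compute. *)
Definition ii : R[i] := 0 +i* 1.

Lemma conj_ii : Num.conj ii = - ii.
Proof. by rewrite /ii; apply/eqP; rewrite eq_complex /= oppr0 !eqxx. Qed.

Lemma ii_sqr : ii * ii = - 1.
Proof. by rewrite /ii; apply/eqP;
  rewrite eq_complex /= !mul0r !mul1r ?add0r ?addr0 ?oppr0 ?sub0r !eqxx. Qed.

Lemma polarization u v :
  4%:R * dot u v = `|u + v| ^+ 2 - `|u - v| ^+ 2 +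
    ii * `|u + ii *: v| ^+ 2 - ii * `|u - ii *: v| ^+ 2.
Proof.
rewrite -!dot_norm !dotBl !dotDl !dotBr !dotDr !dotZl !dotZr conj_ii.
have := ii_sqr; move: ii (dot u u) (dot v v) (dot u v) (dot v u) => i a b c d i2.
rewrite (_ : (_ + _ + _ - _) = 2 * c + 2 * d - 2 * (i * i) * c + 2 * (i * i) * d).
  by rewrite i2; ring.
ring.
Qed.

End HilbertAlgebra.

Section Sections.
Variables (R : realType) (X Y : topologicalType).
Hypotheses (lcY : locally_compact [set: Y]) (hY : hausdorff_space Y).
Variables (I : (X -> R) -> R) (J : (Y -> R) -> R).
Hypothesis PJ : positive_functional J.
Variable p : Y -> X.
Hypothesis pull : forall f, measurable_for I f -> measurable_for J (fun y => f (p y)).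
Variable H : hilbert_field R X.
Hypothesis mH : measurable_field I H.

Local Notation M := ((outer_measure_of J).-caratheodory).

Lemma measurable_for_lt (f g : Y -> R[i]) : (forall y, 0 <= f y) -> (forall y, 0 <= g y) ->
  measurable_for J f -> measurable_for J g -> M [set y | f y < g y].
Proof.
move=> f0 g0 mf mg.
have mh := measurable_forD lcY hY PJ mg (measurable_forZ lcY hY PJ (-1) mf).
pose V : set R[i]^o := \bigcup_(r in [set r : R | 0 < r]) ball (r%:C : R[i]^o) (r%:C).
have oV : open V by apply: bigcup_open => r _; exact: ball_open.
rewrite (_ : [set y | _] = (fun y => g y + -1 * f y) @^-1` V); first exact: mh.
have re (z : R[i]) : 0 <= z -> z = (complex.Re z)%:C.
  by case: z => a b; rewrite lecE /= => /andP[/eqP ->].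
apply/seteqP; split => y /=; rewrite mulN1r.
  rewrite (re _ (f0 y)) (re _ (g0 y)) -rmorphB ltcR => fg.
  exists (complex.Re (g y) - complex.Re (f y)); first by rewrite /= subr_gt0.
  by rewrite /ball /= subrr normr0 (ltcR 0) subr_gt0.
move=> [r /= r0]; rewrite /ball /= (re _ (f0 y)) (re _ (g0 y)) -!rmorphB normC_real !ltcR.
by rewrite ltr_distlC => /andP[+ _]; lra.
Qed.

Lemma measurable_section_comb (v w : forall y, H (p y)) (c : R[i]) :
  measurable_section J p H v -> measurable_section J p H w ->
  measurable_section J p H (fun y => v y + c *: w y).
Proof.
move=> mv mw u hu; rewrite (_ : (fun y => _) =
    fun y => dot (v y) (u (p y)) + c * dot (w y) (u (p y))); last first.
  by apply/funext => y; rewrite dotDl dotZl.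
by apply: (measurable_forD lcY hY PJ); [exact: mv | apply: (measurable_forZ lcY hY PJ);
  exact: mw].
Qed.

(** Rational linear combinations of a fundamental sequence. Countability matters:
    it makes the norm of a measurable section a countable supremum. *)
Lemma dense_sections : exists d : seq (rat * rat * nat) -> forall x, H x,
  (forall l, hsections H (d l)) /\
  forall x (w : H x) (e : R[i]), 0 < e -> exists l, `|d l x - w| < e.
Proof.
have [_ [h0 hlin] _ _ [e he de]] := mH.
pose q (a : rat * rat) : R[i] := (ratr a.1 : R) +i* (ratr a.2 : R).
pose d := fix d (l : seq (rat * rat * nat)) : forall x, H x :=
  if l is a :: l' then fun x => q a.1 *: e a.2 x + d l' x else fun x => 0.
have hd l : hsections H (d l) by elim: l => [|a l ih] //=; exact: hlin.
have dcat l l' x : d (l ++ l') x = d l x + d l' x.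
  by elim: l => [|a l ih] /=; rewrite ?add0r// ih addrA.
exists d; split => // x w eps eps0.
have eps2 : 0 < eps / 2 by rewrite divr_gt0.
have [z [zw [n [c [f [fe zE]]]]]] : (ball w (eps / 2) `&` lspan (range (fun n =>
  e n x))) !=set0.
  by apply: de; [exists w; exact: ballxx | exact: ball_open].
have approx m (g : 'I_m -> H x) (b : 'I_m -> R[i]) (t : R[i]) : 0 < t ->
    (forall i, range (fun n => e n x) (g i)) ->
    exists l, `|d l x - \sum_(i < m) b i *: g i| < t.
  elim: m g b t => [|m ih] g b t t0 ge.
    by exists [::]; rewrite big_ord0 subrr normr0.
  have t2 : 0 < t / 2 by rewrite divr_gt0.
  have [l hl] := ih (fun i => g (widen_ord (leqnSn m) i))
    (fun i => b (widen_ord (leqnSn m) i)) (t/2) t2 (fun i => ge _).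
  have [k _ gk] := ge ord_max.
  have n0 : 0 < `|e k x| + 1 by rewrite ltr_wpDl.
  have [[[a1 a2] a3] [ab aU]] := @rat_ball_base R (b ord_max)
    (ball (b ord_max : R[i]^o) (t / 2 / (`|e k x| + 1)))
    (nbhsx_ballx _ _ (divr_gt0 t2 n0)).
  have qb : `|q (a1, a2) - b ord_max| < t / 2 / (`|e k x| + 1).
    rewrite distrC; apply: (aU (q (a1, a2))); rewrite /rat_ball /= subrr normr0.
    by apply: le_lt_trans ab.
  exists (((a1, a2), k) :: l); rewrite big_ord_recr /= -gk.
  rewrite (_ : _ - _ = (q (a1, a2) - b ord_max) *: e k x +
     (d l x - \sum_(i < m) b (widen_ord (leqnSn m) i) *: g (widen_ord (leqnSn m) i))).
    apply: le_lt_trans (ler_normD _ _) _; rewrite normrZ [ltRHS]splitr; apply: ltrD => //.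
    apply: le_lt_trans (_ : _ <= `|q (a1, a2) - b ord_max| * (`|e k x| + 1)) _.
      by rewrite ler_wpM2l// lerDl.
    by rewrite -ltr_pdivlMr.
  by rewrite scalerBl opprD [X in _ + X = _]addrC addrACA.
have [l hl] := approx n f c (eps/2) eps2 fe.
exists l; rewrite -[d l x](subrK z) -addrA [eps]splitr.
apply: le_lt_trans (ler_normD _ _) _; apply: ltrD; first by rewrite zE.
by move: zw; rewrite -ball_normE /= distrC.
Qed.

Lemma measurable_for_polarization (v w : forall y, H (p y)) :
  (forall c : R[i], measurable_for J (fun y => `|v y + c *: w y|)) ->
  measurable_for J (fun y => dot (v y) (w y)).
Proof.
move=> mn.
have mn2 c : measurable_for J (fun y => `|v y + c *: w y| ^+ 2).
  by rewrite (_ : (fun y => _) = (fun y => `|v y + c *: w y| * `|v y + c *: w y|))//;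
    exact: (measurable_forM lcY hY PJ).
rewrite (_ : (fun y => _) = (fun y =>
  4%:R^-1 * (`|v y + 1 *: w y| ^+ 2 + -1 * `|v y + -1 *: w y| ^+ 2 +
    ii R * `|v y + ii R *: w y| ^+ 2 + (- ii R) * `|v y + (- ii R) *: w y| ^+ 2)));
      last first.
  apply/funext => y; apply: (@mulfI _ 4%:R); first by rewrite pnatr_eq0.
  by rewrite polarization mulVKf ?pnatr_eq0// scale1r scaleN1r mulN1r scaleNr mulNr.
apply: (measurable_forZ lcY hY PJ).
do 3 (apply: (measurable_forD lcY hY PJ); last by apply: (measurable_forZ lcY hY PJ);
  exact: mn2).
exact: mn2.
Qed.

Lemma dot_hsections (u u' : forall x, H x) : hsections H u -> hsections H u' ->
  measurable_for J (fun y => dot (u (p y)) (u' (p y))).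
Proof.
move=> hu hu'; have [_ [_ hlin] hn _ _] := mH.
apply: measurable_for_polarization => c; apply: (pull (f := fun x => `|u x + c *: u' x|)).
rewrite (_ : (fun x => _) = (fun x => `|c *: u' x + u x|)); last by apply/funext => x;
  rewrite addrC.
by apply: hn; exact: hlin.
Qed.

(** By the Cauchy-Schwarz inequality, the norm of [v] exceeds [t] exactly when
    |<v, d>| > t |d| for some member [d] of a countable dense family of sections.
    The inner products are measurable by hypothesis, the norms of [d] because
    norms of measurable sections over the base pull back. *)
Lemma measurable_section_norm (v : forall y, H (p y)) :
  measurable_section J p H v -> measurable_for J (fun y => `|v y|).
Proof.
move=> mv; have [d [hd dd]] := dense_sections; have [_ _ hn _ _] := mH.
apply: (measurable_for_real lcY hY PJ) => // t t0.
have tC : 0 <= t%:C by rewrite (lecR 0).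
rewrite (_ : [set y | _] = [set y | exists2 l, True &
    [set y | t%:C * `|d l (p y)| < `|dot (v y) (d l (p y))| ] y]).
  apply: (cara_countable lcY hY PJ) => l _; apply: measurable_for_lt.
  - by move=> y; rewrite mulr_ge0.
  - by [].
  - by apply: (measurable_forZ lcY hY PJ); apply: (pull (f := fun x => `|d l x|));
      exact: hn.
  - apply: (measurable_for_comp (phi := fun z : R[i]^o => (`|z| : R[i]^o))).
      by move=> z; exact: (@norm_continuous _ R[i]^o).
    exact: mv.
apply/seteqP; split => y /=; last first.
  move=> [l _ h]; have := lt_le_trans h (cauchy_schwarz _ _).
  have [->|d0] := eqVneq (d l (p y)) 0; first by rewrite normr0 !mulr0 ltxx.
  by rewrite ltr_pM2r// normr_gt0.
move=> tv; have v0 : 0 < `|v y| by apply: le_lt_trans tv.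
(* For [d l] within [e] of [v y], the inner product is at least
   |v|^2 - |v| e and the norm of [d l] at most |v| + e; the value of [e] makes
   the former exceed t times the latter. *)
pose e := (`|v y| - t%:C) * `|v y| / (`|v y| + t%:C + 1).
have s0 : 0 < `|v y| + t%:C + 1 by rewrite ltr_wpDl// addr_ge0.
have e0 : 0 < e by rewrite divr_gt0// mulr_gt0// subr_gt0.
have [l hl] := dd (p y) (v y) e e0; exists l => //.
set w := d l (p y) in hl *.
have h1 : `|w| <= `|v y| + `|w - v y|.
  by rewrite -{1}(subrK (v y) w) addrC; exact: ler_normD.
have h2 : `|v y| ^+ 2 - `|v y| * `|w - v y| <= `|dot (v y) w|.
  rewrite -{2}(subrK (v y) w) dotDr dot_norm [dot _ _ + _]addrC.
  apply: le_trans (lerB_normD _ _); apply: lerB; last exact: cauchy_schwarz.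
  by rewrite ger0_norm// exprn_ge0.
apply: le_lt_trans (ler_wpM2l tC h1) _; apply: lt_le_trans h2.
move: hl; rewrite ltr_pdivlMr// -subr_gt0 => hl; rewrite -subr_gt0.
rewrite (_ : _ - _ = ((`|v y| - t%:C) * `|v y| - `|w - v y| * (`|v y| + t%:C + 1)) +
  `|w - v y|); first by rewrite ltr_pwDl.
by ring.
Qed.

(** Polarization reduces inner products to norms. *)
Lemma measurable_section_dot (v w : forall y, H (p y)) :
  measurable_section J p H v -> measurable_section J p H w ->
  measurable_for J (fun y => dot (v y) (w y)).
Proof.
move=> mv mw.
apply: measurable_for_polarization => c; apply: measurable_section_norm.
exact: measurable_section_comb.
Qed.

End Sections.

(** * Integration along the fibres of a map *)

Lemma Cc_bounded (R : realType) (X : topologicalType) (f : X -> R) : Cc f ->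
  exists2 c : R, 0 < c & forall x, `|f x| <= c.
Proof.
move=> [cf kf].
have [c hc] : exists c, forall x, supp f x -> `|f x| <= c.
  apply: (@compact_induction X (supp f) (fun A =>
    exists c, forall x, A x -> `|f x| <= c) kf).
  - by exists 0.
  - by move=> A B AB [c hc]; exists c => x /AB; exact: hc.
  - move=> A B [c hc] [d hd]; exists (Num.max c d) => x [/hc|/hd] h;
      rewrite le_max h ?orbT//.
  - move=> x _; exists (f @^-1` ball (f x) 1); first by apply: cf; exact: nbhsx_ballx.
    exists (`|f x| + 1) => y; rewrite /preimage /= /ball /= => h.
    by rewrite -(subrK (f x) (f y)) addrC; apply: le_trans (ler_normD _ _) _;
      rewrite lerD2l distrC ltW.
exists (Num.max c 1); first by rewrite lt_max ltr01 orbT.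
move=> x; rewrite le_max; have [/hc ->//|/supp_out ->] := pselect (supp f x).
by rewrite normr0 ler01 orbT.
Qed.

(** Integration along the fibres of [p], as by a Haar system or by the rotation
    invariant measures on a circle bundle. *)
Record fibre_integral (R : realType) (X Y : topologicalType) (p : Y -> X)
    (T : (Y -> R) -> X -> R) : Prop := FibreIntegral {
  fibre_Cc : forall f, Cc f -> Cc (T f);
  fibre_lin : forall (a : R) f g, Cc f -> Cc g ->
    forall x, T (fun y => a * f y + g y) x = a * T f x + T g x;
  fibre_pos : forall f, Cc f -> (forall y, 0 <= f y) -> forall x, 0 <= T f x;
  fibre_local : forall f x, Cc f -> (forall y, p y = x -> f y = 0) -> T f x = 0
}.

Section FibreIntegral.
Variables (R : realType) (X Y : topologicalType).
Hypothesis hX : hausdorff_space X.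
Hypotheses (lcY : locally_compact [set: Y]) (hY : hausdorff_space Y).
Variables (p : Y -> X) (T : (Y -> R) -> X -> R) (I : (X -> R) -> R).
Hypotheses (cp : continuous p) (hT : fibre_integral p T) (PI : positive_functional I).
Let J f := I (T f).

Lemma fibre_le f g : Cc f -> Cc g -> (forall y, f y <= g y) -> forall x, T f x <= T g x.
Proof.
move=> cf cg fg x; have := fibre_pos hT (Cc_lin (-1) cf cg) _ x.
rewrite (fibre_lin hT)// mulN1r addrC subr_ge0; apply.
by move=> y; rewrite mulN1r addrC subr_ge0.
Qed.

Lemma fibre_positive : positive_functional J.
Proof.
split=> [a f g cf cg|f cf f0]; rewrite /J.
  rewrite -(PI.1 a _ _ (fibre_Cc hT cf) (fibre_Cc hT cg)); congr I.
  by apply/funext => x; exact: (fibre_lin hT).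
by apply: PI.2; [exact: (fibre_Cc hT) | exact: (fibre_pos hT)].
Qed.

Lemma fibre_supp f : Cc f -> supp (T f) `<=` p @` supp f.
Proof.
move=> cf; apply: supp_sub.
  apply: compact_closed => //; apply: continuous_compact; last exact: cf.2.
  exact: continuous_subspaceT.
move=> x; apply: contraNP => nx; apply/eqP; apply: (fibre_local hT) => // y yx.
by apply: supp_out => sy; apply: nx; exists y.
Qed.

(** On the set where a cut-off [k] is 1, integrals along the fibres are bounded
    by a bound [c] of the fibre integral of [k]. Hence the part over an open set
    of measure below e / c has measure at most e. *)
Lemma fibre_null N : negligible_for I N -> negligible_for J (p @^-1` N).
Proof.
move=> nN K kK; apply: (content_null fibre_positive) => e e0.
have [k [ck k01 _ [W oW [KW kW]]]] := urysohn_Cc R lcY hY kK openT (@subsetT _ K).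
have [c c0 hc] := Cc_bounded (fibre_Cc hT ck).
have kC : compact (p @` K) by apply: continuous_compact => //; exact: continuous_subspaceT.
have [U [oU NU Ue]] : exists U, [/\ open U, N `&` (p @` K) `<=` U &
    (outer_measure_of I U < (e / c)%:E)%E].
  by apply: outer_regular; rewrite nN// lte_fin divr_gt0.
have oV : open (p @^-1` U `&` W) by apply: openI => //; exact: continuous_open.
apply: (@le_trans _ _ (outer_measure_of J (p @^-1` U `&` W))).
  apply: contentS => y [Ny Ky]; split; last exact: KW.
  by apply: NU; split => //; exists y.
apply: content_le => // f [cf f01 fU].
have fk y : f y <= k y.
  have [/fU[_ /kW ->]|/supp_out ->] := pselect (supp f y); first by case/andP: (f01 y).
  by case/andP: (k01 y).
have cT := fibre_Cc hT cf.
have : subordinate (fun x => c^-1 * T f x) U.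
  split.
  - have := Cc_lin c^-1 cT (Cc_cst0 R X); congr Cc.
    by apply/funext => x; rewrite addr0.
  - move=> x; rewrite mulr_ge0 ?invr_ge0 ?(ltW c0)//=; last first.
      by apply: (fibre_pos hT) => // y; case/andP: (f01 y).
    rewrite ler_pdivrMl// mulr1; apply: le_trans (hc x); apply: le_trans (ler_norm _).
    exact: fibre_le.
  - apply: (@subset_trans _ (supp (T f))).
      apply: supp_sub; first exact: closed_closure.
      by move=> x; rewrite mulf_eq0 => /norP[_ h]; exact: subset_closure.
    by move=> x /(fibre_supp cf)[y /fU[Uy _] <-].
move=> /(content_ge I oU)/le_trans/(_ (ltW Ue)).
by rewrite (functionalZ PI)// !lee_fin ler_pdivrMl// mulrCA divff ?mulr1// gt_eqF.
Qed.

End FibreIntegral.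

(** * The functionals of a Haar system *)

Section IntegralOfRadon.
Variables (R : realType) (X : ptopologicalType) (m : {measure set (borel X) -> \bar R}).
Hypothesis mfin : forall K : set X, compact K -> (m K < +oo)%E.

Lemma borel_open (U : set X) : open U -> measurable (U : set (borel X)).
Proof. by move=> oU; apply: sub_sigma_algebra. Qed.

Lemma borel_closed (A : set X) : closed A -> measurable (A : set (borel X)).
Proof.
move=> cA; rewrite -(setCK A); apply: measurableC; apply: borel_open.
exact: closed_openC.
Qed.

Lemma continuous_borel (f : X -> R) : continuous f ->
  measurable_fun setT (f : borel X -> R).
Proof.
move=> cf; apply: (measurability _ (RGenOInfty.measurableE R)) => // _ [_ [a ->] <-].
rewrite setTI; apply: borel_open; exact: continuous_open.
Qed.

Lemma Cc_integrable (f : X -> R) : Cc f -> m.-integrable setT (EFin \o (f : borel X -> R)).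
Proof.
move=> cf; have [c c0 hc] := Cc_bounded cf.
have cS : measurable (supp f : set (borel X)) by apply: borel_closed; exact: closed_closure.
apply/integrableP; split.
  by apply/measurable_EFinP; apply: continuous_borel; exact: cf.1.
apply: (@le_lt_trans _ _ (\int[m]_(x in supp f) (cst c%:E x))%E); last first.
  by rewrite integral_cst// lte_mul_pinfty ?lee_fin ?(ltW c0)//; apply: mfin; exact: cf.2.
rewrite [leRHS]integral_mkcond; apply: ge0_le_integral => //.
- apply/measurable_EFinP; apply: measurableT_comp => //.
  by apply: continuous_borel; exact: cf.1.
- exact/(measurable_restrictT _ cS).
- move=> x _; rewrite patchE; case: ifPn => [_|]; first by rewrite lee_fin.
  by rewrite notin_setE => /supp_out fx; rewrite /= fx normr0.
Qed.

Lemma integral_of_positive : positive_functional (integral_of m).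
Proof.
split=> [a f g cf cg|f cf f0].
  rewrite /integral_of RintegralD//; last 2 first.
    by have := Cc_integrable (Cc_mul cf (@cst_continuous _ _ a)); congr (_.-integrable _ _);
      apply/funext => x /=; rewrite mulrC.
    exact: Cc_integrable.
  by rewrite RintegralZl//; exact: Cc_integrable.
by apply: Rintegral_ge0.
Qed.

End IntegralOfRadon.

Section UnitSpace.
Variable G : topGroupoid.
Hypotheses (lcG : locally_compact [set: G]) (hG : hausdorff_space G).

Lemma src_unit (x : obj G) : src (gunit x : G) = x.
Proof. by have [[su _ _ _] _ _] := groupoidP G. Qed.

Lemma unit_space_hausdorff : hausdorff_space (obj G).
Proof.
have [cs _ cu _ _] := topologicalP G.
move=> x y xy; rewrite -(src_unit x) -(src_unit y); congr src; apply: hG.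
move=> A B nA nB; have [z [Az Bz]] := xy _ _ (cu _ _ nA) (cu _ _ nB).
by exists (gunit z).
Qed.

(** The unit map embeds the unit space as the closed set of arrows [g] with
    gunit (src g) = g. *)
Lemma unit_space_locally_compact : locally_compact [set: obj G].
Proof.
have [cs _ cu _ _] := topologicalP G.
move=> x _; have [W [oW Wx kW _]] := lc_open_nbhs lcG hG openT (I : [set: G] (gunit x)).
pose C := gunit @^-1` closure W : set (obj G).
have cC : closed C by apply: continuous_closed => //; exact: closed_closure.
rewrite withinET; exists C.
  apply: (@filterS _ (nbhs x) _ _ _ (preimage_subset (@subset_closure _ W))).
  by apply: cu; apply: open_nbhs_nbhs; split.
split => //.
have -> : C = src @` (closure W `&` [set g : G | gunit (src g) = g]).
  apply/seteqP; split => [y Cy|_ [g [Wg gE] <-]]; last by rewrite /C /= gE.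
  by exists (gunit y); [split => //=; rewrite src_unit | exact: src_unit].
apply: continuous_compact; first exact: continuous_subspaceT.
apply: compact_closedI => //; apply: closed_equalizer => //; last by move=> g;
  exact: cvg_id.
by move=> g; apply: (continuous_comp (cs g)); exact: cu.
Qed.

End UnitSpace.

Section Haar.
Variables (R : realType) (G : topGroupoid).
Hypotheses (lcG : locally_compact [set: G]) (hG : hausdorff_space G).
Variable alpha : obj G -> {measure set (borel G) -> \bar R}.
Hypothesis haar : haar_system alpha.

(** Inner regularity reduces to compact sets off the fibre, and the points off
    the support have null neighbourhoods. *)
Lemma haar_off_fibre (x : obj G) : alpha x (~` (rng @^-1` [set x])) = 0%E.
Proof.
have [rad sup _ _] := haar; have [_ cr _ _ _] := topologicalP G.
have hX := unit_space_hausdorff hG.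
have oU : open (~` (rng @^-1` [set x]) : set G).
  apply: closed_openC; apply: continuous_closed => //.
  by apply: accessible_closed_set1; exact: hausdorff_accessible.
have [_ _ /(_ _ oU) ->] := rad x.
apply/eqP; rewrite eq_le; apply/andP; split; last first.
  apply: ereal_sup_ubound; exists set0; last by rewrite measure0.
  by split => //; exact: compact0.
apply: ge_ereal_sup => _ [K [kK KU] <-].
have [V [oV KV V0]] : exists V : set G, [/\ open V, K `<=` V & alpha x V = 0%E].
  apply: (@compact_induction G K
    (fun A => exists V : set G, [/\ open V, A `<=` V & alpha x V = 0%E]) kK).
  - by exists set0; split => //; exact: open0.
  - by move=> A B AB [V [oV BV V0]]; exists V; split => //; exact: subset_trans BV.
  - move=> A B [V [oV AV V0]] [W [oW BW W0]]; exists (V `|` W); split.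
    + exact: openU.
    + exact: setUSS.
    + by rewrite null_set_setU //; exact: borel_open.
  - move=> g /KU; rewrite -sup => /existsNP[V /not_implyP[oV /not_implyP[Vg /negP]]].
    rewrite -leNgt => V0; exists V; first by apply: open_nbhs_nbhs; split.
    by exists V; split => //; apply/eqP; rewrite eq_le V0 measure_ge0.
rewrite -V0; apply: le_measure => //; rewrite inE; last exact: borel_open.
by apply: borel_closed; exact: compact_closed.
Qed.

Lemma haar_integralE (x : obj G) (f : G -> R) : Cc f ->
  haar_integral alpha x f = integral_of (alpha x) f.
Proof.
move=> cf; have [rad _ _ _] := haar; have [_ cr _ _ _] := topologicalP G.
have hX := unit_space_hausdorff hG.
have cF : closed (rng @^-1` [set x] : set G).
  apply: continuous_closed => //.
  by apply: accessible_closed_set1; exact: hausdorff_accessible.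
rewrite /integral_of /Rintegral (@negligible_integral _ _ _ _ _ (~` (rng @^-1` [set x])
  : set (borel G))).
- by rewrite setTD setCK.
- by apply: borel_open; exact: closed_openC.
- exact: measurableT.
- by apply: Cc_integrable => // K kK; have [+ _ _] := rad x; apply.
- exact: haar_off_fibre.
Qed.

Lemma haar_fibre_integral :
  fibre_integral (rng : G -> obj G) (fun f x => haar_integral alpha x f).
Proof.
have [rad _ cont _] := haar; have [_ cr _ _ _] := topologicalP G.
have hX := unit_space_hausdorff hG.
have pos x : positive_functional (integral_of (alpha x)).
  by apply: integral_of_positive => K kK; have [+ _ _] := rad x; apply.
have loc (f : G -> R) x : (forall y, rng y = x -> f y = 0) -> haar_integral alpha x f = 0.
  by move=> f0; rewrite /haar_integral /Rintegral integral0_eq // => g /f0 ->.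
split.
- move=> f cf; split.
    rewrite (_ : (fun x => _) = fun x => integral_of (alpha x) f); first exact: cont.
    by apply/funext => x; exact: haar_integralE.
  have kr : compact (rng @` supp f).
    by apply: continuous_compact; [exact: continuous_subspaceT | exact: cf.2].
  apply: (subclosed_compact _ kr); first exact: closed_closure.
  apply: supp_sub; first exact: compact_closed.
  move=> x; apply: contraNP => nx; apply/eqP; apply: loc => g gx.
  by apply: supp_out => sg; apply: nx; exists g.
- move=> a f g cf cg x; rewrite !haar_integralE//; last exact: Cc_lin.
  exact: (pos x).1.
- by move=> f cf f0 x; rewrite haar_integralE//; exact: (pos x).2.
- by move=> f x cf; exact: loc.
Qed.

End Haar.

(** * Means of periodic functions *)

Section PeriodicIntegral.
Variable R : realType.
Local Notation leb := (@lebesgue_measure R).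
Implicit Types (phi : R -> R) (a b s : R).

Lemma integrable_continuous phi a b : continuous phi ->
  leb.-integrable `[a, b] (EFin \o phi).
Proof.
move=> cphi; apply: continuous_compact_integrable; first exact: segment_compact.
exact: continuous_subspaceT.
Qed.

Lemma Rintegral_shift phi a b s : a <= b -> continuous phi ->
  \int[leb]_(t in `[a, b]) phi (t + s) = \int[leb]_(t in `[(a + s)%R, (b + s)%R]) phi t.
Proof.
move=> ab cphi; rewrite /Rintegral; congr fine.
pose F t : R := t + s.
have DF : derive1 F = cst 1.
  by apply/funext => t; rewrite derive1E /F deriveD// derive_id derive_cst addr0.
rewrite (@integration_by_substitution_increasing _ F phi a b) //.
- by apply: eq_integral => t _; rewrite DF /= mulr1.
- by move=> x y _ _ xy; rewrite /F ltrD2r.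
- by rewrite DF => ? _; exact: cvg_cst.
- by rewrite DF; exact: is_cvg_cst.
- by rewrite DF; exact: is_cvg_cst.
- split.
  + by move=> x _; apply: derivableD.
  + by apply: cvg_at_right_filter; apply: cvgD; [exact: cvg_id | exact: cvg_cst].
  + by apply: cvg_at_left_filter; apply: cvgD; [exact: cvg_id | exact: cvg_cst].
- exact: continuous_subspaceT.
Qed.

Lemma Rintegral_split phi a b c : a <= b -> b <= c -> continuous phi ->
  \int[leb]_(t in `[a, c]) phi t =
  \int[leb]_(t in `[a, b]) phi t + \int[leb]_(t in `[b, c]) phi t.
Proof.
move=> ab bc cphi.
have := Rintegral_itvB (f := phi) (a := BLeft a) (b := BRight c) (x := b).
move=> /(_ (integrable_continuous a c cphi)); rewrite !bnd_simp => /(_ ab bc) h.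
rewrite -(@Rintegral_itv_obnd_cbnd _ b (BRight c) phi); last first.
  by apply: integrableS (integrable_continuous b c cphi) => //; exact: subset_itv_oc_cc.
by rewrite -h addrC subrK.
Qed.

Definition period_mean phi : R :=
  (2 * pi)^-1 * \int[leb]_(t in `[0, 2 * pi]) phi t.

Let pi2_gt0 : 0 < 2 * pi :> R.
Proof. by rewrite mulr_gt0// pi_gt0. Qed.

Let pi2_ge0 := ltW pi2_gt0.

(** Cut the shifted period at [2 * pi] and move the overhang back by one period. *)
Lemma period_mean_shift phi s : continuous phi -> (forall t, phi (t + 2 * pi) = phi t) ->
  0 <= s <= 2 * pi -> period_mean (fun t => phi (t + s)) = period_mean phi.
Proof.
move=> cphi per /andP[s0 s2]; congr (_ * _).
rewrite Rintegral_shift// add0r addrC (@Rintegral_split phi s (2 * pi) (s + 2 * pi))//;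
  last by rewrite lerDr.
rewrite (@Rintegral_split phi 0 s (2 * pi))// addrC; congr (_ + _).
transitivity (\int[leb]_(t in `[0, s]) phi (t + 2 * pi)).
  by rewrite Rintegral_shift// add0r.
by apply: eq_Rintegral => t _; exact: per.
Qed.

Lemma period_mean_opp phi : continuous phi -> (forall t, phi (t + 2 * pi) = phi t) ->
  period_mean (fun t => phi (- t)) = period_mean phi.
Proof.
move=> cphi per; congr (_ * _).
have -> : \int[leb]_(t in `[0, 2 * pi]) phi (- t) =
    \int[leb]_(t in `[(- (2 * pi))%R, (- 0)%R]) phi t.
  rewrite /Rintegral integration_by_substitution_oppr//; exact: continuous_subspaceT.
have -> : \int[leb]_(t in `[(- (2 * pi))%R, (- 0)%R]) phi t =
    \int[leb]_(t in `[(- (2 * pi))%R, (- 0)%R]) phi (t + 2 * pi).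
  by apply: eq_Rintegral => t _; rewrite per.
by rewrite Rintegral_shift// ?lerN2// addNr oppr0 add0r.
Qed.

Lemma period_mean_lin (c : R) phi psi : continuous phi -> continuous psi ->
  period_mean (fun t => c * phi t + psi t) = c * period_mean phi + period_mean psi.
Proof.
move=> cphi cpsi; rewrite /period_mean RintegralD//; last 2 first.
- apply: (@integrable_continuous (fun t => c * phi t)).
  by move=> t; apply: cvgM; [exact: cvg_cst | exact: cphi].
- exact: integrable_continuous.
by rewrite RintegralZl//; [ring | exact: integrable_continuous].
Qed.

Lemma period_mean_cst (c : R) : period_mean (fun=> c) = c.
Proof.
have E : leb `[0, 2 * pi]%classic = (2 * pi)%:E.
  by rewrite lebesgue_measure_itv /= lte_fin pi2_gt0 -EFinD subr0.
rewrite /period_mean Rintegral_cst// (_ : fine _ = 2 * pi); last exact: (congr1 fine E).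
by rewrite mulrCA mulVf ?mulr1// gt_eqF.
Qed.

Lemma period_mean_le phi psi : continuous phi -> continuous psi ->
  (forall t, phi t <= psi t) -> period_mean phi <= period_mean psi.
Proof.
move=> cphi cpsi le; rewrite ler_wpM2l ?invr_ge0//.
by apply: le_Rintegral => //; exact: integrable_continuous.
Qed.

Lemma period_mean_near phi psi (e : R) : continuous phi -> continuous psi ->
  (forall t, 0 <= t <= 2 * pi -> `|phi t - psi t| <= e) ->
  `|period_mean phi - period_mean psi| <= e.
Proof.
move=> cphi cpsi h; have [i1 i2] := (integrable_continuous 0 (2 * pi) cphi,
  integrable_continuous 0 (2 * pi) cpsi).
have cs : continuous (fun t => phi t - psi t).
  by move=> t; apply: cvgB; [exact: cphi | exact: cpsi].
rewrite /period_mean -mulrBr -RintegralB// normrM ger0_norm ?invr_ge0//.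
rewrite ler_pdivrMl//; apply: (le_trans (le_normr_Rintegral _ _)) => //.
  exact: (integrable_continuous 0 (2 * pi) cs).
apply: (@le_trans _ _ (\int[leb]_(t in `[0%R, (2 * pi)%R]) e)).
  apply: le_Rintegral => //.
  - apply: (@integrable_continuous (fun t => `|phi t - psi t|)).
    by move=> t; apply: cvg_norm; exact: cs.
  - apply: (@integrable_continuous (fun=> e)); exact: cst_continuous.
by rewrite -[X in _ <= _ * X](period_mean_cst e) /period_mean mulrA divff ?gt_eqF// mul1r.
Qed.

End PeriodicIntegral.

(** * The algebra of a Fell line bundle *)

Section BundleAlgebra.
Variables (R : realType) (G : topGroupoid) (L : fell_line_bundle R G).
Local Notation E := (total_space L).
Implicit Types (s t u : E) (z : R[i]).

Lemma src_mul (g h : G) : src g = rng h -> src (gmul g h) = src h.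
Proof. by have [[_ _ + _] _ _] := groupoidP G; exact. Qed.
Lemma rng_mul (g h : G) : src g = rng h -> rng (gmul g h) = rng g.
Proof. by have [[_ _ _ +] _ _] := groupoidP G; exact. Qed.
Lemma rng_unit (x : obj G) : rng (gunit x : G) = x.
Proof. by have [[_ + _ _] _ _] := groupoidP G. Qed.
Lemma gmul1 (g : G) : gmul (gunit (rng g)) g = g.
Proof. by have [_ [_ + _] _] := groupoidP G. Qed.
Lemma gmulr1 (g : G) : gmul g (gunit (src g)) = g.
Proof. by have [_ [_ _ +] _] := groupoidP G. Qed.
Lemma src_inv (g : G) : src (ginv g) = rng g.
Proof. by have [_ _ [+ _ _ _]] := groupoidP G. Qed.
Lemma rng_inv (g : G) : rng (ginv g) = src g.
Proof. by have [_ _ [_ + _ _]] := groupoidP G. Qed.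
Lemma gmulVg (g : G) : gmul (ginv g) g = gunit (src g).
Proof. by have [_ _ [_ _ + _]] := groupoidP G. Qed.
Lemma gmulgV (g : G) : gmul g (ginv g) = gunit (rng g).
Proof. by have [_ _ [_ _ _ +]] := groupoidP G. Qed.
Lemma gmulA (g h k : G) : src g = rng h -> src h = rng k ->
  gmul (gmul g h) k = gmul g (gmul h k).
Proof. by have [_ [+ _ _] _] := groupoidP G; exact. Qed.

Lemma ginvK (g : G) : ginv (ginv g) = g.
Proof.
rewrite -[LHS]gmulr1 src_inv rng_inv -(gmulVg g) -gmulA ?src_inv// ?rng_inv//.
by rewrite gmulVg src_inv gmul1.
Qed.

(** The operations of the bundle on its total space, which avoid transports
    between fibres over equal arrows. *)
Definition tmul s t : E := tot (fmul (bvect s) (bvect t)).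
Definition tstar s : E := tot (fstar (bvect s)).
Definition tscale z s : E := tot (z *: bvect s).
Definition tnorm s : R[i] := `|bvect s|.
Definition tone (x : obj G) : E := tot (fone L x).

Lemma tot_inj (g : G) (a b : L g) : tot a = tot b :> E -> a = b.
Proof. exact: (@Eqdep_dec.inj_pair2_eq_dec G (fun x y => eq_comparable x y) (fun g =>
  L g)). Qed.

Lemma tot_fibre s (g : G) : bproj s = g -> exists a : L g, s = tot a.
Proof. by case: s => h a /= <-; exists a. Qed.

Lemma tmulA s t u : src (bproj s) = rng (bproj t) -> src (bproj t) = rng (bproj u) ->
  tmul (tmul s t) u = tmul s (tmul t u).
Proof. by case: s t u => [g a] [h b] [k c] gh hk; exact: fmulA. Qed.

Lemma tstarK s : tstar (tstar s) = s.
Proof. by case: s => [g a]; exact: fstarK. Qed.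

Lemma tscaleA z z' s : tscale z (tscale z' s) = tscale (z * z') s.
Proof. by rewrite /tscale /= scalerA. Qed.

Lemma tscale1 s : tscale 1 s = s.
Proof. by case: s => g a; rewrite /tscale /= scale1r. Qed.

Lemma tnormZ z s : tnorm (tscale z s) = `|z| * tnorm s.
Proof. exact: normrZ. Qed.

Lemma tmul0l (g h : G) (b : L h) : composable g h -> fmul (0 : L g) b = 0.
Proof.
move=> gh; have := fmul_linearl 1 (0 : L g) 0 b gh.
by rewrite !scale1r addr0 => /esym/eqP; rewrite -subr_eq0 addrK => /eqP.
Qed.

Lemma tmul0r (g h : G) (a : L g) : composable g h -> fmul a (0 : L h) = 0.
Proof.
move=> gh; have := fmul_linearr 1 a (0 : L h) 0 gh.
by rewrite !scale1r addr0 => /esym/eqP; rewrite -subr_eq0 addrK => /eqP.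
Qed.

Lemma tmulZl z s t : src (bproj s) = rng (bproj t) ->
  tmul (tscale z s) t = tscale z (tmul s t).
Proof.
case: s t => [g a] [h b] gh; rewrite /tmul /tscale /=; congr tot.
by rewrite -[z *: a]addr0 fmul_linearl// tmul0l// addr0.
Qed.

Lemma tmulZr z s t : src (bproj s) = rng (bproj t) ->
  tmul s (tscale z t) = tscale z (tmul s t).
Proof.
case: s t => [g a] [h b] gh; rewrite /tmul /tscale /=; congr tot.
by rewrite -[z *: b]addr0 fmul_linearr// tmul0r// addr0.
Qed.

Lemma tstarZ z s : tstar (tscale z s) = tscale (Num.conj z) (tstar s).
Proof.
case: s => [g a]; rewrite /tstar /tscale /=; congr tot.
have s0 : fstar (0 : L g) = 0.
  have := fstar_linear 1 (0 : L g) 0; rewrite rmorph1 !scale1r addr0.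
  by move/esym/eqP; rewrite -subr_eq0 addrK => /eqP.
by rewrite -[z *: a]addr0 fstar_linear s0 addr0.
Qed.

Lemma tnormM s t : src (bproj s) = rng (bproj t) -> tnorm (tmul s t) <= tnorm s * tnorm t.
Proof. exact: fmul_norm. Qed.

Lemma tnorm_sqr s : tnorm (tmul (tstar s) s) = tnorm s ^+ 2.
Proof. exact: fstar_norm. Qed.

(** The C*-identity gives |u|^2 <= |u*||u|, hence |u| <= |u*|, and the star is
    an involution. *)
Lemma tnorm_star s : tnorm (tstar s) = tnorm s.
Proof.
have le u : tnorm u <= tnorm (tstar u).
  have := tnormM (s := tstar u) (t := u); rewrite tnorm_sqr => /(_ (src_inv _)).
  have [->|n0] := eqVneq (tnorm u) 0; first by rewrite /tnorm normr_ge0.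
  by rewrite expr2 ler_pM2r// /tnorm lt_def n0 normr_ge0.
by apply/eqP; rewrite eq_le le andbT -{2}(tstarK s) le.
Qed.

Lemma unit_vector (g : G) : exists a : L g, `|a| = 1.
Proof.
have [_ /(_ g)[U [sg [c [[_ Ug] n1 _ _ _]]]]] := fell_trivial L.
by exists (sg g); exact: n1.
Qed.

Lemma fibre_one_dim s t : bproj s = bproj t -> tnorm s = 1 -> exists z, t = tscale z s.
Proof.
case: s t => [g a] [h b] /= gh; case: h / gh b => b n1.
have [_ /(_ g)[U [sg [c [[_ Ug] _ cE _ _]]]]] := fell_trivial L.
have a0 : c (tot a) != 0.
  by apply/eqP => c0; move: n1; rewrite /tnorm /= (cE _ a Ug) c0 scale0r normr0 =>
    /eqP; rewrite eq_sym oner_eq0.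
exists (c (tot b) / c (tot a)); rewrite /tscale /=; congr tot.
by rewrite {2}(cE _ a Ug) scalerA divfK// -cE.
Qed.

Lemma tone_mul (x : obj G) s : bproj s = gunit x -> tmul (tone x) s = s.
Proof. by move=> /tot_fibre[a ->]; exact: fone_l. Qed.

Lemma tmul_unit_idem x : tmul (tstar (tone x)) (tone x) = tone x.
Proof.
transitivity (tone (src (gunit x : G))); last by rewrite src_unit.
exact: (set_mem (fone_circle L x)).
Qed.

(** The identity is idempotent, so its norm is 0 or 1; norm 0 would make the
    one-dimensional fibre vanish. *)
Lemma tnorm_one x : tnorm (tone x) = 1.
Proof.
have : tnorm (tone x) ^+ 2 = tnorm (tone x) by rewrite -tnorm_sqr tmul_unit_idem.
have n0 : tnorm (tone x) != 0.
  apply/eqP => /normr0_eq0 /= e0; have [a a1] := unit_vector (gunit x).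
  have : tmul (tone x) (tot a) = tot a by exact: tone_mul.
  move=> /(congr1 tnorm); rewrite /tnorm /= a1 e0 tmul0l ?normr0.
    by move=> /esym/eqP; rewrite oner_eq0.
  by rewrite /composable src_unit rng_unit.
by rewrite expr2 => /(canRL (mulfK n0)); rewrite divff.
Qed.

(** The scalar c in a* a = c 1 is |a|^2, because it is nonnegative and the
    identity has norm 1. *)
Lemma circle_setE s : circle_set s <-> tnorm s = 1.
Proof.
split=> [cs|n1].
  have : tnorm s ^+ 2 = 1 by rewrite -tnorm_sqr -[X in tnorm X]/(tmul (tstar s) s) /tmul
    /tstar /= cs tnorm_one.
  move/eqP; rewrite -[X in _ == X](expr1n _ 2) eqrXn2//; last by rewrite /tnorm.
  by move/eqP.
case: s n1 => g a n1.
have [c c0 cE] := fstar_ge0 a; rewrite /circle_set /= cE.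
suff -> : c = 1 by rewrite scale1r.
have := congr1 tnorm cE; rewrite -[LHS]/(tnorm (tmul (tstar (tot a)) (tot a))) tnorm_sqr.
by rewrite [tnorm (tot a)]n1 expr1n -[RHS]/(tnorm (tscale c (tone (src g)))) tnormZ
  tnorm_one mulr1 ger0_norm.
Qed.

Lemma tmulVs s : tnorm s = 1 -> tmul (tstar s) s = tone (src (bproj s)).
Proof. by move/circle_setE. Qed.

(** The axioms make [fone] an identity on the fibres over units only. On another
    fibre it multiplies a unit vector [u] by a scalar; multiplying by u* on the
    right leads to a fibre over a unit and shows that this scalar is 1. *)
Lemma tmul1s s : tmul (tone (rng (bproj s))) s = s.
Proof.
have base u : tnorm u = 1 -> tmul (tone (rng (bproj u))) u = u.
  move=> n1; set e := tone _; have eu : src (bproj e) = rng (bproj u) by rewrite src_unit.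
  have [z zE] : exists z, tmul e u = tscale z u.
    by apply: fibre_one_dim => //; rewrite /e /= gmul1.
  have uu : src (bproj u) = rng (bproj (tstar u)) by rewrite rng_inv.
  have h : tmul e (tmul u (tstar u)) = tmul u (tstar u).
    by rewrite tone_mul//; exact: gmulgV.
  rewrite -tmulA// zE tmulZl// in h.
  have n2 : tnorm (tmul u (tstar u)) = 1.
    by rewrite -{1}(tstarK u) tnorm_sqr tnorm_star n1 expr1n.
  have [a aE] := tot_fibre (erefl (bproj (tmul u (tstar u)))).
  move: h n2; rewrite aE /tscale /tnorm /= => /tot_inj h n2.
  suff z1 : z = 1 by rewrite zE z1 tscale1.
  apply/eqP; rewrite -subr_eq0; have : (z - 1) *: a = 0 by rewrite scalerBl scale1r h subrr.
  move/eqP; rewrite scaler_eq0 => /orP[//|/eqP a0]; move: n2; rewrite a0 normr0.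
  by move=> /esym/eqP; rewrite oner_eq0.
have [a a1] := unit_vector (bproj s).
have [z ->] := fibre_one_dim (s := tot a) (t := s) erefl a1.
rewrite tmulZr; last exact: src_unit.
by congr tscale; exact: (base (tot a)).
Qed.

(** Submultiplicativity bounds the norm above, and t = s* (s t) bounds it
    below. *)
Lemma tnorm_mul1 s t : src (bproj s) = rng (bproj t) -> tnorm s = 1 -> tnorm t = 1 ->
  tnorm (tmul s t) = 1.
Proof.
move=> st s1 t1; apply/eqP; rewrite eq_le; apply/andP; split.
  by have := tnormM st; rewrite s1 t1 mulr1.
have tE : tmul (tstar s) (tmul s t) = t.
  by rewrite -tmulA ?src_inv// tmulVs// st tmul1s.
rewrite -t1 -[in leLHS]tE; apply: (le_trans (tnormM _)).
  by rewrite src_inv /= rng_mul.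
by rewrite tnorm_star s1 mul1r.
Qed.

Implicit Types (y : circle L).

Lemma circle_norm y : tnorm (val y) = 1.
Proof. by apply/circle_setE; exact: (set_mem (valP y)). Qed.

Lemma val_circle_mul y1 y2 : src (cproj y1) = rng (cproj y2) ->
  val (circle_mul y1 y2) = tmul (val y1) (val y2).
Proof.
move=> e; rewrite /circle_mul insubdK// inE; apply/circle_setE.
by apply: tnorm_mul1 => //; exact: circle_norm.
Qed.

Lemma val_circle_inv y : val (circle_inv y) = tstar (val y).
Proof.
rewrite /circle_inv insubdK// inE; apply/circle_setE.
by rewrite -[tot _]/(tstar (val y)) tnorm_star circle_norm.
Qed.

Lemma val_circle_scale z y : `|z| = 1 -> val (circle_scale z y) = tscale z (val y).
Proof.
move=> z1; rewrite /circle_scale insubdK// inE; apply/circle_setE.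
by rewrite -[tot _]/(tscale z (val y)) tnormZ z1 mul1r circle_norm.
Qed.

Lemma circle_inhabited (g : G) : exists y, cproj y = g.
Proof.
have [a a1] := unit_vector g.
have ca : tot a \in @circle_set R G L by rewrite inE; apply/circle_setE.
by exists (exist _ (tot a) ca).
Qed.

End BundleAlgebra.

(** * The topology of the circle extension *)

Section UnitCircle.
Variable R : realType.
Implicit Types (t : R) (z : R[i]).

Lemma expi_norm t : `|expi t| = 1.
Proof. by rewrite normc_def /= cos2Dsin2 sqrtr1. Qed.

Lemma expiD s t : expi (s + t) = expi s * expi t.
Proof.
rewrite /expi cosD sinD; apply/eqP; rewrite eq_complex /= eqxx /=.
by apply/eqP; ring.
Qed.

Lemma expi_conj t : Num.conj (expi t) = expi (- t).
Proof. by rewrite /expi cosN sinN. Qed.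

Lemma expi_period t : expi (t + 2 * pi) = expi t.
Proof. by rewrite /expi mulr_natl cosD2pi sinD2pi. Qed.

Lemma expi_surj z : `|z| = 1 -> exists2 t, 0 <= t <= 2 * pi & z = expi t.
Proof.
case: z => a b; rewrite normc_def /= => /(congr1 (@complex.Re R)) /= h.
have ab : a ^+ 2 + b ^+ 2 = 1.
  by rewrite -[LHS]sqr_sqrtr ?addr_ge0 ?sqr_ge0// h expr1n.
have a1 : -1 <= a <= 1.
  rewrite -ler_norml -(@ler_pXn2r _ 2) ?nnegrE// expr1n real_normK ?num_real//.
  by rewrite -ab lerDl sqr_ge0.
have [c0 cpi] := (acos_ge0 a1, acos_lepi a1).
have cosE : cos (acos a) = a by rewrite acosK.
have sinE : sin (acos a) = `|b|.
  by rewrite sin_acos// -ab addrC addKr sqrtr_sqr.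
have p0 := pi_ge0 R.
have [b0|b0] := leP 0 b.
  exists (acos a); last by rewrite /expi cosE sinE ger0_norm.
  by rewrite c0 /=; lra.
exists (- acos a + 2 * pi); first lra.
by rewrite expi_period /expi cosN sinN cosE sinE ltr0_norm// opprK.
Qed.

Lemma continuous_complex_of_real : continuous (fun t : R => (t%:C : R[i]^o)).
Proof.
move=> t U /complex_ball[r r0 rU]; rewrite nbhs_simpl /=.
exists r => //= s; rewrite /ball /= => ts; apply: rU.
by rewrite -rmorphB normC_real ltcR.
Qed.

Lemma continuous_expi : continuous (@expi R : R -> R[i]^o).
Proof.
rewrite (_ : (@expi R : R -> R[i]^o) = fun t =>
  ((cos t)%:C : R[i]^o) + ii R * (sin t)%:C); last first.
  by apply/funext => t; rewrite [LHS](complexE (expi t)).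
move=> t; apply: cvgD; last apply: cvgM; last 2 first.
- exact: cvg_cst.
- by apply: (continuous_comp (@continuous_sin R t)); exact: continuous_complex_of_real.
- by apply: (continuous_comp (@continuous_cos R t)); exact: continuous_complex_of_real.
Qed.

End UnitCircle.

Lemma continuous_pair (X Y Z : topologicalType) (f : X -> Y) (g : X -> Z) (x : X) :
  {for x, continuous f} -> {for x, continuous g} ->
  {for x, continuous (fun x => (f x, g x))}.
Proof. by move=> cf cg; exact: (cvg_pair cf cg). Qed.

Section CircleTopology.
Variables (R : realType) (G : topGroupoid) (L : fell_line_bundle R G).
Hypotheses (lcG : locally_compact [set: G]) (hG : hausdorff_space G).
Local Notation E := (total_space L).
Local Notation cp := (@cproj R G L).

Lemma continuous_circle_val : continuous (val : circle L -> E).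
Proof. exact: initial_continuous. Qed.

Lemma continuous_into_circle (Z : topologicalType) (h : Z -> circle L) (z : Z) :
  {for z, continuous (fun x => val (h x) : E)} -> {for z, continuous h}.
Proof.
move=> ch V; rewrite nbhsE => -[B [[A oA AB] Bz] BV].
apply: filterS BV _; rewrite -AB; apply: ch.
by apply: open_nbhs_nbhs; split => //; move: Bz; rewrite -AB.
Qed.

Lemma continuous_bproj : continuous (@bproj R G L).
Proof. by have [] := fell_trivial L. Qed.

Lemma continuous_cproj : continuous (@cproj R G L).
Proof.
move=> y; apply: (continuous_comp (continuous_circle_val (x := y))).
exact: continuous_bproj.
Qed.

Lemma open_within_pointwise (X Y : topologicalType) (A : set X) (f : X -> Y) (x : X) :
  open A -> {within A, continuous f} -> A x -> {for x, continuous f}.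
Proof.
by move=> oA; rewrite continuous_open_subspace// => + Ax; apply; rewrite inE.
Qed.

(** Local triviality with continuity at points instead of on subspaces. *)
Lemma bundle_chart (g0 : G) : exists (U : set G) (sg : forall g, L g) (c : E -> R[i]^o),
  [/\ open U /\ U g0, forall g, U g -> `|sg g| = 1,
      forall g (a : L g), U g -> a = c (tot a) *: sg g,
      forall g (z : R[i]^o), U g -> {for (g, z), continuous
        (fun q : G * R[i]^o => tot ((q.2 : R[i]) *: sg q.1) : E)}
    & forall t, U (bproj t) -> {for t, continuous c}].
Proof.
have [_ /(_ g0)[U [sg [c [[oU Ug0] n1 cE cont1 cont2]]]]] := fell_trivial L.
exists U, sg, c; split => //.
- move=> g z Ug; apply: (open_within_pointwise _ cont1) => //.
  by apply: (continuous_open (f := fst)) => // x; exact: cvg_fst.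
- move=> t Ut; apply: (open_within_pointwise _ cont2) => //.
  exact: continuous_open continuous_bproj oU.
Qed.

Definition circle_rot (t : R) (y : circle L) : circle L := circle_scale (expi t) y.

Lemma val_circle_rot t y : val (circle_rot t y) = tscale (expi t) (val y).
Proof. by rewrite val_circle_scale// expi_norm. Qed.

Lemma cproj_circle_rot t y : cproj (circle_rot t y) = cproj y.
Proof. by rewrite /cproj val_circle_rot. Qed.

Lemma circle_rotD s t y : circle_rot s (circle_rot t y) = circle_rot (s + t) y.
Proof. by apply: val_inj; rewrite !val_circle_rot tscaleA expiD. Qed.

Lemma circle_rot_period t y : circle_rot (t + 2 * pi) y = circle_rot t y.
Proof. by apply: val_inj; rewrite !val_circle_rot expi_period. Qed.

Lemma circle_rot_transitive y y' :
  cproj y = cproj y' -> exists2 t, 0 <= t <= 2 * pi & y' = circle_rot t y.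
Proof.
move=> yy'; have [z zE] := fibre_one_dim (s := val y) (t := val y') yy' (circle_norm y).
have z1 : `|z| = 1.
  by have := circle_norm y'; rewrite zE tnormZ circle_norm mulr1.
have [t t2 tE] := expi_surj z1; exists t => //.
by apply: val_inj; rewrite val_circle_rot -tE.
Qed.

(** A circle is parametrised by angles because its measure is an integral over
    angles. *)
Lemma circle_chart (g0 : G) : exists (U : set G) (sg : G -> circle L),
  [/\ open U /\ U g0, forall g, U g -> cproj (sg g) = g
    & forall g t, U g -> {for (g, t), continuous (fun q : G * R =>
      circle_rot q.2 (sg q.1))}].
Proof.
have [U [sg [c [[oU Ug0] n1 cE cont1 cont2]]]] := bundle_chart g0.
have [y0 _] := circle_inhabited L g0.
pose s g : circle L := insubd y0 (tot (sg g)).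
have sE g : U g -> val (s g) = tot (sg g).
  by move=> Ug; rewrite insubdK// inE; apply/circle_setE; exact: n1.
exists U, s; split => // [g Ug|g t Ug]; first by rewrite /cproj sE.
apply: continuous_into_circle.
pose F (q : G * R) : E := tot (expi q.2 *: sg q.1).
have cF : {for (g, t), continuous F}.
  pose k (q : G * R) : G * R[i]^o := (q.1, expi q.2).
  have ck : {for (g, t), continuous k}.
    apply: continuous_pair; first exact: cvg_fst.
    by apply: (@continuous_comp _ _ _ snd (@expi R : R -> R[i]^o));
      [exact: cvg_snd | exact: continuous_expi].
  exact: (@continuous_comp _ _ _ k (fun q : G * R[i]^o => tot ((q.2 : R[i]) *: sg q.1) : E)
    (g, t) ck (cont1 _ _ Ug)).
move=> V; rewrite /= val_circle_rot sE// => nV.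
have nF : nbhs (g, t) (F @^-1` V) by apply: cF.
have nU : nbhs (g, t) (fst @^-1` U).
  exists (U, setT); last by move=> [a b] [].
  by split; [apply: open_nbhs_nbhs; split | exact: filterT].
apply: filterS (filterI nF nU) => -[h s'] [/= Fh Uh].
by rewrite /= val_circle_rot sE.
Qed.

(** Points over different arrows are separated by the projection, points of one
    fibre by the coordinate of a chart. *)
Lemma circle_hausdorff : hausdorff_space (circle L).
Proof.
move=> y y' yy'.
have sep (Z : topologicalType) (f : circle L -> Z) : hausdorff_space Z ->
    {for y, continuous f} -> {for y', continuous f} -> f y = f y'.
  move=> hZ cy cy'; apply: hZ => A B nA nB.
  by have [z [Az Bz]] := yy' _ _ (cy _ nA) (cy' _ nB); exists (f z).
have py : cproj y = cproj y'.
  by apply: sep => //; exact: continuous_cproj.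
have [U [sg [c [[oU Ug0] n1 cE _ cont2]]]] := bundle_chart (cproj y).
have cc : c (val y) = c (val y').
  apply: (sep _ (fun x => c (val x)) (@norm_hausdorff _ R[i]^o)).
    by apply: (continuous_comp (continuous_circle_val (x := y))); exact: cont2.
  by apply: (continuous_comp (continuous_circle_val (x := y'))); apply: cont2;
    rewrite -[bproj _]py.
apply: val_inj; move: py cc Ug0; rewrite /cproj;
  case: (val y) (val y') => [g a] [h b] /= gh.
case: h / gh b => b cc Ug.
by rewrite (cE _ a Ug) (cE _ b Ug) cc.
Qed.

(** Over a small compact set the circle extension is the image of the product of
    that set with an interval of angles. *)
Lemma circle_proper (K : set G) : compact K -> compact (cp @^-1` K : set (circle L)).
Proof.
move=> kK.
have [C kC KC] : exists2 C : set (circle L), compact C & cp @^-1` K `<=` C.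
  apply: (@compact_induction G K (fun A => exists2 C : set (circle L), compact C &
    cp @^-1` A `<=` C) kK).
  - by exists set0; [exact: compact0 | move=> y].
  - by move=> A B AB [C kC BC]; exists C => // y /AB; exact: BC.
  - move=> A B [C kC AC] [D kD BD]; exists (C `|` D); first exact: compactU.
    by move=> y [/AC|/BD]; [left|right].
  - move=> g _; have [U [sg [[oU Ug] sgE cont]]] := circle_chart g.
    have [W [oW Wg kW WU]] := lc_open_nbhs lcG hG oU Ug.
    exists W; first by apply: open_nbhs_nbhs; split.
    exists ((fun q : G * R => circle_rot q.2 (sg q.1)) @` (closure W `*` `[0, 2 * pi])).
      apply: continuous_compact.
        apply: continuous_in_subspaceT => -[h t] /[!inE] -[/= Wh _].
        by apply: cont; exact: WU.
      by apply: compact_setX => //; exact: segment_compact.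
    move=> y Wy; have Wc : closure W (cproj y) by exact: subset_closure.
    have [t t2 ->] := @circle_rot_transitive (sg (cproj y)) y (sgE _ (WU _ Wc)).
    by exists (cproj y, t) => //; split => //=; rewrite in_itv.
apply: subclosed_compact kC KC; apply: continuous_closed; first exact: continuous_cproj.
exact: compact_closed.
Qed.

Lemma circle_locally_compact : locally_compact [set: circle L].
Proof.
move=> y _; have [W [oW Wy kW _]] := lc_open_nbhs lcG hG openT (I : [set: G] (cproj y)).
rewrite withinET; exists (cp @^-1` closure W).
  apply: (@filterS _ (nbhs y) _ _ _ (preimage_subset (@subset_closure _ W))).
  by apply: continuous_cproj; apply: open_nbhs_nbhs; split.
split; first exact: circle_proper.
by apply: continuous_closed; [exact: continuous_cproj | exact: closed_closure].
Qed.

(** The projection is closed because it is proper; hence the points whose whole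
    fibre lies in an open set form an open set. *)
Lemma fibre_inside_open (V : set (circle L)) : open V ->
  open [set g : G | forall y, cproj y = g -> V y].
Proof.
move=> oV; rewrite openE => g /= gV;
  have [W [oW Wg kW _]] := lc_open_nbhs lcG hG openT (I : [set: G] g).
pose F := cp @` ((cp @^-1` closure W : set (circle L)) `&` ~` V).
have cF : closed F.
  apply: compact_closed => //; apply: continuous_compact.
    exact/continuous_subspaceT/continuous_cproj.
  by apply: compact_closedI; [exact: circle_proper | exact: open_closedC].
have nF : nbhs g (W `&` ~` F).
  apply: open_nbhs_nbhs; split; first by apply: openI => //; exact: closed_openC.
  by split => // -[y [_ nVy] yg]; apply: nVy; exact: gV.
apply: filterS nF => h [Wh nFh] y yh; apply: contrapT => nVy; apply: nFh.
by exists y => //; split => //=; rewrite yh; exact: subset_closure.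
Qed.

End CircleTopology.

(** * Averages over the circles *)

Section Average.
Variables (R : realType) (G : topGroupoid) (L : fell_line_bundle R G).
Hypotheses (lcG : locally_compact [set: G]) (hG : hausdorff_space G).
Local Notation E := (total_space L).
Local Notation cp := (@cproj R G L).
Implicit Types (f : circle L -> R) (y : circle L).

Lemma continuous_circle_rot y : continuous (fun t => circle_rot t y).
Proof.
have [U [sg [[oU Ug] sgE cont]]] := circle_chart L (cproj y).
have [s _ ->] := circle_rot_transitive (sgE _ Ug).
move=> t; rewrite (_ : (fun t => _) = fun t => circle_rot (t + s) (sg (cproj y)));
  last first.
  by apply/funext => u; rewrite circle_rotD.
apply: (@continuous_comp _ _ _ (fun t => (cproj y, t + s)) (fun q : G * R =>
  circle_rot q.2 (sg q.1))).
  apply: continuous_pair; first exact: cvg_cst.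
  by apply: cvgD; [exact: cvg_id | exact: cvg_cst].
exact: cont.
Qed.

Lemma continuous_orbit f y : continuous f -> continuous (fun t => f (circle_rot t y)).
Proof.
move=> cf t; apply: (@continuous_comp _ _ _ (fun t => circle_rot t y) f); last exact: cf.
exact: continuous_circle_rot.
Qed.

(** Two points of a fibre differ by a rotation, which shifts the angle; so the
    average is the same for both. *)
Lemma circle_averageE f y : continuous f ->
  circle_average f (cproj y) = period_mean (fun t => f (circle_rot t y)).
Proof.
move=> cf; apply: xget_subset1; first by exists y.
have mean y' : cproj y' = cproj y ->
    period_mean (fun t => f (circle_rot t y')) = period_mean (fun t => f (circle_rot t y)).
  move=> e; have [s s2 ->] := circle_rot_transitive (esym e).
  rewrite -[RHS](period_mean_shift (s := s))//.
  - by congr period_mean; apply/funext => t; rewrite circle_rotD.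
  - exact: continuous_orbit.
  - by move=> t; rewrite circle_rot_period.
by move=> _ _ [y1 e1 ->] [y2 e2 ->];
  rewrite -[LHS]/(period_mean (fun t => f (circle_rot t y1))) (mean y1 e1) -(mean y2 e2).
Qed.

Lemma circle_average_lin (a : R) f k : continuous f -> continuous k -> forall g,
  circle_average (fun y => a * f y + k y) g = a * circle_average f g + circle_average k g.
Proof.
move=> cf ck g; have [y <-] := circle_inhabited L g.
rewrite !circle_averageE//; last first.
  exact: continuous_lin.
by apply: period_mean_lin; exact: continuous_orbit.
Qed.

Lemma circle_average_le f k : continuous f -> continuous k -> forall g,
  (forall y, cproj y = g -> f y <= k y) -> circle_average f g <= circle_average k g.
Proof.
move=> cf ck g; have [y <-] := circle_inhabited L g => h.
rewrite !circle_averageE//.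
by apply: period_mean_le => [||t]; [exact: continuous_orbit..| apply: h;
  exact: cproj_circle_rot].
Qed.

Lemma circle_average_const f g (c : R) : continuous f ->
  (forall y, cproj y = g -> f y = c) -> circle_average f g = c.
Proof.
move=> cf; have [y <-] := circle_inhabited L g => h; rewrite circle_averageE//.
rewrite (_ : (fun t => _) = fun=> c) ?period_mean_cst//.
by apply/funext => t; apply: h; exact: cproj_circle_rot.
Qed.

Lemma circle_average_pull f (k : G -> R) g : continuous f -> continuous k ->
  circle_average (fun y => f y * k (cproj y)) g = circle_average f g * k g.
Proof.
move=> cf ck; have [y <-] := circle_inhabited L g; rewrite !circle_averageE//; last first.
  apply: continuous_mul => // x.
  by apply: (continuous_comp (@continuous_cproj R G L x)); exact: ck.
rewrite (_ : (fun t => _) = fun t => k (cproj y) * f (circle_rot t y) + (fun=> 0) t).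
  rewrite period_mean_lin; last by exact: cst_continuous.
    by rewrite period_mean_cst addr0 mulrC.
  exact: continuous_orbit.
by apply/funext => t; rewrite cproj_circle_rot addr0 mulrC.
Qed.

(** Uniform continuity of [f] along the compact orbit of the circle. *)
Lemma continuous_circle_average f : continuous f -> continuous (circle_average f).
Proof.
move=> cf g0; apply/cvgrPdist_le => e e0.
have [U [sg [[oU Ug0] sgE cont]]] := circle_chart L g0.
pose F (q : G * R) := f (circle_rot q.2 (sg q.1)).
have cF g t : U g -> {for (g, t), continuous F}.
  move=> Ug; apply: (@continuous_comp _ _ _ (fun q : G * R =>
    circle_rot q.2 (sg q.1)) f); last exact: cf.
  exact: cont.
have e2 : 0 < e / 2 by rewrite divr_gt0.
have [V [nV hV]] : exists V : set G, nbhs g0 V /\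
    forall g t, V g -> `[0, 2 * pi]%classic t -> `|F (g0, t) - F (g, t)| <= e.
  apply: (@compact_induction R `[0, 2 * pi]%classic (fun A => exists V : set G, nbhs g0 V /\
    forall g t, V g -> A t -> `|F (g0, t) - F (g, t)| <= e) (@segment_compact R _ _)).
  - by exists setT; split => //; exact: filterT.
  - by move=> A B AB [V [nV hV]]; exists V; split => // g t Vg /AB; exact: hV.
  - move=> A B [V [nV hV]] [W [nW hW]]; exists (V `&` W); split; first exact: filterI.
    by move=> g t [Vg Wg] [/hV|/hW]; apply.
  - move=> t _.
    have nb : nbhs (g0, t) (F @^-1` ball (F (g0, t)) (e / 2)).
      by apply: cF => //; exact: nbhsx_ballx.
    have [[V T] [/= nV nT] VT] := nb.
    exists T => //; exists V; split => // g s Vg Ts.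
    have h1 : ball (F (g0, t)) (e / 2) (F (g, s)) by exact: (VT (g, s)).
    have h2 : ball (F (g0, t)) (e / 2) (F (g0, s)).
      by apply: (VT (g0, s)); split => //=; exact: nbhs_singleton.
    rewrite [e]splitr; apply: ltW; apply: le_lt_trans (ler_distD (F (g0, t)) _ _) _.
    by apply: ltrD; [rewrite distrC|].
have nVU : nbhs g0 (V `&` U) by apply: filterI => //; apply: open_nbhs_nbhs; split.
apply: filterS nVU => g [Vg Ug].
have := circle_averageE (sg g0) cf; rewrite sgE// => ->.
have := circle_averageE (sg g) cf; rewrite sgE// => ->.
apply: period_mean_near => [||t t2]; [exact: continuous_orbit..|].
by apply: (hV g t Vg); rewrite /= in_itv.
Qed.

Lemma circle_fibre_integral : fibre_integral cp (@circle_average R G L).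
Proof.
have loc f g : continuous f -> (forall y, cproj y = g -> f y = 0) -> circle_average f g = 0.
  by move=> cf; exact: circle_average_const.
split.
- move=> f [cf kf]; split; first exact: continuous_circle_average.
  have kr : compact (cp @` supp f).
    by apply: continuous_compact => //; exact/continuous_subspaceT/continuous_cproj.
  apply: (subclosed_compact _ kr); first exact: closed_closure.
  apply: supp_sub; first exact: compact_closed.
  move=> g; apply: contraNP => ng; apply/eqP; apply: loc => // y yg.
  by apply: supp_out => sy; apply: ng; exists y.
- by move=> a f k [cf _] [ck _] g; exact: circle_average_lin.
- move=> f [cf _] f0 g; rewrite -(@circle_average_const (fun=> 0) g 0)//.
    by apply: circle_average_le => //; exact: cst_continuous.
  exact: cst_continuous.
- by move=> f g [cf _]; exact: loc.
Qed.

Lemma continuous_circle_inv : continuous (@circle_inv R G L).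
Proof.
move=> y; apply: continuous_into_circle.
rewrite (_ : (fun x => _) = (fun x => tstar (val x))); last first.
  by apply/funext => x; exact: val_circle_inv.
apply: (continuous_comp (continuous_circle_val (x := y))).
exact: (fstar_continuous (f := L)).
Qed.

Lemma cproj_inv y : cproj (circle_inv y) = ginv (cproj y).
Proof. by rewrite /cproj val_circle_inv. Qed.

Lemma circle_inv_rot t y : circle_inv (circle_rot t y) = circle_rot (- t) (circle_inv y).
Proof.
apply: val_inj; rewrite val_circle_inv !val_circle_rot val_circle_inv tstarZ.
by rewrite expi_conj.
Qed.

Lemma circle_invK y : circle_inv (circle_inv y) = y.
Proof. by apply: val_inj; rewrite !val_circle_inv tstarK. Qed.

(** Inversion reverses the angle of rotations. *)
Lemma circle_average_inv f g : continuous f ->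
  circle_average (fun y => f (circle_inv y)) g = circle_average f (ginv g).
Proof.
move=> cf; have [y <-] := circle_inhabited L g; rewrite -cproj_inv.
have cfi : continuous (fun y => f (circle_inv y)).
  by move=> x; apply: (continuous_comp (continuous_circle_inv (x := x))); exact: cf.
rewrite !circle_averageE//.
rewrite (_ : (fun t => _) = fun t => (fun u => f (circle_rot u (circle_inv y))) (- t));
  last first.
  by apply/funext => t; rewrite circle_inv_rot.
apply: (period_mean_opp (phi := fun u => f (circle_rot u (circle_inv y)))).
  exact: continuous_orbit.
by move=> t; rewrite circle_rot_period.
Qed.

End Average.

(** * Measures on the circle extension *)

Section CircleMeasure.
Variables (R : realType) (G : topGroupoid) (L : fell_line_bundle R G).
Hypotheses (lcG : locally_compact [set: G]) (hG : hausdorff_space G).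
Variable I : (G -> R) -> R.
Hypothesis PI : positive_functional I.
Local Notation cp := (@cproj R G L).
Local Notation avg := (@circle_average R G L).
Let J (f : circle L -> R) := I (avg f).
Local Notation muG := (outer_measure_of I).
Local Notation muS := (outer_measure_of J).

Let lcS : locally_compact [set: circle L] := circle_locally_compact lcG hG.
Let hS : hausdorff_space (circle L) := circle_hausdorff hG.
Let fib : fibre_integral cp avg := circle_fibre_integral L hG.
Let PJ : positive_functional J := fibre_positive fib PI.

Lemma subordinate_average f (U : set G) :
  subordinate f (cp @^-1` U) -> subordinate (avg f) U.
Proof.
move=> [cf f01 fU]; split.
- exact: (fibre_Cc fib).
- move=> g; rewrite (fibre_pos fib)//=; last by move=> y; case/andP: (f01 y).
  rewrite -(@circle_average_const _ _ L (fun=> 1) g 1)//; last exact: cst_continuous.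
  apply: circle_average_le; [exact: cf.1 | exact: cst_continuous|].
  by move=> y _; case/andP: (f01 y).
- move=> g /(fibre_supp hG (@continuous_cproj R G L) fib cf)[y /fU Uy <-]; exact: Uy.
Qed.

Lemma Cc_circle_pull (f : G -> R) : Cc f -> Cc (fun y => f (cp y)).
Proof.
move=> [cf kf]; apply: (@Cc_supp _ _ _ (cp @^-1` supp f)).
- by move=> y; apply: (continuous_comp (@continuous_cproj R G L y)); exact: cf.
- exact: circle_proper.
- by apply: continuous_closed; [exact: continuous_cproj | exact: closed_closure].
- by move=> y fy; exact: subset_closure.
Qed.

Lemma subordinate_circle_pull (f : G -> R) (U : set G) : subordinate f U ->
  subordinate (fun y => f (cp y)) (cp @^-1` U).
Proof.
move=> [cf f01 fU]; split => //; first exact: Cc_circle_pull.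
apply: (@subset_trans _ (cp @^-1` supp f)); last by move=> y /fU.
apply: supp_sub; last by move=> y fy; exact: subset_closure.
by apply: continuous_closed; [exact: continuous_cproj | exact: closed_closure].
Qed.

(** Averaging takes functions subordinate to the preimage of [U] to functions
    subordinate to [U], which gives one inequality. For the other one, an open
    set that contains the preimage of [A] contains the preimage of an open
    neighbourhood of [A], since the projection is proper, and functions that are
    pulled back are equal to their average. *)
Lemma content_saturated (A : set G) : muS (cp @^-1` A) = muG A.
Proof.
apply/eqP; rewrite eq_le; apply/andP; split.
  apply: le_ereal_inf_tmp => _ [U [oU AU] <-]; rewrite -content_openE//.
  apply: (@le_trans _ _ (muS (cp @^-1` U))).
    by apply: contentS => y; exact: AU.
  apply: content_le; first exact: continuous_open (@continuous_cproj R G L) oU.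
  by move=> f /subordinate_average; exact: content_ge.
apply: le_ereal_inf_tmp => _ [V [oV AV] <-]; rewrite -content_openE//.
have oU := fibre_inside_open lcG hG oV; set U := [set g | _] in oU.
apply: (@le_trans _ _ (muG U)).
  by apply: contentS => g Ag y yg; apply: AV; rewrite /preimage /= yg.
apply: content_le => // f fU; have [[cf _] _ _] := fU.
have -> : I f = J (fun y => f (cp y)).
  congr I; apply/funext => g; apply/esym/circle_average_const; last by move=> y ->.
  by move=> y; apply: (continuous_comp (@continuous_cproj R G L y)); exact: cf.
apply: content_ge => //; apply: subordinateS (subordinate_circle_pull fU).
by move=> y Uy; exact: Uy.
Qed.

Lemma negligible_saturated (A : set G) :
  negligible_for J (cp @^-1` A) <-> negligible_for I A.
Proof.
split=> [nA K kK|nA]; last exact: (@fibre_null _ _ _ hG lcS hS _ _ _ (@continuous_cproj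
  R G L) fib PI _ nA).
rewrite -content_saturated preimage_setI; apply: nA; exact: circle_proper.
Qed.

(** Only saturated test sets are tried, and their measures are those of their
    images. *)
Lemma caratheodory_saturated (A : set G) :
  muS.-caratheodory (cp @^-1` A) -> muG.-caratheodory A.
Proof.
move=> mA Y; rewrite -(content_saturated Y) -(content_saturated (Y `&` A)).
by rewrite -(content_saturated (Y `&` ~` A)) !preimage_setI -preimage_setC.
Qed.

(** The points over which the fibre of [V] has rotation invariant measure above
    [t], expressed through functions. *)
Definition thick (V : set (circle L)) (t : R) : set G :=
  [set g | exists2 f, subordinate f V & t < avg f g].

Lemma thick_open V t : open (thick V t).
Proof.
rewrite (_ : thick V t = \bigcup_(f in [set f | subordinate f V]) (avg f @^-1` [set r |
  t < r])).
  apply: bigcup_open => f [[cf _] _ _]; apply: continuous_open; last exact: open_gt.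
  exact: continuous_circle_average.
by apply/seteqP; split => g [f fV h]; exists f.
Qed.

(** Markov's inequality. By compactness a single function subordinate to [V]
    has averages above [t] on the support of a given test function. *)
Lemma content_thick V t : open V -> 0 < t -> (t%:E * muG (thick V t) <= muS V)%E.
Proof.
move=> oV t0; rewrite muleC -lee_pdivlMr//.
apply: content_le; first exact: thick_open.
move=> h [ch h01 hV]; rewrite lee_pdivlMr//.
have [f fV fh] : exists2 f, subordinate f V & forall g, supp h g -> t < avg f g.
  apply: (@compact_induction G (supp h)
    (fun A => exists2 f, subordinate f V & forall g, A g -> t < avg f g) ch.2).
  - by exists (fun=> 0) => //; exact: subordinate0.
  - by move=> A B AB [f fV hf]; exists f => // g /AB; exact: hf.
  - move=> A B [f fV hf] [k kV hk]; exists (fun y => Num.max (f y) (k y)).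
      have [cf f01 sf] := fV; have [ck k01 sk] := kV; split.
      + exact: Cc_max.
      + by move=> x; rewrite le_max ge_max; have /andP[-> ->] := f01 x; case/andP: (k01 x).
      + apply: (@subset_trans _ (supp f `|` supp k)); last by move=> x [/sf|/sk].
        apply: supp_sub; first by apply: closedU; exact: closed_closure.
        by move=> x; apply: contraNP => /not_orP[/supp_out -> /supp_out ->]; rewrite maxxx.
    have [[cf _ _] [ck _ _]] := (fV, kV); have cm := Cc_max cf ck.
    move=> g [/hf|/hk] /lt_le_trans; apply; apply: circle_average_le; try exact: cm.1.
    + exact: cf.1.
    + by move=> y _; rewrite le_max lexx.
    + exact: ck.1.
    + by move=> y _; rewrite le_max lexx orbT.
  - move=> g /hV[f fV tf]; exists (avg f @^-1` [set r | t < r]); last by exists f.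
    apply: open_nbhs_nbhs; split => //; apply: continuous_open; last exact: open_gt.
    by case: fV => [[cf _] _ _]; exact: continuous_circle_average.
have [cf f01 _] := fV; apply: le_trans (content_ge J oV fV).
rewrite -EFinM lee_fin mulrC -functionalZ//.
apply: functional_le => //.
- by have := Cc_lin t ch (Cc_cst0 R G); congr Cc; apply/funext => g; rewrite addr0.
- exact: (fibre_Cc fib).
- move=> g; have [/fh/ltW|/supp_out ->] := pselect (supp h g).
    by apply: le_trans; rewrite ler_piMr ?(ltW t0)//; case/andP: (h01 g).
  by rewrite mulr0; apply: (fibre_pos fib) => // y; case/andP: (f01 y).
Qed.

(** A cut-off that is 1 where the average of [f] is at least t + d splits [f]:
    one summand lives over the thick fibres, and the average of the other one is
    at most t + d. *)
Lemma content_thin V (W : set G) t : open V -> open W -> 0 < t -> (muG W < +oo)%E ->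
  (muS ((V `&` cp @^-1` W) `\` cp @^-1` (thick V t)) <= t%:E * muG W)%E.
Proof.
move=> oV oW t0 Wfin; set V1 := V `&` cp @^-1` W; set P := thick V t.
have oP : open P := thick_open V t.
have oV1 : open V1 by apply: openI => //;
  exact: continuous_open (@continuous_cproj R G L) oW.
have ocP : open (cp @^-1` P) by exact: continuous_open (@continuous_cproj R G L) oP.
have W0 := content_ge0 PI W.
have Wnum : muG W \is a fin_num by rewrite ge0_fin_numE.
have V1fin : (muS V1 < +oo)%E.
  apply: le_lt_trans Wfin; rewrite -content_saturated; apply: contentS; exact: subIsetr.
have PVnum : muS (V1 `&` cp @^-1` P) \is a fin_num.
  rewrite ge0_fin_numE ?(content_ge0 PJ)//; apply: le_lt_trans V1fin; apply: contentS.
  exact: subIsetl.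
suff h : (muS V1 <= t%:E * muG W + muS (V1 `&` cp @^-1` P))%E.
  move: h; rewrite [X in (X <= _)%E](caratheodory_open lcS hS PJ ocP V1) addeC.
  by rewrite leeD2rE.
apply: content_le => // f fV1; apply/lee_addgt0Pr => e e0.
have [w wE] : exists w, muG W = w%:E by exists (fine (muG W)); rewrite fineK.
have w0 : 0 <= w by rewrite -lee_fin -wE.
(* Chosen such that d times the measure of [W] is at most e. *)
pose d := e / (w + 1); have d0 : 0 < d by rewrite divr_gt0// ltr_wpDl.
have [cf f01 sf] := fV1; pose k := avg f.
have fV : subordinate f V by apply: subordinateS fV1 => y [].
have [ck k01 kW] : subordinate k W by apply: subordinate_average;
  apply: subordinateS fV1 => y [].
have kC : compact [set g | t + d <= k g].
  apply: (subclosed_compact _ ck.2).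
    exact: (@continuous_closed _ _ k [set r | t + d <= r] ck.1 (@closed_ge _ _)).
  move=> g /= kg; apply: subset_closure; rewrite /= gt_eqF//.
  by apply: lt_le_trans kg; rewrite addr_gt0.
have CP : [set g | t + d <= k g] `<=` P.
  by move=> g /= kg; exists f => //; apply: lt_le_trans kg; rewrite ltrDl.
have [x [cx x01 xP [N oN [CN xN]]]] := urysohn_Cc R lcG hG kC oP CP.
have cxp : continuous (fun y => x (cp y)) by have [] := Cc_circle_pull cx.
have cx1 : continuous (fun g => 1 - x g) := continuous_1B cx.1.
have cxp1 : continuous (fun y => 1 - x (cp y)) := continuous_1B cxp.
have c1 : Cc (fun y => f y * x (cp y)) by exact: Cc_mul.
have c2 : Cc (fun y => f y * (1 - x (cp y))) by exact: Cc_mul.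
have -> : J f = J (fun y => f y * x (cp y)) + J (fun y => f y * (1 - x (cp y))).
  rewrite -(functionalD PJ)//; congr J; apply/funext => y.
  by rewrite -mulrDr addrC subrK mulr1.
rewrite EFinD [leLHS]addeC [leRHS]addeAC; apply: leeD; last first.
  apply: content_ge; first exact: openI.
  split => //.
  - move=> y; have /andP[a0 a1] := f01 y; have /andP[b0 b1] := x01 (cp y).
    by rewrite mulr_ge0//= mulr_ile1.
  - apply: (@subset_trans _ (supp f `&` cp @^-1` supp x)).
      apply: supp_sub.
        apply: closedI; first exact: closed_closure.
        by apply: continuous_closed; [exact: continuous_cproj | exact: closed_closure].
      by move=> y; rewrite mulf_eq0 => /norP[fy xy]; split; exact: subset_closure.
    by move=> y [/sf Vy /xP Py].
have -> : J (fun y => f y * (1 - x (cp y))) = I (fun g => k g * (1 - x g)).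
  congr I; apply/funext => g.
  by rewrite (@circle_average_pull _ _ L f (fun g => 1 - x g))//; exact: cf.1.
have td : 0 < t + d by rewrite addr_gt0.
have ckx : Cc (fun g => k g * (1 - x g)) by exact: Cc_mul.
have sub : subordinate (fun g => (t + d)^-1 * (k g * (1 - x g))) W.
  split.
  - by have := Cc_lin (t + d)^-1 ckx (Cc_cst0 R G); congr Cc; apply/funext => g;
      rewrite addr0.
  - move=> g; have /andP[a0 a1] := k01 g; have /andP[b0 b1] := x01 g.
    rewrite mulr_ge0 ?invr_ge0 ?(ltW td) ?mulr_ge0 ?subr_ge0//=.
    rewrite ler_pdivrMl// mulr1.
    have [h|/ltW h] := leP (t + d) (k g);
      first by rewrite xN ?subrr ?mulr0 ?(ltW td)//; exact: CN.
    by apply: le_trans h; rewrite ler_piMr// gerBl.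
  - apply: subset_trans kW; apply: supp_sub; first exact: closed_closure.
    by move=> g; rewrite !mulf_eq0 => /norP[_ /norP[h _]]; exact: subset_closure.
have := content_ge I oW sub; rewrite (functionalZ PI)// wE lee_fin ler_pdivrMl// => h.
rewrite -EFinM -EFinD lee_fin; apply: le_trans h _.
rewrite mulrDl lerD2l /d mulrAC -mulrA ler_piMr ?(ltW e0)//.
by rewrite ler_pdivrMr ?mul1r ?lerDl ?ltr_wpDl.
Qed.

End CircleMeasure.

(** * Inversion and null sets *)

Lemma content_bigcup0 (R : realType) (X : topologicalType)
    (lcX : locally_compact [set: X]) (hX : hausdorff_space X)
    (I : (X -> R) -> R) (PI : positive_functional I) (A : nat -> set X) :
  (forall n, outer_measure_of I (A n) = 0%E) -> outer_measure_of I (\bigcup_n A n) = 0%E.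
Proof.
move=> A0; apply/eqP; rewrite eq_le (content_ge0 PI) andbT.
apply: (le_trans (content_sigma_subadditive lcX hX PI A)).
by rewrite eseries0.
Qed.

Section InversionNull.
Variables (R : realType) (G : topGroupoid) (L : fell_line_bundle R G).
Hypotheses (lcG : locally_compact [set: G]) (hG : hausdorff_space G).
Variable I : (G -> R) -> R.
Hypothesis PI : positive_functional I.
Local Notation cp := (@cproj R G L).
Local Notation avg := (@circle_average R G L).
Local Notation cinv := (@circle_inv R G L).
Let J (f : circle L -> R) := I (avg f).
Local Notation muG := (outer_measure_of I).
Local Notation muS := (outer_measure_of J).
Let lcS : locally_compact [set: circle L] := circle_locally_compact lcG hG.
Let hS : hausdorff_space (circle L) := circle_hausdorff hG.
Let PJ : positive_functional J := fibre_positive (circle_fibre_integral L hG) PI.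

Hypothesis inv_null : forall N, negligible_for I N -> negligible_for I (ginv @^-1` N).

Lemma thick_inv (V : set (circle L)) t : thick (cinv @^-1` V) t `<=` ginv @^-1` (thick V t).
Proof.
move=> g [f [[cf kf] f01 fV] tf]; exists (fun y => f (cinv y)).
  have cfi : continuous (fun y => f (cinv y)).
    by move=> y; apply: (continuous_comp (@continuous_circle_inv R G L y)); exact: cf.
  have sub : supp (fun y => f (cinv y)) `<=` cinv @^-1` supp f.
    apply: supp_sub; last by move=> y fy; exact: subset_closure.
    by apply: continuous_closed; [exact: continuous_circle_inv | exact: closed_closure].
  split => //; last by move=> y /sub /fV; rewrite /preimage /= circle_invK.
  split => //; have ks : compact (cinv @` supp f).
    by apply: continuous_compact => //; exact/continuous_subspaceT/continuous_circle_inv.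
  apply: (subclosed_compact _ ks); first exact: closed_closure.
  by move=> y /sub sy; exists (cinv y) => //; exact: circle_invK.
by rewrite circle_average_inv// ginvK.
Qed.

(** This replaces Fubini's theorem. Let [V n] be open neighbourhoods of a null set
    of measure below [t n] squared. The base points over which [V n] fills more
    than [t n] of the circle form a set [P n] of measure at most [t n]. The upper
    limit of the [P n] is null, and so is its inverse. Away from it, the inverse
    of [V n] fills at most [t n] of each circle for large [n], because inversion
    is an isometry between circles; so [content_thin] applies. *)
Lemma circle_inv_null N : negligible_for J N -> negligible_for J (cinv @^-1` N).
Proof.
move=> nN; apply: (negligible_for_local lcS hS PJ) => y.
have cinvG : continuous (@ginv G) by have [] := topologicalP G.
have [W [oW Wy kW _]] := lc_open_nbhs lcG hG openT (Logic.I : [set: G] (cp y)).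
have Wfin : (muG W < +oo)%E.
  apply: le_lt_trans (content_compact lcG hG PI kW); apply: contentS.
  exact: subset_closure.
have kC : compact (ginv @` closure W).
  by apply: continuous_compact => //; exact: continuous_subspaceT.
pose N' := N `&` cp @^-1` (ginv @` closure W).
have N'0 : muS N' = 0%E by apply: nN; exact: circle_proper.
(* With this form the sum of [t (m.+1 + j)] over [j] is at most [t m]. *)
pose t n : R := 1 / (2 ^ n.+1)%:R.
have t0 n : 0 < t n by rewrite divr_gt0// ltr0n expn_gt0.
have /choice[V hV] : forall n, exists V, [/\ open V, N' `<=` V & (muS V < (t n * t
  n)%:E)%E].
  by move=> n; apply: outer_regular; rewrite N'0 lte_fin mulr_gt0.
pose P n := thick (V n) (t n).
have P_small n : (muG (P n) <= (t n)%:E)%E.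
  have [oV _ Vt] := hV n; have := le_trans (content_thick hG PI oV (t0 n)) (ltW Vt).
  by rewrite muleC -lee_pdivlMr// -EFinM mulfK ?gt_eqF.
pose Plim := \bigcap_m \bigcup_j P (m + j)%N.
have Plim0 : muG Plim = 0%E.
  apply: (content_null PI) => e e0.
  have [m me] : exists m, t m <= e.
    have [m me] := ltr_add_invr e0; rewrite add0r in me; exists m.
    apply: le_trans (ltW me); rewrite /t div1r lef_pV2 ?posrE ?ltr0n ?expn_gt0// ler_nat.
    exact: ltnW (ltn_expl _ _).
  apply: (@le_trans _ _ (muG (\bigcup_j P (m.+1 + j)%N))).
    by apply: contentS => g; exact.
  apply: (le_trans (content_sigma_subadditive lcG hG PI _)).
  apply: (@le_trans _ _ (\sum_(j <oo) (t m / (2 ^ j.+1)%:R)%:E)%E).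
    apply: lee_nneseries => [j _ _|j _]; first exact: content_ge0.
    apply: (le_trans (P_small _)); rewrite lee_fin /t -mulrA -invfM -natrM -expnD.
    by rewrite addSn addnS.
  by apply: (le_trans (epsilon_trick0 xpredT (ltW (t0 m)))); rewrite lee_fin.
have nP := inv_null (negligible_for0 PI Plim0).
pose Q n := (cinv @^-1` (V n) `&` cp @^-1` W) `\` cp @^-1` (thick (cinv @^-1` (V n)) (t n)).
have Q_small n : (muS (Q n) <= (t n)%:E * muG W)%E.
  apply: content_thin => //; have [oV _ _] := hV n.
  exact: continuous_open (@continuous_circle_inv R G L) oV.
have Qlim0 m : muS (\bigcap_j Q (m + j)%N) = 0%E.
  apply: (content_null PJ) => e e0.
  have [w wE] : exists w, muG W = w%:E.
    by exists (fine (muG W)); rewrite fineK// ge0_fin_numE// content_ge0.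
  have w0 : 0 <= w by rewrite -lee_fin -wE; exact: content_ge0.
  have w1 : 0 < w + 1 by rewrite ltr_wpDl.
  have [j je] := ltr_add_invr (divr_gt0 e0 w1); rewrite add0r in je.
  apply: (@le_trans _ _ (muS (Q (m + j)%N))).
    by apply: contentS => z; exact.
  apply: (le_trans (Q_small _)); rewrite wE -EFinM lee_fin.
  apply: (@le_trans _ _ (e / (w + 1) * (w + 1))); last by rewrite divfK ?gt_eqF.
  apply: ler_pM => //; [exact: ltW | | by rewrite lerDl].
  apply: le_trans (ltW je); rewrite /t div1r lef_pV2 ?posrE ?ltr0n ?expn_gt0// ler_nat.
  apply: leq_ltn_trans (leq_addl m j) _; apply: ltn_trans (ltn_expl _ _).
    by [].
  by [].
exists (cp @^-1` W).
  by apply: continuous_cproj; apply: open_nbhs_nbhs; split.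
apply: (content_eq0 PJ (B := (cp @^-1` (ginv @^-1` Plim) `&` cp @^-1` closure W) `|`
    \bigcup_m \bigcap_j Q (m + j)%N)); last first.
  apply/eqP; rewrite eq_le (content_ge0 PJ) andbT.
  apply: (le_trans (contentU lcS hS PJ _ _));
    rewrite (content_bigcup0 lcS hS PJ Qlim0) adde0.
  have nP' : negligible_for J (cp @^-1` (ginv @^-1` Plim)).
    by apply/(negligible_saturated L lcG hG PI).
  by rewrite nP'//; exact: circle_proper.
move=> z [Nz Wz].
have N'z : N' (cinv z).
  split => //; rewrite /preimage /= cproj_inv; exists (cp z) => //.
  exact: subset_closure.
have [Pz|] := pselect (Plim (ginv (cp z))).
  by left; split => //; exact: subset_closure.
move=> /existsNP[m /not_implyP[_ nPz]]; right; exists m => // j _.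
split; first by split => //; have [_ + _] := hV (m + j)%N; exact.
by move=> /thick_inv Pz; apply: nPz; exists j.
Qed.

End InversionNull.

(** * Transport between equal fibres *)

Section Casts.
Variables (R : realType) (X : Type) (H : hilbert_field R X).

Lemma hcast_irr (x y : X) (e e' : x = y) (v : H x) : hcast e v = hcast e' v.
Proof. by rewrite (Prop_irrelevance e e'). Qed.

Lemma hcast_id (x : X) (e : x = x) (v : H x) : hcast e v = v.
Proof. by rewrite (Prop_irrelevance e erefl). Qed.

Lemma hcastK (x y : X) (e : x = y) (e' : y = x) (v : H x) : hcast e' (hcast e v) = v.
Proof. by case: y / e e' => e'; rewrite !hcast_id. Qed.

Lemma hcast_trans (x y z : X) (e : x = y) (e' : y = z) (e'' : x = z) (v : H x) :
  hcast e' (hcast e v) = hcast e'' v.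
Proof. by case: z / e' e'' => e''; rewrite hcast_id; exact: hcast_irr. Qed.

Lemma hcast_linear (x y : X) (e : x = y) (c : R[i]) (u v : H x) :
  hcast e (c *: u + v) = c *: hcast e u + hcast e v.
Proof. by case: y / e. Qed.

Lemma hcastZ (x y : X) (e : x = y) (c : R[i]) (u : H x) : hcast e (c *: u) = c *: hcast e u.
Proof. by case: y / e. Qed.

Lemma hcast_dot (x y : X) (e : x = y) (u v : H x) : dot (hcast e u) (hcast e v) = dot u v.
Proof. by case: y / e. Qed.

Lemma hcast_continuous (x y : X) (e : x = y) : continuous (hcast e : H x -> H y).
Proof. by case: y / e; move=> v; exact: cvg_id. Qed.

End Casts.

Section FellAlgebra.
Variables (R : realType) (G : topGroupoid) (L : fell_line_bundle R G).
Variable H : hilbert_field R (obj G).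
Variable S : forall g : G, L g -> H (src g) -> H (rng g).
Local Notation E := (total_space L).

(** The operator of an element of the bundle, between fibres over objects that
    are only propositionally the source and the range of its arrow. *)
Definition tot_op (t : E) (x y : obj G) (es : src (bproj t) = x) (er : rng (bproj t) = y) :
  H x -> H y := fun xi => hcast er (S (bvect t) (hcast (esym es) xi)).

Lemma tot_op_congr (t t' : E) (x y : obj G) es er es' er' (xi : H x) :
  t = t' -> tot_op (t := t) (x := x) (y := y) es er xi = tot_op (t := t') es' er' xi.
Proof.
move=> tt'; case: t' / tt' es' er' => es' er'.
by rewrite (Prop_irrelevance es es') (Prop_irrelevance er er').
Qed.

Lemma tot_opE (g : G) (a : L g) (xi : H (src g)) :
  tot_op (t := tot a) erefl erefl xi = S a xi.
Proof. by []. Qed.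

Hypothesis S_linear : forall g (c : R[i]) (a b : L g) (xi : H (src g)),
  S (c *: a + b) xi = c *: S a xi + S b xi.

Lemma S_scale (g : G) (c : R[i]) (a : L g) (xi : H (src g)) : S (c *: a) xi = c *: S a xi.
Proof.
have S0 : S (0 : L g) xi = 0.
  have := S_linear 1 (0 : L g) 0 xi; rewrite !scale1r addr0.
  by move/esym/eqP; rewrite -subr_eq0 addrK => /eqP.
by rewrite -[c *: a]addr0 S_linear S0 addr0.
Qed.

Lemma tot_opZ (c : R[i]) (t : E) (x y : obj G) es er (xi : H x) :
  tot_op (t := tscale c t) (x := x) (y := y) es er xi = c *: tot_op (t := t) es er xi.
Proof. by rewrite /tot_op /= S_scale hcastZ. Qed.

Hypothesis S_bounded : forall g (a : L g), bounded_operator (S a).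

Lemma tot_op_linear (t : E) (x y : obj G) es er (c : R[i]) (u v : H x) :
  tot_op (t := t) (y := y) es er (c *: u + v) =
  c *: tot_op (t := t) es er u + tot_op (t := t) es er v.
Proof. by rewrite /tot_op hcast_linear (S_bounded _).1 hcast_linear. Qed.

Lemma tot_op_continuous (t : E) (x y : obj G) es er :
  continuous (tot_op (t := t) (x := x) (y := y) es er).
Proof.
move=> v; apply: (@continuous_comp _ _ _ (fun xi =>
  S (bvect t) (hcast (esym es) xi)) (hcast er));
  last exact: hcast_continuous.
apply: (@continuous_comp _ _ _ (fun xi => (hcast (esym es) xi)) (S (bvect t)));
  first exact: hcast_continuous.
exact: (S_bounded _).2.
Qed.

Hypothesis S_mul : forall (g h : G) (a : L g) (b : L h) (e : src g = rng h)
  (es : src (gmul g h) = src h) (er : rng (gmul g h) = rng g) (xi : H (src h)),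
  S (fmul a b) (hcast (esym es) xi) = hcast (esym er) (S a (hcast (esym e) (S b xi))).

Lemma tot_opM (t u : E) (x y z : obj G) es er es1 er1 es2 er2 (xi : H x) :
  tot_op (t := tmul t u) (x := x) (y := y) es er xi =
  tot_op (t := t) (x := z) es1 er1 (tot_op (t := u) es2 er2 xi).
Proof.
case: t u es er es1 er1 es2 er2 => [g a] [h b] /= es er es1 er1 es2 er2.
rewrite /tot_op /=; case: x / es2 es xi => es xi; case: y / er1 er => er.
rewrite (S_mul a b (etrans es1 (esym er2)) es er) (hcastK (esym er) er) /=.
by congr (S _ _); rewrite [RHS](hcast_trans _ _ (esym (etrans es1 (esym er2)))).
Qed.

Hypothesis S_star : forall (g : G) (a : L g) (es : src (ginv g) = rng g)
  (er : rng (ginv g) = src g) (xi : H (src g)) (eta : H (rng g)),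
  dot (S a xi) eta = dot xi (hcast er (S (fstar a) (hcast (esym es) eta))).

Lemma tot_op_adjoint (t : E) (x y : obj G) es er es' er' (xi : H x) (eta : H y) :
  dot (tot_op (t := t) es er xi) eta = dot xi (tot_op (t := tstar t) es' er' eta).
Proof.
case: t es er es' er' => [g a] /= es er es' er'.
rewrite /tot_op /=; case: x / es er' xi => er' xi; case: y / er es' eta => es' eta.
exact: S_star.
Qed.

Hypothesis S_nondegenerate : forall x : obj G,
  dense (lspan [set w : H (rng (gunit x : G)) |
    exists (a : L (gunit x)) (xi : H (src (gunit x : G))), w = S a xi]).

(** The identity at [x] acts as a continuous idempotent that fixes the range of
    the fibre over the unit, and this range spans a dense subspace. *)
Lemma tot_op_one (x x' : obj G) es er (xi : H x') : tot_op (t := tone L x) es er xi = xi.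
Proof.
case: x' / er es xi => es xi.
pose Q := tot_op (t := tone L x) (y := rng (gunit x : G)) es erefl.
have Q0 : Q 0 = 0.
  have := tot_op_linear (t := tone L x) es erefl 1 0 0; rewrite -/Q !scale1r addr0.
  by move/esym/eqP; rewrite -subr_eq0 addrK => /eqP.
have Qfix w : lspan [set w : H (rng (gunit x : G)) |
    exists (a : L (gunit x)) (xi : H (src (gunit x : G))), w = S a xi] w -> Q w = w.
  move=> [n [c [f [fS ->]]]].
  have Qf i : Q (f i) = f i.
    have [a [eta ->]] := fS i.
    have es1 : src (bproj (tmul (tone L x) (tot a))) = src (gunit x : G).
      by rewrite /= src_mul// src_unit rng_unit.
    have er1 : rng (bproj (tmul (tone L x) (tot a))) = rng (gunit x : G).
      by rewrite /= rng_mul// src_unit rng_unit.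
    rewrite -(tot_opE a eta) /Q -(tot_opM es1 er1 es erefl erefl erefl).
    by apply: tot_op_congr; exact: tone_mul.
  elim/big_ind: _ => [//|u v Qu Qv|i _].
    by rewrite -[u]scale1r /Q tot_op_linear -/Q Qu Qv.
  by rewrite -[_ *: _]addr0 /Q tot_op_linear -/Q Qf Q0.
have cl : closed [set w | Q w = w].
  apply: closed_equalizer; [exact: norm_hausdorff | exact: tot_op_continuous |].
  by move=> w; exact: cvg_id.
apply: contrapT => nQ.
have [w [Qw /Qfix]] := S_nondegenerate (ex_intro _ xi nQ) (closed_openC cl).
by [].
Qed.

End FellAlgebra.

(** * Quasi-invariance *)

Lemma continuous_conj (R : realType) : continuous (fun z : R[i]^o =>
  (Num.conj (z : R[i]) : R[i]^o)).
Proof.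
move=> z U /complex_ball[r r0 rU]; rewrite nbhs_simpl /=.
apply/nbhs_ballP; exists r%:C; first by rewrite /= (ltcR 0).
by move=> w zw; apply: rU; rewrite -rmorphB norm_conjC.
Qed.

(** The field is nonzero almost everywhere, so the restriction in the definition
    of quasi-invariance does not affect null sets. *)
Lemma quasi_invariant_null (R : realType) (G : groupoid_data) (m : (G -> R) -> R)
    (H : hilbert_field R (obj G)) :
  locally_compact [set: G] -> hausdorff_space G -> positive_functional m ->
  involutive (@ginv G) ->
  negligible_for m (~` [set g : G | nonzero_at H (rng g)]) ->
  quasi_invariant m H <->
  forall N : set G, negligible_for m N -> negligible_for m (ginv @^-1` N).
Proof.
move=> lcG hG Pm invK nE; pose E := [set g : G | nonzero_at H (rng g)].
have full A : negligible_for m (A `&` E) -> negligible_for m A.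
  move=> nA; apply: (negligible_forS Pm _ (negligible_forU lcG hG Pm nA nE)) => g Ag.
  by have [Eg|nEg] := pselect (E g); [left|right].
have part A : negligible_for m A -> negligible_for m (A `&` E).
  by apply: (negligible_forS Pm); exact: subIsetl.
split=> [q N nN|h E0 A]; first by apply: full; apply: (q N).1; exact: part.
split=> /full nA; apply: part; first exact: h.
rewrite (_ : A = ginv @^-1` (ginv @^-1` A)); first exact: h.
by apply/seteqP; split => g; rewrite /preimage /= invK.
Qed.

Section Measures.
Variables (R : realType) (G : topGroupoid) (L : fell_line_bundle R G).
Hypotheses (lcG : locally_compact [set: G]) (hG : hausdorff_space G).
Variable alpha : obj G -> {measure set (borel G) -> \bar R}.
Hypothesis haar : haar_system alpha.
Variable nu : {measure set (borel (obj G)) -> \bar R}.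
Hypothesis rad : radon nu.
Local Notation cp := (@cproj R G L).
Local Notation I0 := (integral_of nu).
Local Notation IG := (Defs.induced nu (haar_integral alpha)).
Local Notation IS := (@Defs.induced R (circle_extension L) nu (circle_haar (L := L) alpha)).

Lemma unit_space_functional : positive_functional I0.
Proof. by apply: integral_of_positive => K kK; have [+ _ _] := rad; apply. Qed.

Lemma groupoid_functional : positive_functional IG.
Proof. exact: (fibre_positive (haar_fibre_integral hG haar) unit_space_functional). Qed.

Lemma circle_functional : positive_functional IS.
Proof. exact: (fibre_positive (circle_fibre_integral L hG) groupoid_functional). Qed.

Lemma rng_null N : negligible_for I0 N -> negligible_for IG (rng @^-1` N).
Proof.
have [_ cr _ _ _] := topologicalP G.
exact: (fibre_null (unit_space_hausdorff hG) lcG hG cr (haar_fibre_integral hG haar)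
  unit_space_functional).
Qed.

Lemma circle_null N : negligible_for IS (cp @^-1` N) <-> negligible_for IG N.
Proof. exact: (negligible_saturated L lcG hG groupoid_functional). Qed.

Lemma measurable_circle_pull (f : G -> R[i]) : measurable_for IG f ->
  measurable_for IS (fun y => f (cp y)).
Proof.
apply: (@measurable_for_preimage _ _ _ lcG hG (circle_locally_compact lcG hG)
  (circle_hausdorff hG) _ _ groupoid_functional circle_functional cp).
  exact: continuous_cproj.
by move=> N; exact: (circle_null N).2.
Qed.

Lemma measurable_circle_push (f : G -> R[i]) : measurable_for IS (fun y => f (cp y)) ->
  measurable_for IG f.
Proof.
move=> mf V oV; apply: (@caratheodory_saturated _ _ L lcG hG); exact: (mf V oV).
Qed.

Variable H : hilbert_field R (obj G).
Hypothesis nzH : negligible_for I0 (~` nonzero_at H).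

Lemma nonzero_rng_null : negligible_for IG (~` [set g : G | nonzero_at H (rng g)]).
Proof. exact: rng_null nzH. Qed.

Lemma quasi_invariant_groupoid : quasi_invariant IG H <->
  forall N : set G, negligible_for IG N -> negligible_for IG (ginv @^-1` N).
Proof.
apply: quasi_invariant_null => //; [exact: groupoid_functional | exact: ginvK |].
exact: nonzero_rng_null.
Qed.

Lemma quasi_invariant_circle : @quasi_invariant R (circle_extension L) IS H <->
  forall N : set (circle L), negligible_for IS N ->
    negligible_for IS (@circle_inv R G L @^-1` N).
Proof.
apply: (@quasi_invariant_null R (circle_extension L) IS H).
- exact: circle_locally_compact.
- exact: circle_hausdorff.
- exact: circle_functional.
- exact: circle_invK.
- exact: (circle_null _).2 nonzero_rng_null.
Qed.

(** Upwards this is [circle_inv_null]; downwards it suffices to test saturated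
    sets. *)
Lemma quasi_invariant_extension : quasi_invariant IG H <->
  @quasi_invariant R (circle_extension L) IS H.
Proof.
split=> [/quasi_invariant_groupoid q|/quasi_invariant_circle q].
  apply/quasi_invariant_circle => N.
  exact: (circle_inv_null lcG hG groupoid_functional q).
apply/quasi_invariant_groupoid => N /circle_null/q nN; apply/circle_null.
by move: nN; congr negligible_for; apply/seteqP; split => y; rewrite /preimage /= cproj_inv.
Qed.

Hypothesis qH : quasi_invariant IG H.

(** The source is the range of the inverse, and quasi-invariance says that
    inversion preserves null sets. *)
Lemma measurable_src_pull (f : obj G -> R[i]) : measurable_for I0 f ->
  measurable_for IG (fun g => f (src g)).
Proof.
have [cs _ _ _ _] := topologicalP G.
apply: (@measurable_for_preimage _ _ _ (unit_space_locally_compact lcG hG)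
  (unit_space_hausdorff hG) lcG hG _ _ unit_space_functional groupoid_functional src cs).
move=> N /rng_null /(quasi_invariant_groupoid.1 qH).
by congr negligible_for; apply/seteqP; split => g; rewrite /preimage /= rng_inv.
Qed.

End Measures.

(** * From the bundle to its circle extension *)

Section Cutoff.
Variables (R : realType) (G : topGroupoid) (L : fell_line_bundle R G).
Hypotheses (lcG : locally_compact [set: G]) (hG : hausdorff_space G).
Local Notation E := (total_space L).

(** Near [g0], cutting off a local section of norm one yields a global section
    [f] of compact support, to which the measurability axiom of a bundle
    representation applies. *)
Lemma local_unit_section (g0 : G) : exists (W : set G) (f : forall g, L g) (c :
  E -> R[i]^o),
  [/\ open W /\ W g0, Cc_section f,
      forall t, W (bproj t) -> t = tscale (c t) (tot (f (bproj t)))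
    & forall t, W (bproj t) -> {for t, continuous c}].
Proof.
have [U [sg [c [[oU Ug0] n1 cE cont1 cont2]]]] := bundle_chart L g0.
have [V [oV Vg0 kV VU]] := lc_open_nbhs lcG hG oU Ug0.
have [x [cx x01 xU [W oW [VW xW]]]] := urysohn_Cc R lcG hG kV oU VU.
pose f g : L g := (x g)%:C *: sg g.
have f0 g : ~ supp x g -> f g = 0 by move=> /supp_out xg; rewrite /f xg scale0r.
have cxC : continuous (fun g => ((x g)%:C : R[i]^o)).
  by move=> g; apply: (continuous_comp (cx.1 g)); exact: continuous_complex_of_real.
exists (W `&` U), f, c; split.
- split; first exact: openI.
  by split => //; apply: VW; exact: subset_closure.
- split.
    move=> g; have [/xU Ug|nx] := pselect (supp x g).
      apply: (@continuous_comp _ _ _ (fun g => (g, (x g)%:C : R[i]^o))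
        (fun q : G * R[i]^o => tot ((q.2 : R[i]) *: sg q.1) : E)); last exact: cont1.
      by apply: continuous_pair; [exact: cvg_id | exact: cxC].
    have [U' [sg' [c' [[oU' Ug'] _ _ cont' _]]]] := bundle_chart L g.
    pose F q : E := tot ((q.2 : R[i]) *: sg' q.1).
    have cF : {for g, continuous (fun h => F (h, 0 : R[i]^o))}.
      apply: (@continuous_comp _ _ _ (fun h => (h, 0 : R[i]^o)) F); last exact: cont'.
      by apply: continuous_pair; [exact: cvg_id | exact: cvg_cst].
    have F0 h : ~ supp x h -> tot (f h) = F (h, 0) :> E.
      by move=> nh; rewrite /F /= f0// scale0r.
    move=> B; rewrite /= F0// => nB.
    have nS : nbhs g (~` supp x).
      by apply: open_nbhs_nbhs; split => //; apply: closed_openC; exact: closed_closure.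
    have nF : nbhs g ((fun h => F (h, 0 : R[i]^o)) @^-1` B) by exact: cF.
    by apply: filterS (filterI nF nS) => h [Bh nh]; rewrite /preimage /= F0.
  apply: (subclosed_compact _ cx.2); first exact: closed_closure.
  rewrite -/(supp x); have -> : supp x = closure (supp x).
    by apply/closure_id; exact: closed_closure.
  apply: closureS => g /eqP fg; apply: contrapT => nx; apply: fg; exact: f0.
- move=> [g a] [Wg Ug]; rewrite /tscale /f /= (xW g Wg) scale1r -cE//.
- by move=> t [_ Ut]; exact: cont2.
Qed.

End Cutoff.

Section FellToCircle.
Variables (R : realType) (G : topGroupoid) (L : fell_line_bundle R G).
Hypotheses (lcG : locally_compact [set: G]) (hG : hausdorff_space G).
Variable alpha : obj G -> {measure set (borel G) -> \bar R}.
Hypothesis haar : haar_system alpha.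
Variable nu : {measure set (borel (obj G)) -> \bar R}.
Variables (H : hilbert_field R (obj G)) (S : forall g : G, L g -> H (src g) -> H (rng g)).
Hypothesis hS : is_fell_rep alpha nu S.
Local Notation E := (total_space L).
Local Notation cp := (@cproj R G L).
Local Notation IG := (Defs.induced nu (haar_integral alpha)).
Local Notation IS := (@Defs.induced R (circle_extension L) nu (circle_haar (L := L) alpha)).

Definition restrict_op (y : circle_extension L) : H (src y) -> H (rng y) :=
  @S (cproj y) (cvect y).

Let radon_nu : radon nu. Proof. by have [[]] := hS. Qed.
Let mH : measurable_field (integral_of nu) H. Proof. by have [[]] := hS. Qed.
Let nzH : negligible_for (integral_of nu) (~` nonzero_at H).
Proof. by have [[]] := hS. Qed.
Let S_bounded g (a : L g) : bounded_operator (S a).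
Proof. by have [_ [+ _] _ _ _] := hS; apply. Qed.
Let S_linear g (c : R[i]) (a b : L g) (xi : H (src g)) :
  S (c *: a + b) xi = c *: S a xi + S b xi.
Proof. by have [_ [_ +] _ _ _] := hS; apply. Qed.
Let S_mul (g h : G) (a : L g) (b : L h) (e : src g = rng h)
  (es : src (gmul g h) = src h) (er : rng (gmul g h) = rng g) (xi : H (src h)) :
  S (fmul a b) (hcast (esym es) xi) = hcast (esym er) (S a (hcast (esym e) (S b xi))).
Proof. by have [_ _ [+ _ _] _ _] := hS; apply. Qed.
Let S_star (g : G) (a : L g) (es : src (ginv g) = rng g)
  (er : rng (ginv g) = src g) (xi : H (src g)) (eta : H (rng g)) :
  dot (S a xi) eta = dot xi (hcast er (S (fstar a) (hcast (esym es) eta))).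
Proof. by have [_ _ [_ + _] _ _] := hS; apply. Qed.
Let S_nondegenerate (x : obj G) : dense (lspan [set w : H (rng (gunit x : G)) |
    exists (a : L (gunit x)) (xi : H (src (gunit x : G))), w = S a xi]).
Proof. by have [_ _ [_ _ +] _ _] := hS; apply. Qed.

Let opM := tot_opM S_mul.
Let op_adjoint := tot_op_adjoint S_star.
Let op_one := tot_op_one S_bounded S_mul S_nondegenerate.

Lemma op_star_mul (t : E) (x z : obj G) es er es' er' (xi : H x) : tnorm t = 1 ->
  tot_op S (t := tstar t) (x := z) es' er' (tot_op S (t := t) es er xi) = xi.
Proof.
move=> t1.
have esM : src (bproj (tmul (tstar t) t)) = x by rewrite /= src_mul// src_inv.
have erM : rng (bproj (tmul (tstar t) t)) = x by rewrite /= rng_mul ?src_inv// er'.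
rewrite -(opM esM erM); have E1 := tmulVs t1.
have es1 : src (bproj (tone L (src (bproj t)))) = x by rewrite src_unit.
have er1 : rng (bproj (tone L (src (bproj t)))) = x by rewrite rng_unit.
by rewrite (tot_op_congr S esM erM es1 er1 xi E1) op_one.
Qed.

Lemma restrict_op_unitary (y : circle_extension L) :
  unitary_operator (restrict_op (y := y)).
Proof.
have y1 := circle_norm y.
have es : src (bproj (tstar (val y))) = rng (cproj y) by exact: src_inv.
have er : rng (bproj (tstar (val y))) = src (cproj y) by exact: rng_inv.
split.
- exact: (S_bounded _).1.
- move=> u v; have := op_adjoint (t := val y) erefl erefl es er u (restrict_op v).
  rewrite /tot_op /= => ->.
  by have := op_star_mul erefl erefl es er v y1; rewrite /tot_op /= => ->.
- move=> w; exists (tot_op S (t := tstar (val y)) es er w).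
  have n1 : tnorm (tstar (val y)) = 1 by rewrite tnorm_star.
  have h := op_star_mul (t := tstar (val y)) es er (etrans (congr1 src (ginvK (cproj
    y))) erefl)
    (etrans (congr1 rng (ginvK (cproj y))) erefl) w n1.
  rewrite -[RHS]h; apply: (tot_op_congr S erefl erefl); exact/esym/tstarK.
Qed.

Lemma restrict_op_mul (y1 y2 : circle_extension L) (e : src y1 = rng y2)
    (es : src (gmul y1 y2) = src y2) (er : rng (gmul y1 y2) = rng y1) (xi : H (src y2)) :
  restrict_op (hcast (esym es) xi) =
  hcast (esym er) (restrict_op (hcast (esym e) (restrict_op xi))).
Proof.
have esM : src (bproj (tmul (val y1) (val y2))) = src (cproj y2) by exact: src_mul.
have erM : rng (bproj (tmul (val y1) (val y2))) = rng (cproj y1) by exact: rng_mul.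
apply: (can_inj (g := hcast (esym er)) (f := hcast er)) => [v|]; first exact: hcastK.
rewrite hcastK.
transitivity (tot_op S (t := tmul (val y1) (val y2)) esM erM xi).
  rewrite -[LHS]/(tot_op S (t := val (circle_mul y1 y2)) es er xi).
  by apply: tot_op_congr; exact: val_circle_mul.
by rewrite (opM esM erM e erefl erefl erefl) /tot_op /=; congr (S _ _); exact: hcast_irr.
Qed.

Lemma restrict_op_scale (z : R[i]) (y : circle_extension L) : `|z| = 1 ->
  forall (es : src (circle_scale z y : circle_extension L) = src y)
    (er : rng (circle_scale z y : circle_extension L) = rng y) (xi : H (src y)),
  restrict_op (y := circle_scale z y) (hcast (esym es) xi) =
  hcast (esym er) (z *: restrict_op xi).
Proof.
move=> z1 es er xi.
apply: (can_inj (g := hcast (esym er)) (f := hcast er)) => [v|]; first exact: hcastK.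
rewrite hcastK -[LHS]/(tot_op S (t := val (circle_scale z y)) es er xi).
rewrite (tot_op_congr S es er (erefl : src (bproj (tscale z (val y))) = _) erefl xi
  (val_circle_scale y z1)).
by rewrite tot_opZ.
Qed.

(** Locally, [S] at [y] is a continuous multiple of [S] at a global section of
    compact support. Pulling [u'] back along the source uses quasi-invariance. *)
Lemma restrict_op_coefficient (u u' : forall x, H x) : hsections H u -> hsections H u' ->
  measurable_for IS (fun y => dot (restrict_op (y := y) (u' (src y))) (u (rng y))).
Proof.
move=> hu hu'; have [_ _ _ S_meas qH] := hS.
have lcS := circle_locally_compact (L := L) lcG hG.
have hC := circle_hausdorff (L := L) hG.
have PS := circle_functional L hG haar radon_nu.
have msrc : measurable_section IG src H (fun g => u' (src g)).
  move=> u'' hu''; have PG := groupoid_functional hG haar radon_nu.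
  apply: (dot_hsections lcG hG PG (I := integral_of nu) (p := src)) => // f.
  exact: (measurable_src_pull lcG hG haar radon_nu nzH qH).
apply: (measurable_for_local lcS hC PS) => y0.
have [W [f [c [[oW Wy0] ccf fE cc]]]] := local_unit_section L lcG hG (cp y0).
have oW' : open (cp @^-1` W) by exact: continuous_open (@continuous_cproj R G L) oW.
exists (cp @^-1` W); split => //.
pose F (y : circle L) := c (val y) *
  (fun g => dot (S (f g) (u' (src g))) (u (rng g))) (cp y).
have FE (y : circle L) : (cp @^-1` W) y ->
    F y = dot (restrict_op (y := y) (u' (src (cp y)))) (u (rng (cp y))).
  move=> Wy; rewrite /F /restrict_op.
  have -> : S (cvect y) (u' (src (cp y))) =
      c (val y) *: S (f (cp y)) (u' (src (cp y))).
    rewrite -(S_scale S_linear); congr (S _ _); apply: tot_inj.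
    have vE : val y = tot (cvect y) by rewrite /cvect /cproj; case: (val y).
    by rewrite -vE [LHS]fE.
  by rewrite dotZl.
suff mF : measurable_on IS (cp @^-1` W) F by exact: measurable_on_ext FE mF.
apply: (measurable_onM lcS hC PS); first exact: (cara_open lcS hC PS).
  apply: (measurable_on_continuous lcS hC PS oW').
  apply: continuous_in_subspaceT => y; rewrite inE => Wy.
  by apply: (continuous_comp (continuous_circle_val (x := y))); exact: cc.
apply: (measurable_for_on lcS hC PS); first exact: (cara_open lcS hC PS).
have h := @measurable_circle_pull R G L lcG hG alpha haar nu radon_nu _
  (S_meas f (fun g => u' (src g)) ccf msrc u hu).
exact: h.
Qed.

(** A measurable section over the circle extension need not come from the base,
    so the axiom on [S] does not apply to it. But moving [S] to the other side of
    the inner product turns the claim into the measurability of an inner product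
    of two measurable sections. *)
Lemma restrict_op_measurable (xi : forall y : circle_extension L, H (src y)) :
  measurable_section IS src H xi ->
  measurable_section IS rng H (fun y => restrict_op (xi y)).
Proof.
move=> mxi u hu; have [_ _ _ _ qH] := hS.
have lcS := circle_locally_compact (L := L) lcG hG.
have hC := circle_hausdorff (L := L) hG.
have PS := circle_functional L hG haar radon_nu.
have es (y : circle L) : src (bproj (tstar (val y))) = rng (cproj y) by exact: src_inv.
have er (y : circle L) : rng (bproj (tstar (val y))) = src (cproj y) by exact: rng_inv.
pose w (y : circle_extension L) : H (src y) :=
  tot_op S (t := tstar (val y)) (es y) (er y) (u (rng y)).
have adj (y : circle_extension L) (v : H (src y)) :
    dot (restrict_op v) (u (rng y)) = dot v (w y).
  exact: (op_adjoint (t := val y) erefl erefl (es y) (er y)).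
rewrite (_ : (fun y => _) = fun y => dot (xi y) (w y)); last by apply/funext => y;
  exact: adj.
apply: (measurable_section_dot lcS hC PS (I := integral_of nu) (p :=
  fun y : circle L => src (cp y))) => //.
  move=> f mf; have h := @measurable_circle_pull R G L lcG hG alpha haar nu radon_nu _
    (measurable_src_pull lcG hG haar radon_nu nzH qH mf).
  exact: h.
move=> u' hu'.
rewrite (_ : (fun y => _) = fun y => Num.conj (dot (restrict_op (y :=
  y) (u' (src y))) (u (rng y)))); last first.
  by apply/funext => y; rewrite adj -dot_conj.
apply: (measurable_for_comp (phi := fun z : R[i]^o => (Num.conj (z : R[i]) : R[i]^o))).
  exact: continuous_conj.
exact: restrict_op_coefficient.
Qed.

Lemma restrict_axioms : is_groupoid_rep (circle_haar (L := L) alpha) nu restrict_op.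
Proof.
have [_ _ _ _ qH] := hS.
split => //; last exact: restrict_op_measurable.
- exact/(quasi_invariant_extension L lcG hG haar radon_nu nzH).
- by split; [exact: restrict_op_unitary | exact: restrict_op_mul].
Qed.

End FellToCircle.

(** * From the circle extension to the bundle *)

Lemma isometry_continuous (R : realType) (H K : hilbert R) (T : H -> K) :
  linear T -> (forall u v, dot (T u) (T v) = dot u v) -> continuous T.
Proof.
move=> lT iT u; apply/cvgrPdist_lt => e e0.
have nb : nbhs u (ball u e) by exact: nbhsx_ballx.
apply: filterS nb => v; rewrite -ball_normE /= => uv.
have -> : T u - T v = T (u - v).
  by have h := lT (-1) v u; rewrite !scaleN1r in h; rewrite addrC -h addrC.
suff -> : `|T (u - v)| = `|u - v| by [].
by apply/eqP; rewrite -(@eqrXn2 _ 2)// -!dot_norm iT.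
Qed.

Section CircleToFell.
Variables (R : realType) (G : topGroupoid) (L : fell_line_bundle R G).
Hypotheses (lcG : locally_compact [set: G]) (hG : hausdorff_space G).
Variable alpha : obj G -> {measure set (borel G) -> \bar R}.
Hypothesis haar : haar_system alpha.
Variable nu : {measure set (borel (obj G)) -> \bar R}.
Variables (H : hilbert_field R (obj G)).
Variable U : forall y : circle_extension L, H (src y) -> H (rng y).
Arguments U : clear implicits.
Local Notation E := (total_space L).
Local Notation cp := (@cproj R G L).
Local Notation IG := (Defs.induced nu (haar_integral alpha)).
Local Notation IS := (@Defs.induced R (circle_extension L) nu (circle_haar (L := L) alpha)).

(** The choice is pointwise and arbitrary; [ext_opE] shows that the operators
    defined from it are independent of it. *)
Definition frame (g : G) : L g := sval (cid (unit_vector L g)).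

Lemma frame_norm (g : G) : tnorm (tot (frame g)) = 1.
Proof. exact: (svalP (cid (unit_vector L g))). Qed.

Lemma frame_circle (g : G) : tot (frame g) \in @circle_set R G L.
Proof. by rewrite inE; apply/circle_setE; exact: frame_norm. Qed.

Definition circle_frame (g : G) : circle L :=
  exist (fun t => t \in @circle_set R G L) (tot (frame g)) (frame_circle g).

Lemma frame_spans (g : G) (a : L g) : exists z, tot a = tscale z (tot (frame g)).
Proof. exact: (fibre_one_dim (s := tot (frame g)) (t := tot a) erefl (frame_norm g)). Qed.

Definition frame_coord (g : G) (a : L g) : R[i] := sval (cid (frame_spans a)).

Lemma frame_coordE (g : G) (a : L g) : tot a = tscale (frame_coord a) (tot (frame g)).
Proof. exact: (svalP (cid (frame_spans a))). Qed.

Lemma tscale_inj (t : E) (z w : R[i]) : tnorm t = 1 -> tscale z t = tscale w t -> z = w.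
Proof.
case: t => g a; rewrite /tnorm /tscale /= => a1 /tot_inj zw.
apply/eqP; rewrite -subr_eq0; have : (z - w) *: a = 0 by rewrite scalerBl zw subrr.
move/eqP; rewrite scaler_eq0 => /orP[//|/eqP a0]; move: a1; rewrite a0 normr0.
by move=> /esym/eqP; rewrite oner_eq0.
Qed.

Lemma frame_coord_lin (g : G) (c : R[i]) (a b : L g) :
  frame_coord (c *: a + b) = c * frame_coord a + frame_coord b.
Proof.
apply: (@tscale_inj (tot (frame g))); first exact: frame_norm.
rewrite -frame_coordE; have := frame_coordE a; have := frame_coordE b.
rewrite /tscale /= => /tot_inj {1}-> /tot_inj {1}->.
by rewrite scalerA -scalerDl.
Qed.

Definition ext_op (g : G) (a : L g) (xi : H (src g)) : H (rng g) :=
  frame_coord a *: U (circle_frame g) xi.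

(** The analogue of [tot_op] for the circle extension. *)
Definition circ_op (y : circle L) (x z : obj G) (es : src (cp y) = x) (er :
  rng (cp y) = z) :
  H x -> H z := fun xi => hcast er (U y (hcast (esym es) xi)).

Lemma circ_op_congr (y y' : circle L) (x z : obj G) es er es' er' (xi : H x) :
  y = y' -> circ_op (y := y) (x := x) (z := z) es er xi = circ_op (y := y') es' er' xi.
Proof.
move=> yy'; case: y' / yy' es' er' => es' er'.
by rewrite (Prop_irrelevance es es') (Prop_irrelevance er er').
Qed.

Hypothesis hU : is_groupoid_rep (circle_haar (L := L) alpha) nu U.
Hypothesis hE : forall (z : R[i]) (y : circle_extension L), `|z| = 1 ->
  forall (es : src (circle_scale z y : circle_extension L) = src y)
    (er : rng (circle_scale z y : circle_extension L) = rng y) (xi : H (src y)),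
  U (circle_scale z y) (hcast (esym es) xi) = hcast (esym er) (z *: U y xi).

Let U_unitary (y : circle L) : unitary_operator (U y).
Proof. by have [_ _ _ [+ _] _] := hU; apply. Qed.
Let U_mul (y1 y2 : circle_extension L) (e : src y1 = rng y2)
    (es : src (gmul y1 y2) = src y2) (er : rng (gmul y1 y2) = rng y1) (xi : H (src y2)) :
  U (gmul y1 y2) (hcast (esym es) xi) = hcast (esym er) (U y1 (hcast (esym e) (U y2 xi))).
Proof. by have [_ _ _ [_ +] _] := hU; apply. Qed.

Lemma circ_op_scale (z : R[i]) (y : circle L) (x x' : obj G) es er es' er' (xi : H x) :
  `|z| = 1 ->
  circ_op (y := circle_scale z y) (x := x) (z := x') es er xi =
  z *: circ_op (y := y) es' er' xi.
Proof.
move=> z1; case: x / es' es xi => es xi; case: x' / er' er => er.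
by rewrite /circ_op (hE z1 es er) (hcastK (esym er) er).
Qed.

Lemma circ_opM (y1 y2 : circle L) (x x' x'' : obj G) es er es1 er1 es2 er2 (xi : H x) :
  circ_op (y := circle_mul y1 y2) (x := x) (z := x') es er xi =
  circ_op (y := y1) (x := x'') es1 er1 (circ_op (y := y2) es2 er2 xi).
Proof.
rewrite /circ_op; case: x / es2 es xi => es xi; case: x' / er1 er => er.
rewrite (U_mul (etrans es1 (esym er2)) es er) (hcastK (esym er) er) /=.
by congr (U _ _); rewrite [RHS](hcast_trans _ _ (esym (etrans es1 (esym er2)))).
Qed.

Lemma circ_op_linear (y : circle L) (x x' : obj G) es er (c : R[i]) (u v : H x) :
  circ_op (y := y) (z := x') es er (c *: u + v) =
  c *: circ_op (y := y) es er u + circ_op (y := y) es er v.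
Proof. by have [lU _ _] := U_unitary y; rewrite /circ_op hcast_linear lU hcast_linear. Qed.

Lemma circ_opZ (y : circle L) (x x' : obj G) es er (c : R[i]) (u : H x) :
  circ_op (y := y) (z := x') es er (c *: u) = c *: circ_op (y := y) es er u.
Proof.
have z0 : circ_op (y := y) (z := x') es er (0 : H x) = 0.
  have := circ_op_linear es er 1 0 0; rewrite !scale1r addr0.
  by move/esym/eqP; rewrite -subr_eq0 addrK => /eqP.
by rewrite -[c *: u]addr0 circ_op_linear z0 addr0.
Qed.

Lemma circ_op_dot (y : circle L) (x x' : obj G) es er (u v : H x) :
  dot (circ_op (y := y) (z := x') es er u) (circ_op (y := y) es er v) = dot u v.
Proof. by have [_ iU _] := U_unitary y; rewrite /circ_op hcast_dot iU hcast_dot. Qed.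

(** The operator is a unitary idempotent. *)
Lemma circ_op_one (x x' : obj G) es er (xi : H x') :
  circ_op (y := circle_unit L x) (x := x') (z := x') es er xi = xi.
Proof.
set T := circ_op es er.
have TT : T (T xi) = T xi.
  have e : src (cp (circle_unit L x)) = rng (cp (circle_unit L x)) by rewrite es er.
  have mulE : circle_mul (circle_unit L x) (circle_unit L x) = circle_unit L x.
    by apply: val_inj; rewrite val_circle_mul// tone_mul.
  have es1 : src (cp (circle_mul (circle_unit L x) (circle_unit L x))) = x' by rewrite mulE.
  have er1 : rng (cp (circle_mul (circle_unit L x) (circle_unit L x))) = x' by rewrite mulE.
  by rewrite /T -(circ_opM es1 er1); apply: circ_op_congr.
apply: dot_inj => w; rewrite -(circ_op_dot es er) -/T TT.
by rewrite -[RHS](circ_op_dot es er).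
Qed.

Lemma circ_op_inv (y : circle L) (x x' : obj G) es er es' er' (xi : H x) :
  circ_op (y := circle_inv y) (x := x') (z := x) es' er'
    (circ_op (y := y) es er xi) = xi.
Proof.
have mulE : circle_mul (circle_inv y) y = circle_unit L (src (cp y)).
  apply: val_inj; rewrite val_circle_mul ?cproj_inv ?src_inv// val_circle_inv.
  exact: tmulVs (circle_norm y).
have es1 : src (cp (circle_mul (circle_inv y) y)) = x by rewrite mulE /= -es;
  exact: src_unit.
have er1 : rng (cp (circle_mul (circle_inv y) y)) = x by rewrite mulE /= -es;
  exact: rng_unit.
have es2 : src (cp (circle_unit L (src (cp y)))) = x by rewrite -es; exact: src_unit.
have er2 : rng (cp (circle_unit L (src (cp y)))) = x by rewrite -es; exact: rng_unit.
by rewrite -(circ_opM es1 er1) (circ_op_congr es1 er1 es2 er2 xi mulE) circ_op_one.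
Qed.

(** Equivariance makes the extension independent of the chosen frame. *)
Lemma ext_opE (t : E) (z : R[i]) (y : circle L) (x x' : obj G) es er es' er' (xi : H x) :
  t = tscale z (val y) ->
  tot_op ext_op (t := t) (x := x) (y := x') es er xi = z *: circ_op (y := y) es' er' xi.
Proof.
move=> tE; move: es er; rewrite {t}tE => es er.
have [w wE] : exists w, val y = tscale w (val (circle_frame (cp y))).
  by apply: fibre_one_dim => //; exact: circle_norm.
have w1 : `|w| = 1.
  by have := circle_norm y; rewrite wE tnormZ circle_norm mulr1.
have yE : y = circle_scale w (circle_frame (cp y)).
  by apply: val_inj; rewrite val_circle_scale.
have co : frame_coord (z *: cvect y) = z * w.
  apply: (@tscale_inj (tot (frame (cp y)))); first exact: frame_norm.
  rewrite -frame_coordE -tscaleA -[tscale w _]wE /tscale /=.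
  by [].
have es1 : src (cp (circle_scale w (circle_frame (cp y)))) = x by rewrite -yE.
have er1 : rng (cp (circle_scale w (circle_frame (cp y)))) = x' by rewrite -yE.
rewrite (circ_op_congr es' er' es1 er1 xi yE) (circ_op_scale (z := w) (y :=
  circle_frame (cp y)) _ _ es' er')//.
rewrite /tot_op /ext_op -[bvect _]/(z *: cvect y) co hcastZ scalerA /circ_op.
by congr (_ *: _); rewrite (Prop_irrelevance es es') (Prop_irrelevance er er').
Qed.

Lemma ext_op_restrict (y : circle_extension L) (xi : H (src y)) :
  U y xi = ext_op (cvect y) xi.
Proof.
have h := ext_opE (t := val y) (y := y) erefl erefl erefl erefl xi (esym (tscale1 _)).
by rewrite scale1r in h; exact: esym h.
Qed.

Lemma ext_op_linear (g : G) (c : R[i]) (a b : L g) (xi : H (src g)) :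
  ext_op (c *: a + b) xi = c *: ext_op a xi + ext_op b xi.
Proof. by rewrite /ext_op frame_coord_lin scalerDl scalerA. Qed.

Lemma ext_op_bounded (g : G) (a : L g) : bounded_operator (ext_op a).
Proof.
have [lU iU _] := U_unitary (circle_frame g); split.
  by move=> c u v; rewrite /ext_op lU scalerDr !scalerA mulrC.
by move=> u; apply: cvgZr; exact: isometry_continuous.
Qed.

Lemma ext_op_mul (g h : G) (a : L g) (b : L h) (e : src g = rng h)
    (es : src (gmul g h) = src h) (er : rng (gmul g h) = rng g) (xi : H (src h)) :
  ext_op (fmul a b) (hcast (esym es) xi) =
  hcast (esym er) (ext_op a (hcast (esym e) (ext_op b xi))).
Proof.
apply: (can_inj (g := hcast (esym er)) (f := hcast er)) => [v|]; first exact: hcastK.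
rewrite hcastK -[LHS]/(tot_op ext_op (t := tmul (tot a) (tot b)) es er xi).
have abE : tmul (tot a) (tot b) = tscale (frame_coord a * frame_coord b)
    (val (circle_mul (circle_frame g) (circle_frame h))).
  rewrite (frame_coordE a) (frame_coordE b) val_circle_mul// tmulZl// tmulZr//.
  by rewrite tscaleA.
have es0 : src (cp (circle_mul (circle_frame g) (circle_frame h))) = src h.
  by rewrite /cproj val_circle_mul.
have er0 : rng (cp (circle_mul (circle_frame g) (circle_frame h))) = rng g.
  by rewrite /cproj val_circle_mul.
rewrite (ext_opE (t := tmul (tot a) (tot b)) es er es0 er0 xi abE).
rewrite (circ_opM (y1 := circle_frame g) (y2 :=
  circle_frame h) es0 er0 e erefl erefl erefl).
by rewrite -scalerA -circ_opZ.
Qed.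

Lemma ext_op_star (g : G) (a : L g) (es : src (ginv g) = rng g)
    (er : rng (ginv g) = src g) (xi : H (src g)) (eta : H (rng g)) :
  dot (ext_op a xi) eta = dot xi (hcast er (ext_op (fstar a) (hcast (esym es) eta))).
Proof.
rewrite -[hcast er _]/(tot_op ext_op (t := tstar (tot a)) es er eta).
have aE : tstar (tot a) = tscale (Num.conj (frame_coord a)) (val (circle_inv
  (circle_frame g))).
  by rewrite {1}(frame_coordE a) tstarZ val_circle_inv.
have es0 : src (cp (circle_inv (circle_frame g))) = rng g by rewrite cproj_inv.
have er0 : rng (cp (circle_inv (circle_frame g))) = src g by rewrite cproj_inv.
rewrite (ext_opE (t := tstar (tot a)) es er es0 er0 eta aE) dotZr conjCK /ext_op dotZl;
  congr (_ * _).
have [lU iU sU] := U_unitary (circle_frame g); have [v <-] := sU eta.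
rewrite iU; congr dot.
exact/esym/(circ_op_inv (y := circle_frame g) erefl erefl es0 er0).
Qed.

Lemma ext_op_nondegenerate (x : obj G) : dense (lspan [set w : H (rng (gunit x : G)) |
    exists (a : L (gunit x)) (xi : H (src (gunit x : G))), w = ext_op a xi]).
Proof.
move=> O [w Ow] _; exists w; split => //.
exists 1%N, (fun=> 1), (fun=> w); split;
  last by rewrite big_ord_recl big_ord0 addr0 scale1r.
move=> _; have [_ _ sU] := U_unitary (circle_frame (gunit x)); have [v vw] := sU w.
exists (frame (gunit x)), v; rewrite /ext_op (_ : frame_coord _ = 1) ?scale1r//.
by apply: (@tscale_inj (tot (frame (gunit x))));
  [exact: frame_norm|rewrite -frame_coordE tscale1].
Qed.

Let radon_nu : radon nu. Proof. by have [[]] := hU. Qed.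
Let nzH : negligible_for (integral_of nu) (~` nonzero_at H). Proof. by have [] := hU. Qed.

(** The matrix coefficient becomes, after pulling back to the circle extension, a
    matrix coefficient of [U] times a scalar that is continuous in every chart.
    Measurability descends because the pulled back function is constant on
    circles. *)
Lemma ext_op_measurable (f : forall g, L g) (xi : forall g : G, H (src g)) :
  Cc_section f -> measurable_section IG src H xi ->
  measurable_section IG rng H (fun g => ext_op (f g) (xi g)).
Proof.
move=> [cf _] mxi u hu; have [_ _ _ _ U_meas] := hU.
have lcS := circle_locally_compact (L := L) lcG hG.
have hC := circle_hausdorff (L := L) hG.
have PS := circle_functional L hG haar radon_nu.
have /choice[k kE] : forall y : circle L, exists z, tot (f (cp y)) = tscale z (val y).
  by move=> y; apply: fibre_one_dim => //; exact: circle_norm.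
apply: (@measurable_circle_push R G L lcG hG alpha nu).
pose h (y : circle_extension L) := dot (U y (xi (cp y))) (u (rng y)).
have -> : (fun y : circle L => dot (ext_op (f (cp y)) (xi (cp y))) (u (rng (cp y)))) =
    (fun y => k y * h y).
  apply/funext => y; rewrite /h -dotZl; congr dot.
  exact: (ext_opE (t := tot (f (cp y))) (y := y) erefl erefl erefl erefl _ (kE y)).
apply: (measurable_forM lcS hC PS); last first.
  apply: (U_meas (fun y => xi (cp y))) => // u' hu'.
  have h' := @measurable_circle_pull R G L lcG hG alpha haar nu radon_nu _ (mxi u' hu').
  exact: h'.
apply: (measurable_for_local lcS hC PS) => y0.
have [V [sg [c [[oV Vy0] n1 cE _ cc]]]] := bundle_chart L (cp y0).
have oW : open (cp @^-1` V) by exact: continuous_open (@continuous_cproj R G L) oV.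
exists (cp @^-1` V); split => //.
have mV := cara_open lcS hC PS oW.
have gen (t : E) : V (bproj t) -> t = tscale (c t) (tot (sg (bproj t))).
  by case: t => g a Vg; exact: (congr1 (@tot R G L g) (cE g a Vg)).
have kc (y : circle L) : (cp @^-1` V) y ->
    c (tot (f (cp y))) * Num.conj (c (val y)) = k y.
  move=> Vy; have yE : val y = tscale (c (val y)) (tot (sg (cp y))) by exact: gen.
  have nsg : tnorm (tot (sg (cp y))) = 1 by exact: n1.
  have c1 : `|c (val y)| = 1.
    by have := circle_norm y; rewrite {1}yE tnormZ nsg mulr1.
  have : c (tot (f (cp y))) = k y * c (val y).
    apply: (@tscale_inj (tot (sg (cp y)))) => //.
    rewrite -tscaleA -yE -kE; apply: (congr1 (@tot R G L (cp y))).
    exact: esym (cE _ (f (cp y)) Vy).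
  by move=> ->; rewrite -mulrA -normCK c1 expr1n mulr1.
suff mk : measurable_on IS (cp @^-1` V) (fun y : circle L =>
    c (tot (f (cp y))) * Num.conj (c (val y))) by exact: measurable_on_ext kc mk.
apply: (measurable_onM lcS hC PS) => //; apply: (measurable_on_continuous lcS hC PS oW);
  apply: continuous_in_subspaceT => y; rewrite inE => Vy.
  apply: (@continuous_comp _ _ _ (fun y : circle L => tot (f (cp y)) : E) c);
    last exact: cc.
  exact: (@continuous_comp _ _ _ cp (fun g => tot (f g) : E) y
    (@continuous_cproj R G L y) (cf (cp y))).
apply: (@continuous_comp _ _ _ (fun y : circle L => c (val y))
  (fun z : R[i]^o => (Num.conj (z : R[i]) : R[i]^o))); last exact: continuous_conj.
by apply: (continuous_comp (continuous_circle_val (x := y))); exact: cc.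
Qed.

Lemma ext_axioms : is_fell_rep alpha nu ext_op.
Proof.
have [[rad mH] nz qS _ _] := hU; split.
- by split.
- by split; [exact: ext_op_bounded | exact: ext_op_linear].
- by split; [exact: ext_op_mul | exact: ext_op_star | exact: ext_op_nondegenerate].
- exact: ext_op_measurable.
- exact/(quasi_invariant_extension L lcG hG haar radon_nu nzH).
Qed.

End CircleToFell.

(** * The bijection between classes *)

Section Classes.
Variables (T T' : Type) (E : T -> T -> Prop) (E' : T' -> T' -> Prop).
Hypotheses (Er : forall x, E x x) (Et' : forall x y z, E' x y -> E' y z -> E' x z).
Variable F : T -> T'.
Hypothesis EF : forall x y, E x y -> E' (F x) (F y).

Lemma class_image (C : eqv_classes E) :
  exists x', (fun z => exists x, sval C x /\ E' (F x) z) = E' x'.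
Proof.
case: C => C [x CE]; exists (F x) => /=; rewrite {}CE; apply: funext => z; apply: propext.
split=> [[y [xy yz]]|h]; last by exists x.
exact: Et' (EF xy) yz.
Qed.

(** The union of the classes of the images, so that no representative has to be
    chosen. *)
Definition class_map (C : eqv_classes E) : eqv_classes E' :=
  exist _ (fun z => exists x, sval C x /\ E' (F x) z) (class_image C).

Lemma class_mapE (x : T) : class_map (eqv_class E x) = eqv_class E' (F x).
Proof.
apply: eq_exist; apply: funext => z; apply: propext.
split=> [[y [xy yz]]|h]; last by exists x; split => //; exact: Er.
exact: Et' (EF xy) yz.
Qed.

End Classes.

Section Equivalences.
Variables (R : realType) (G : topGroupoid) (L : fell_line_bundle R G).
Variable alpha : obj G -> {measure set (borel G) -> \bar R}.

(** Equivalent representations share field and operators; this form exposes the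
    second one as a record over those of the first, so that transitivity needs no
    inversion of dependent equalities. *)
Lemma fell_rep_equivP (r r' : fell_rep L alpha) : fell_rep_equiv r r' <->
  exists nu' (h : is_fell_rep alpha nu' (fr_op (f := r))),
    equivalent (integral_of (fr_measure r)) (integral_of nu') /\ r' = FellRep h.
Proof.
split=> [[nu nu' H S hS hS' e]|]; first by exists nu', hS'.
by case: r => nu H S hS [nu' [h [e ->]]]; exact: FellRepEquiv.
Qed.

Lemma fell_rep_equiv_refl (r : fell_rep L alpha) : fell_rep_equiv r r.
Proof. by apply/fell_rep_equivP; exists (fr_measure r), (fr_axioms r); split => //;
  case: r. Qed.

Lemma fell_rep_equiv_trans (r1 r2 r3 : fell_rep L alpha) :
  fell_rep_equiv r1 r2 -> fell_rep_equiv r2 r3 -> fell_rep_equiv r1 r3.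
Proof.
move=> /fell_rep_equivP[nu2 [h2 [e2 ->]]] /fell_rep_equivP[nu3 [h3 [e3 ->]]].
apply/fell_rep_equivP; exists nu3, h3; split => // A.
by split => [/e2/e3|/e3/e2].
Qed.

Lemma groupoid_rep_equivP (r r' : circle_rep L alpha) : groupoid_rep_equiv r r' <->
  exists nu' (h : is_groupoid_rep (circle_haar (L := L) alpha) nu' (@gr_op _ _ _ r)),
    equivalent (integral_of (gr_measure r)) (integral_of nu') /\ r' = GroupoidRep h.
Proof.
split=> [[nu nu' H S hS hS' e]|]; first by exists nu', hS'.
by case: r => nu H S hS [nu' [h [e ->]]]; exact: GroupoidRepEquiv.
Qed.

Lemma groupoid_rep_equiv_refl (r : circle_rep L alpha) : groupoid_rep_equiv r r.
Proof. by apply/groupoid_rep_equivP; exists (gr_measure r), (gr_axioms r); split => //;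
  case: r. Qed.

Lemma groupoid_rep_equiv_trans (r1 r2 r3 : circle_rep L alpha) :
  groupoid_rep_equiv r1 r2 -> groupoid_rep_equiv r2 r3 -> groupoid_rep_equiv r1 r3.
Proof.
move=> /groupoid_rep_equivP[nu2 [h2 [e2 ->]]] /groupoid_rep_equivP[nu3 [h3 [e3 ->]]].
apply/groupoid_rep_equivP; exists nu3, h3; split => // A.
by split => [/e2/e3|/e3/e2].
Qed.

Lemma fell_rep_eq nu (H : hilbert_field R (obj G))
    (S S' : forall g : G, L g -> H (src g) -> H (rng g))
    (hS : is_fell_rep alpha nu S) (hS' : is_fell_rep alpha nu S') :
  S = S' -> FellRep hS = FellRep hS'.
Proof. by move=> SS'; case: S' / SS' hS' => hS'; rewrite (Prop_irrelevance hS hS'). Qed.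

Lemma groupoid_rep_eq nu (H : hilbert_field R (obj G))
    (U U' : forall y : circle_extension L, H (src y) -> H (rng y))
    (hU : is_groupoid_rep (circle_haar (L := L) alpha) nu U)
    (hU' : is_groupoid_rep (circle_haar (L := L) alpha) nu U') :
  U = U' -> GroupoidRep hU = GroupoidRep hU'.
Proof. by move=> UU'; case: U' / UU' hU' => hU'; rewrite (Prop_irrelevance hU hU'). Qed.

Hypotheses (lcG : locally_compact [set: G]) (hG : hausdorff_space G).
Hypothesis haar : haar_system alpha.

Lemma restrict_equivariant (rho : fell_rep L alpha) :
  equivariant (GroupoidRep (restrict_axioms lcG hG haar (fr_axioms rho))).
Proof. by move=> z y z1 es er xi; exact: (restrict_op_scale (fr_axioms rho) z1). Qed.

Definition restrict_rep (rho : fell_rep L alpha) : equivariant_rep L alpha :=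
  exist (fun r : circle_rep L alpha => equivariant r) _ (@restrict_equivariant rho).

Definition extend_rep (tau : equivariant_rep L alpha) : fell_rep L alpha :=
  FellRep (ext_axioms lcG hG haar (gr_axioms (sval tau)) (svalP tau)).

Lemma restrict_repK : cancel restrict_rep extend_rep.
Proof.
case=> nu H S hS; apply: fell_rep_eq.
apply: functional_extensionality_dep => g; apply: funext => a; apply: funext => xi.
have [_ [_ S_linear] _ _ _] := hS.
rewrite /ext_op -(S_scale S_linear); congr (S _ _ _); apply: tot_inj.
exact/esym/frame_coordE.
Qed.

Lemma extend_repK : cancel extend_rep restrict_rep.
Proof.
case=> -[nu H U hU] hE; apply: eq_exist; apply: groupoid_rep_eq.
apply: functional_extensionality_dep => y; apply: funext => xi.
exact: (esym (ext_op_restrict hE xi)).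
Qed.

Lemma restrict_rep_equiv (r r' : fell_rep L alpha) :
  fell_rep_equiv r r' -> equivariant_rep_equiv (restrict_rep r) (restrict_rep r').
Proof. by case=> nu nu' H S hS hS' e; exact: GroupoidRepEquiv. Qed.

Lemma extend_rep_equiv (t t' : equivariant_rep L alpha) :
  equivariant_rep_equiv t t' -> fell_rep_equiv (extend_rep t) (extend_rep t').
Proof.
case: t t' => r h [r' h']; rewrite /equivariant_rep_equiv /= => e.
by case: r r' / e h h' => nu nu' H U hU hU' e h h'; exact: FellRepEquiv.
Qed.

Lemma restrict_rep_restricts (rho : fell_rep L alpha) :
  restricts_to rho (sval (restrict_rep rho)).
Proof. by case: rho => nu H S hS; exact: RestrictsTo. Qed.

End Equivalences.

Theorem theorem11p1 (R : realType) (G : topGroupoid)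
    (G_locally_compact : locally_compact [set: G])
    (G_hausdorff : hausdorff_space G)
    (alpha : obj G -> {measure set (borel G) -> \bar R})
    (alpha_haar : haar_system alpha)
    (L : fell_line_bundle R G) :
  exists Phi : eqv_classes (@fell_rep_equiv R G L alpha) ->
               eqv_classes (@equivariant_rep_equiv R G L alpha),
    bijective Phi /\
    forall rho : fell_rep L alpha, exists tau : equivariant_rep L alpha,
      Phi (eqv_class (@fell_rep_equiv R G L alpha) rho) =
        eqv_class (@equivariant_rep_equiv R G L alpha) tau /\
      restricts_to rho (sval tau).
Proof.
pose E := @fell_rep_equiv R G L alpha.
pose E' := @equivariant_rep_equiv R G L alpha.
have Er (x : fell_rep L alpha) : E x x by exact: fell_rep_equiv_refl.
have Et (x y z : fell_rep L alpha) : E x y -> E y z -> E x z by exact: fell_rep_equiv_trans.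
have Er' (x : equivariant_rep L alpha) : E' x x by exact: groupoid_rep_equiv_refl.
have Et' (x y z : equivariant_rep L alpha) : E' x y -> E' y z -> E' x z.
  by exact: groupoid_rep_equiv_trans.
pose F := @restrict_rep R G L alpha G_locally_compact G_hausdorff alpha_haar.
pose K := @extend_rep R G L alpha G_locally_compact G_hausdorff alpha_haar.
have FK : cancel F K by exact: restrict_repK.
have KF : cancel K F by exact: extend_repK.
have EF (x y : fell_rep L alpha) : E x y -> E' (F x) (F y) by exact: restrict_rep_equiv.
have EK (x y : equivariant_rep L alpha) :
  E' x y -> E (K x) (K y) by exact: extend_rep_equiv.
exists (class_map Er Et' EF); split.
  exists (class_map Er' Et EK) => -[C [x xE]].
    have -> : exist _ C (ex_intro _ x xE) = eqv_class E x by exact: eq_exist.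
    by rewrite !class_mapE FK.
  have -> : exist _ C (ex_intro _ x xE) = eqv_class E' x by exact: eq_exist.
  by rewrite !class_mapE KF.
move=> rho; exists (F rho); split; first exact: class_mapE.
exact: restrict_rep_restricts.
Qed.
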